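(* Assume the standing hypotheses (A1)–(A4) on $\varphi,\psi,g,h$ and the conditions (D) on the data $(\alpha_0,\beta_0,\gamma_0,v_0)\in X$ stated in the context, and assume in addition that for each $\delta\in(0,1)$ $$\alpha_0'\in L^{3p}(\delta,1)\cap L^q(\delta,1).$$ Let $(\alpha,\beta,\gamma,v)\in\mathcal{A}_\lambda$ be the minimizer of $I$ over $\mathcal{A}_\lambda$. With $\Xi$, $\Gamma^0$, $G$, $\Omega$ as in the context, set (sum over $i=1,\dots,7$) $$G_1(\rho)=G_{,i}(\Xi)\,\Omega^i_{,1}(\Gamma^0),\qquad G_2(\rho)=G_{,i}(\Xi)\big(\Omega^i_{,2}(\Gamma^0)+\Omega^i_{,3}(\Gamma^0)\big).$$ Then, for each $\delta\in(0,1)$, $$\rho^{2/3}G_1(\rho)\in W^{1,1}(\delta,1),\qquad \rho^{-1/3}G_2(\rho)\in L^1(\delta,1),$$ and there is a constant $c$ such that for a.e. $\rho\in(0,1)$ $$3\rho^{2/3}G_1(\rho)=\int_1^\rho\Big(s^{-1/3}G_2(s)+\frac{v(s)-v_0(s)}{\tau}\Big)ds+c.$$ Moreover, for each $\delta\in(0,1)$, $\alpha'\in L^{3p}(\delta,1)\cap L^q(\delta,1)$.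
   Context: Constants: $1<p,q<\infty$, $\lambda>0$, time step $\tau>0$. All functions of $\rho$ live on $(0,1)$, and $'$ denotes the (weak) derivative in $\rho$ (or the ordinary derivative for $\varphi,\psi,g,h$). $\mathbb{R}_+=(0,\infty)$. Constitutive functions $\varphi,g:\mathbb{R}\to\mathbb{R}$, $h:\mathbb{R}_+\to\mathbb{R}$, and $\psi(x)=\varphi(x^{1/3})$ for $x\in\mathbb{R}$ (real cube root), satisfy: (A1) $\lim_{\delta\to0+}h(\delta)=\lim_{\delta\to+\infty}h(\delta)/\delta=+\infty$; (A2) $\varphi,\psi,g\in C^2(\mathbb{R})$, $h\in C^2(\mathbb{R}_+)$, $\varphi,\psi,g,h,\varphi'',\psi'',g''\ge0$ and $h''>0$; (A3) for some constants $c_1,c_2>0$, $\lim_{|x|\to\infty}\frac{\varphi(x)}{|x|^{3p}}=\lim_{|x|\to\infty}\frac{\psi(x)}{|x|^p}=c_1$ and $\lim_{|x|\to\infty}\frac{g(x)}{|x|^q}=c_2$; (A4) for some constants $C_1,C_2,C_3>0$, $\limsup_{|x|\to\infty}\frac{|\varphi'(x)|}{|x|^{3p-1}}\le C_1$, $\limsup_{|x|\to\infty}\frac{|\psi'(x)|}{|x|^{p-1}}\le C_2$, $\limsup_{|x|\to\infty}\frac{|g'(x)|}{|x|^{q-1}}\le C_3$. Function spaces: $X_1=\{f\in W^{1,1}(0,1): f/\rho\in L^p(0,1)\}$, $X_2=\{f\in L^1_{loc}(0,1): f\rho^{2/3}\in L^{3p}(0,1)\}$, $X_3=\{f\in W^{1,1}_{loc}(0,1):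 f/\rho^{2/3}\in L^q(0,1),\ f'\rho^{1/3}\in L^q(0,1)\}$, $Y=\{f\in W^{1,1}_{loc}(0,1): f\in L^2(0,1),\ f'\rho^{2/3}\in L^{3p}(0,1)\}$, $X=X_1\times X_2\times X_3\times Y$. Values such as $\alpha(0),\alpha(1)$ refer to the continuous representative. Energy density: for $(\alpha,\beta,\gamma)$ with $\alpha'>0$ a.e., $$E(\alpha,\beta,\gamma)(\rho)=\varphi(\beta\rho^{2/3})+2\psi(\alpha/\rho)+g(\gamma/\rho^{2/3})+2g\big(\tfrac32\gamma'\rho^{1/3}\big)+h(\alpha').$$ Data conditions (D): $(\alpha_0,\beta_0,\gamma_0,v_0)\in X$, $\alpha_0(1)=\lambda$, $\alpha_0\ge0$, $\alpha_0'>0$ a.e. on $(0,1)$, and $\int_0^1\big(\tfrac12v_0^2+E(\alpha_0,\beta_0,\gamma_0)\big)d\rho<\infty$. Functional: $I(\alpha,\beta,\gamma,v)=\int_0^1\big(\tfrac12(v-v_0)^2+E(\alpha,\beta,\gamma)\big)d\rho\in[0,\infty]$ for $(\alpha,\beta,\gamma,v)\in X$ with $\alpha'>0$ a.e. Admissible set: $\mathcal{A}_\lambda$ is the set of $(\alpha,\beta,\gamma,v)\in X$ such that $\alpha(0)\ge0$, $\alpha(1)=\lambda$, $\alpha'>0$ a.e., $I(\alpha,\beta,\gamma,v)<\infty$, and $$\frac{\beta-\beta_0}{\tau}=3v',\qquad \frac{\alpha-\alpha_0}{\tau}=3\alpha_0^{2/3}v,\qquad \frac{\gamma-\gamma_0}{\tau}=2\alpha_0^{1/3}v.$$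 Functions $G$, $\Omega$ (both depend explicitly on $\rho$; this dependence is suppressed in the notation): for $\Xi=(\xi_1,\dots,\xi_7)$ with $\xi_7>0$ and $V=(v_1,v_2,v_3)$, $$G(\Xi;\rho)=\varphi(\xi_1)+\psi(\xi_2)+\psi(\xi_3)+g(\xi_4\rho^{-1/3})+g(\xi_5\rho^{-1/3})+g(\xi_6\rho^{-1/3})+h(\xi_7\rho^{-2/3}),$$ $$\Omega(V;\rho)=\big(v_1,\ v_2^3,\ v_3^3,\ v_2v_3\rho^{1/3},\ v_1v_3\rho^{1/3},\ v_1v_2\rho^{1/3},\ v_1v_2v_3\rho^{2/3}\big).$$ $G_{,i}=\partial G/\partial\xi_i$ and $\Omega^i_{,j}=\partial\Omega^i/\partial v_j$ (derivatives at fixed $\rho$). Here $$\Xi(\rho)=\Big(\beta\rho^{2/3},\frac{\alpha}{\rho},\frac{\alpha}{\rho},\frac{\gamma}{\rho^{1/3}},\frac{3\gamma'}{2}\rho^{2/3},\frac{3\gamma'}{2}\rho^{2/3},\alpha'\rho^{2/3}\Big),\quad \Gamma^0(\rho)=\Big(\alpha_0'(\rho/\alpha_0)^{2/3},(\alpha_0/\rho)^{1/3},(\alpha_0/\rho)^{1/3}\Big).$$ (With these, $G(\Xi)=E(\alpha,\beta,\gamma)$.) *)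

(* Defs.v *)
From mathcomp Require Import all_boot all_order all_algebra.
From mathcomp Require Import all_classical all_reals all_analysis.

Set Implicit Arguments.
Unset Strict Implicit.
Unset Printing Implicit Defensive.
Import Order.TTheory GRing.Theory Num.Theory.
Import numFieldNormedType.Exports.

Local Open Scope ring_scope.
Local Open Scope classical_set_scope.

(* Functions on an interval `]a, b[ are total functions R -> R; every notion
   below depends only on their almost-everywhere class on `]a, b[.
   Measurability in the library is Borel measurability, so membership in a
   Lebesgue space asks for a Borel representative of the class. *)

Definition ae_on (R : realType) (a b : R) (P : R -> Prop) : Prop :=
  {ae @lebesgue_measure R, forall x, x \in `]a, b[ -> P x}.

Definition in_Lp (R : realType) (a b r : R) (f : R -> R) : Prop :=
  exists2 g : R -> R, g \_ `]a, b[ \in Lfun (@lebesgue_measure R) r%:E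
                    & ae_on a b (fun x => f x = g x).

Definition in_L1loc (R : realType) (a b : R) (f : R -> R) : Prop :=
  exists2 g : R -> R, locally_integrable `]a, b[ g
                    & ae_on a b (fun x => f x = g x).

Definition test_function (R : realType) (a b : R) (u : R -> R) : Prop :=
  (forall n x, derivable u^`(n) x 1) /\
  exists c d, [/\ a < c, d < b & forall x, x \notin `[c, d] -> u x = 0].

Definition is_weak_derivative (R : realType) (a b : R) (f f' : R -> R) : Prop :=
  [/\ in_L1loc a b f, in_L1loc a b f' &
      forall u, test_function a b u ->
        \int[@lebesgue_measure R]_(x in `]a, b[) (f x * u^`()%classic x) =
        - \int[@lebesgue_measure R]_(x in `]a, b[) (f' x * u x)].

(* A version of the weak derivative of f on `]a, b[; it is unique up to
   almost-everywhere equality, and junk when there is none. *)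
Definition wderiv (R : realType) (a b : R) (f : R -> R) : R -> R :=
  xget (cst 0) [set f' | is_weak_derivative a b f f'].

Definition in_W11loc (R : realType) (a b : R) (f : R -> R) : Prop :=
  exists f', is_weak_derivative a b f f'.

Definition in_W11 (R : realType) (a b : R) (f : R -> R) : Prop :=
  [/\ in_W11loc a b f, in_Lp a b 1 f & in_Lp a b 1 (wderiv a b f)].

(* The continuous representative on `[0, 1] of a function on `]0, 1[ (junk
   when there is none). *)
Definition crep (R : realType) (f : R -> R) : R -> R :=
  xget (cst 0) [set g : R -> R | {within `[0, 1], continuous g} /\
                        ae_on 0 1 (fun x => f x = g x)].

Definition norm_infty (R : realType) : set_system R :=
  [set A | \forall M \near +oo, forall x, M < `|x| -> A x].
Arguments norm_infty : clear implicits.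

Definition C2_on (R : realType) (D : set R) (f : R -> R) : Prop :=
  forall x, D x ->
    [/\ derivable f x 1, derivable f^`() x 1 & {for x, continuous f^`(2)}].

Definition cbrt (R : realType) (x : R) : R := Num.sg x * `|x| `^ 3^-1.

Definition psi (R : realType) (phi : R -> R) : R -> R := fun x => phi (cbrt x).

(* h is only meaningful on `]0, +oo[. *)
Definition blowup_growth (R : realType) (h : R -> R) : Prop :=
  (h x @[x --> 0^'+] --> +oo) /\ (h x / x @[x --> +oo] --> +oo).

Definition smooth_convex (R : realType) (phi g h : R -> R) : Prop :=
  [/\ [/\ C2_on setT phi, C2_on setT (psi phi), C2_on setT g
        & C2_on `]0, +oo[ h],
      forall x, [/\ 0 <= phi x, 0 <= psi phi x & 0 <= g x],
      forall x, [/\ 0 <= phi^`(2) x, 0 <= (psi phi)^`(2) x & 0 <= g^`(2) x]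
    & forall x, 0 < x -> 0 <= h x /\ 0 < h^`(2) x].

Definition power_growth (R : realType) (p q : R) (phi g : R -> R) : Prop :=
  exists c1 c2 : R,
    [/\ 0 < c1 /\ 0 < c2,
        phi x / `|x| `^ (3 * p) @[x --> norm_infty R] --> c1,
        psi phi x / `|x| `^ p @[x --> norm_infty R] --> c1
      & g x / `|x| `^ q @[x --> norm_infty R] --> c2].

Definition derivative_growth (R : realType) (p q : R) (phi g : R -> R) : Prop :=
  exists C1 C2 C3 : R,
    [/\ [/\ 0 < C1, 0 < C2 & 0 < C3],
        (limf_esup (fun x => (`|phi^`()%classic x| / `|x| `^ (3 * p - 1))%:E)
           (norm_infty R) <= C1%:E)%E,
        (limf_esup (fun x => (`|(psi phi)^`()%classic x| / `|x| `^ (p - 1))%:E)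
           (norm_infty R) <= C2%:E)%E
      & (limf_esup (fun x => (`|g^`()%classic x| / `|x| `^ (q - 1))%:E)
           (norm_infty R) <= C3%:E)%E].

Definition in_X1 (R : realType) (p : R) (f : R -> R) : Prop :=
  in_W11 0 1 f /\ in_Lp 0 1 p (fun x => f x / x).

Definition in_X2 (R : realType) (p : R) (f : R -> R) : Prop :=
  in_L1loc 0 1 f /\ in_Lp 0 1 (3 * p) (fun x => f x * x `^ (2 / 3)).

Definition in_X3 (R : realType) (q : R) (f : R -> R) : Prop :=
  [/\ in_W11loc 0 1 f, in_Lp 0 1 q (fun x => f x / x `^ (2 / 3))
    & in_Lp 0 1 q (fun x => wderiv 0 1 f x * x `^ (1 / 3))].

Definition in_Y (R : realType) (p : R) (f : R -> R) : Prop :=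
  [/\ in_W11loc 0 1 f, in_Lp 0 1 2 f
    & in_Lp 0 1 (3 * p) (fun x => wderiv 0 1 f x * x `^ (2 / 3))].

Definition in_X (R : realType) (p q : R) (al be ga v : R -> R) : Prop :=
  [/\ in_X1 p al, in_X2 p be, in_X3 q ga & in_Y p v].

Definition energy (R : realType) (phi g h al be ga : R -> R) (x : R) : R :=
  phi (be x * x `^ (2 / 3)) + 2 * psi phi (al x / x) + g (ga x / x `^ (2 / 3))
  + 2 * g (3 / 2 * wderiv 0 1 ga x * x `^ (1 / 3)) + h (wderiv 0 1 al x).

Definition admissible_data (R : realType) (p q lam : R)
    (phi g h al0 be0 ga0 v0 : R -> R) : Prop :=
  [/\ in_X p q al0 be0 ga0 v0, crep al0 1 = lam,
      ae_on 0 1 (fun x => 0 <= al0 x), ae_on 0 1 (fun x => 0 < wderiv 0 1 al0 x)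
    & (\int[@lebesgue_measure R]_(x in `]0%R, 1%R[)
         (1 / 2 * v0 x ^+ 2 + energy phi g h al0 be0 ga0 x)%:E < +oo)%E].

Definition functional (R : realType) (phi g h v0 al be ga v : R -> R) : \bar R :=
  (\int[@lebesgue_measure R]_(x in `]0%R, 1%R[)
     (1 / 2 * (v x - v0 x) ^+ 2 + energy phi g h al be ga x)%:E)%E.

Definition admissible (R : realType) (p q lam tau : R)
    (phi g h al0 be0 ga0 v0 al be ga v : R -> R) : Prop :=
  [/\ in_X p q al be ga v,
      0 <= crep al 0 /\ crep al 1 = lam,
      ae_on 0 1 (fun x => 0 < wderiv 0 1 al x),
      (functional phi g h v0 al be ga v < +oo)%E
    & [/\ ae_on 0 1 (fun x => (be x - be0 x) / tau = 3 * wderiv 0 1 v x),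
          ae_on 0 1 (fun x => (al x - al0 x) / tau = 3 * al0 x `^ (2 / 3) * v x)
        & ae_on 0 1
            (fun x => (ga x - ga0 x) / tau = 2 * al0 x `^ (1 / 3) * v x)]].

Definition is_minimizer (R : realType) (p q lam tau : R)
    (phi g h al0 be0 ga0 v0 al be ga v : R -> R) : Prop :=
  admissible p q lam tau phi g h al0 be0 ga0 v0 al be ga v /\
  forall al1 be1 ga1 v1,
    admissible p q lam tau phi g h al0 be0 ga0 v0 al1 be1 ga1 v1 ->
    (functional phi g h v0 al be ga v <= functional phi g h v0 al1 be1 ga1 v1)%E.

(* Components of vectors are numbered from 0: xi_i is X 0 (i - 1); the numerals
   below are elements of 'I_7 and 'I_3. *)
Definition Gfun (R : realType) (phi g h : R -> R) (x : R) (X : 'rV[R]_7) : R :=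
  phi (X 0 0) + psi phi (X 0 1) + psi phi (X 0 2)
  + g (X 0 3 * x `^ (- (1 / 3))) + g (X 0 4 * x `^ (- (1 / 3)))
  + g (X 0 5 * x `^ (- (1 / 3))) + h (X 0 6 * x `^ (- (2 / 3))).

Definition Omega (R : realType) (x : R) (V : 'rV[R]_3) : 'rV[R]_7 :=
  \row_(i < 7) nth 0
    [:: V 0 0; V 0 1 ^+ 3; V 0 2 ^+ 3;
        V 0 1 * V 0 2 * x `^ (1 / 3); V 0 0 * V 0 2 * x `^ (1 / 3);
        V 0 0 * V 0 1 * x `^ (1 / 3); V 0 0 * V 0 1 * V 0 2 * x `^ (2 / 3)] i.

Definition partial (R : realType) (n : nat) (i : 'I_n.+1)
    (F : 'rV[R]_n.+1 -> R) (X : 'rV[R]_n.+1) : R := 'D_(delta_mx 0 i) F X.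

Definition Xi (R : realType) (al be ga : R -> R) (x : R) : 'rV[R]_7 :=
  \row_(i < 7) nth 0
    [:: be x * x `^ (2 / 3); al x / x; al x / x; ga x / x `^ (1 / 3);
        3 * wderiv 0 1 ga x / 2 * x `^ (2 / 3);
        3 * wderiv 0 1 ga x / 2 * x `^ (2 / 3);
        wderiv 0 1 al x * x `^ (2 / 3)] i.

Definition Gamma0 (R : realType) (al0 : R -> R) (x : R) : 'rV[R]_3 :=
  \row_(i < 3) nth 0
    [:: wderiv 0 1 al0 x * (x / al0 x) `^ (2 / 3);
        (al0 x / x) `^ (1 / 3); (al0 x / x) `^ (1 / 3)] i.

Definition G1 (R : realType) (phi g h al0 al be ga : R -> R) (x : R) : R :=
  \sum_(i < 7) partial i (Gfun phi g h x) (Xi al be ga x) *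
    partial 0 (fun V => Omega x V 0 i) (Gamma0 al0 x).

Definition G2 (R : realType) (phi g h al0 al be ga : R -> R) (x : R) : R :=
  \sum_(i < 7) partial i (Gfun phi g h x) (Xi al be ga x) *
    (partial 1 (fun V => Omega x V 0 i) (Gamma0 al0 x) +
     partial 2 (fun V => Omega x V 0 i) (Gamma0 al0 x)).

(* Main.v *)
(* Let r = rho^(1/3) and s = alpha_0^(1/3). For theta supported compactly in (0, 1), with mean
   zero and primitive eta, move v by t eta / s^2 and alpha, beta, gamma as the constraints
   dictate. Then alpha' moves by 3 tau t theta, so that for theta bounded and supported where
   alpha' is bounded away from 0 and infinity these are admissible competitors when |t| <= 1.
   The energy is convex in t, hence its difference quotients at t = 0 are controlled by its
   values at t = 1 and t = -1, and one may differentiate under the integral sign: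
   int (A theta + B eta) = 0, where A = 3 tau r^2 G1 / s^2 and B gathers the terms in eta.
   Integrating by parts, W = A - int_1^rho B is orthogonal to every such theta. Taking for
   theta the truncation of W minus its mean to an exhausting sequence of sets shows that W is
   constant almost everywhere. Multiplying A = int_1^rho B + k by s^2 and differentiating,
   3 tau r^2 G1 has the derivative tau G2 / r + v - v_0, which is the identity claimed.
   Finally the constraints express gamma' and alpha' through alpha_0', gamma_0', v and s v';
   this transfers the integrability of alpha_0' to alpha'. *)

Require Import Defs.
From mathcomp Require Import all_boot all_order all_algebra.
From mathcomp Require Import all_classical all_reals all_analysis.
From mathcomp Require Import measurable_realfun ring lra.
Set Implicit Arguments.
Unset Strict Implicit.
Unset Printing Implicit Defensive.
Import Order.TTheory GRing.Theory Num.Theory.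
Import numFieldNormedType.Exports.
Local Open Scope ring_scope.
Local Open Scope classical_set_scope.

(** * Integrals and almost everywhere relations *)

Section ae_integral.
Context {R : realType}.
Notation mu := (@lebesgue_measure R).
Implicit Types (D : set R).

Import HBNNSimple.

(** No upper growth bound is imposed on [h], so a competitor must change [alpha'] in a controlled
    way at almost every point. Since [alpha = alpha_0 + 3 tau s^2 v], a generic variation of [v]
    would bring the unbounded [alpha_0'] into [alpha']. Dividing by [s^2] removes it: [alpha] moves
    by [3 tau t eta]. The price is that [alpha_0'] reappears in [beta] and [gamma'], through the
    derivatives of [eta / s^2] and [eta / s], and has to be integrable there with the exponents
    [3 p] and [q] of the terms in [phi] and [g]. This is what the extra hypothesis on [alpha_0']
    pays for. The sets where [alpha'] is controlled are only measurable, so [theta] is bounded and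
    measurable, and [eta] is Lipschitz rather than smooth. Weak derivatives are therefore exchanged
    for locally absolutely continuous representatives, whose calculus (chain rule, product rule,
    uniqueness) carries the proof; smooth test functions serve only to pass between the two
    notions. *)

Lemma aeS (P Q : R -> Prop) : (forall x, P x -> Q x) ->
  {ae mu, forall x, P x} -> {ae mu, forall x, Q x}.
Proof. by move=> PQ; apply: (@filterS _ _ (ae_filter_ringOfSetsType mu)) => x; exact: PQ. Qed.

Lemma aeS2 (P Q S : R -> Prop) : (forall x, P x -> Q x -> S x) ->
  {ae mu, forall x, P x} -> {ae mu, forall x, Q x} -> {ae mu, forall x, S x}.
Proof. by move=> PQ; apply: (@filterS2 _ _ (ae_filter_ringOfSetsType mu)) => x; exact: PQ. Qed.

Lemma aeS3 (P Q S T : R -> Prop) : (forall x, P x -> Q x -> S x -> T x) ->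
  {ae mu, forall x, P x} -> {ae mu, forall x, Q x} -> {ae mu, forall x, S x} ->
  {ae mu, forall x, T x}.
Proof. by move=> PQ; apply: (@filterS3 _ _ (ae_filter_ringOfSetsType mu)) => x; exact: PQ. Qed.

(* Neither function need be measurable: the integral of a nonnegative function
   is a supremum over the simple functions below it. *)
Lemma ge0_le_integral_ae (D : set R) (f g : R -> \bar R) :
  (forall x, D x -> 0 <= f x)%E -> (forall x, D x -> 0 <= g x)%E ->
  {ae mu, forall x, D x -> (f x <= g x)%E} ->
  (\int[mu]_(x in D) f x <= \int[mu]_(x in D) g x)%E.
Proof.
move=> f0 g0 [N [mN N0 DN]].
rewrite ge0_integralE// [leRHS]ge0_integralE//.
apply: ge_ereal_sup => /= _ [h hf <-].
have mNC := measurableC mN.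
(* The simple function [h] below [f] is multiplied by the indicator of the complement of [N]: the
   product lies below [g] everywhere, and it has the same integral because [N] is null. *)
apply: le_trans (ereal_sup_ubound _); last first.
  exists (proj_nnsfun h mNC) => //= x.
  rewrite mindicE /=.
  have [xN|xN] := boolP (x \in ~` N).
    rewrite mulr1 (le_trans (hf x))//.
    rewrite /patch; case: ifPn => // /set_mem Dx; apply: contrapT => fg.
    by move/set_mem: xN; apply; apply: DN => /= /(_ Dx).
  rewrite mulr0 /patch; case: ifPn => // /set_mem; exact: g0.
rewrite -!integralT_nnsfun/=.
rewrite (ge0_negligible_integral mN)//=; last 2 first.
- exact/measurable_EFinP.
- by move=> x _; rewrite lee_fin.
rewrite setTD integral_mkcond.
rewrite le_eqVlt; apply/orP; left; apply/eqP; apply: eq_integral => x _.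
by rewrite /patch mindicE; case: ifPn => xN; rewrite ?mulr1 ?mulr0.
Qed.

Lemma eq_integral_ae (D : set R) (f g : R -> \bar R) :
  {ae mu, forall x, D x -> f x = g x} ->
  (\int[mu]_(x in D) f x = \int[mu]_(x in D) g x)%E.
Proof.
move=> fg; rewrite integralE [RHS]integralE.
have fgp : {ae mu, forall x, D x -> (f^\+ x = g^\+ x)%E}.
  by apply: aeS fg => x fg Dx; rewrite !funeposE fg.
have fgn : {ae mu, forall x, D x -> (f^\- x = g^\- x)%E}.
  by apply: aeS fg => x fg Dx; rewrite !funenegE fg.
have le (u v : R -> \bar R) : {ae mu, forall x, D x -> u x = v x} ->
    {ae mu, forall x, D x -> (u x <= v x)%E} /\ {ae mu, forall x, D x -> (v x <= u x)%E}.
  by move=> uv; split; apply: aeS uv => x uv Dx; rewrite uv.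
have [lep gep] := le _ _ fgp; have [len gen] := le _ _ fgn.
by congr (_ - _)%E; apply/eqP; rewrite eq_le; apply/andP; split;
  apply: ge0_le_integral_ae.
Qed.

Lemma eq_Rintegral_ae (D : set R) (f g : R -> R) :
  {ae mu, forall x, D x -> f x = g x} ->
  \int[mu]_(x in D) f x = \int[mu]_(x in D) g x.
Proof.
move=> fg; congr fine; apply: eq_integral_ae.
by apply: aeS fg => x fg Dx; rewrite fg.
Qed.

Lemma itv_subset_ae (a b c d : R) (P : R -> Prop) :
  a <= c -> d <= b -> ae_on a b P -> ae_on c d P.
Proof.
move=> ac db; apply: aeS => x + /=; rewrite !inE/= !in_itv/=.
move=> h /andP[cx xd]; apply: h; by rewrite (le_lt_trans ac)//= (lt_le_trans xd).
Qed.

Lemma ae_onP (a b : R) (P : R -> Prop) :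
  ae_on a b P <-> {ae mu, forall x, a < x < b -> P x}.
Proof.
by split; apply: aeS => x; rewrite inE/= in_itv/=.
Qed.

Lemma integrable_le (D : set R) (f g : R -> R) : measurable D ->
  measurable_fun D f -> mu.-integrable D (EFin \o g) ->
  (forall x, D x -> `|f x| <= g x) -> mu.-integrable D (EFin \o f).
Proof.
move=> mD mf ig fg; apply: le_integrable ig => //.
  exact/measurable_EFinP.
move=> x Dx /=; rewrite lee_fin (le_trans (fg _ Dx))//.
by rewrite ler_norm.
Qed.

Lemma integrable_ae_eq (D : set R) (f g : R -> R) : measurable D ->
  mu.-integrable D (EFin \o f) -> measurable_fun D g ->
  {ae mu, forall x, D x -> f x = g x} -> mu.-integrable D (EFin \o g).
Proof.
move=> mD /integrableP[mf foo] mg fg; apply/integrableP; split.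
  exact/measurable_EFinP.
rewrite -(@eq_integral_ae D (fun x => `|(EFin \o f) x|)%E)//.
by apply: aeS fg => x fg Dx /=; rewrite fg.
Qed.

Lemma integrable_bounded (a b M : R) (f : R -> R) (D : set R) :
  measurable D -> D `<=` `[a, b] ->
  measurable_fun D f -> (forall x, D x -> `|f x| <= M) ->
  mu.-integrable D (EFin \o f).
Proof.
move=> mD Dab mf fM; apply: measurable_bounded_integrable => //.
  rewrite (le_lt_trans (le_measure mu _ _ Dab)) ?inE//.
  by rewrite /= lebesgue_measure_itv/=; case: ifPn => _; rewrite ?ltry -?EFinB ?ltry.
exists M; split; first exact: num_real.
by move=> N MN x Dx; apply: le_trans (ltW MN); exact: fM.
Qed.

Lemma integrable_scale (D : set R) (f : R -> R) (k : R) : measurable D ->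
  mu.-integrable D (EFin \o f) -> mu.-integrable D (EFin \o (fun x => k * f x)).
Proof.
move=> mD fi; have := integrableZl (mu := mu) mD k fi.
by apply: eq_integrable => // x _ /=; rewrite EFinM.
Qed.

Lemma integrable_add (D : set R) (f g : R -> R) : measurable D ->
  mu.-integrable D (EFin \o f) -> mu.-integrable D (EFin \o g) ->
  mu.-integrable D (EFin \o (fun x => f x + g x)).
Proof.
move=> mD fi gi; have := integrableD (mu := mu) mD fi gi.
by apply: eq_integrable => // x _ /=; rewrite EFinD.
Qed.

Lemma integrable_sub (D : set R) (f g : R -> R) : measurable D ->
  mu.-integrable D (EFin \o f) -> mu.-integrable D (EFin \o g) ->
  mu.-integrable D (EFin \o (fun x => f x - g x)).
Proof.
move=> mD fi gi; have := integrableB (mu := mu) mD fi gi.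
by apply: eq_integrable => // x _ /=; rewrite EFinB.
Qed.

Lemma measurable_inv : measurable_fun [set: R] (fun x : R => x^-1).
Proof.
have m0 : measurable [set 0 : R] by exact: measurable_set1.
rewrite -(setvU [set 0 : R]); apply/measurable_funU => //.
  exact: measurableC.
split; last exact: measurable_fun_set1.
apply: open_continuous_measurable_fun.
  by rewrite openC; exact: closed_eq.
by move=> x; rewrite inE/= => /eqP x0; exact: inv_continuous.
Qed.

Lemma measurable_funV (D : set R) (f : R -> R) :
  measurable_fun D f -> measurable_fun D (fun x => (f x)^-1).
Proof. exact: (measurableT_comp measurable_inv). Qed.

Lemma measurable_fun_powR (D : set R) (f : R -> R) (r : R) :
  measurable_fun D f -> measurable_fun D (fun x => f x `^ r).
Proof.
move=> mf; apply: (@measurableT_comp _ _ _ _ _ _ (@powR R ^~ r)) => //.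
Qed.

End ae_integral.

(** * Local absolute continuity *)

Section absolutely_continuous.
Context {R : realType}.
Notation mu := (@lebesgue_measure R).

Lemma continuous_epsP (f : R -> R) (x : R) :
  {for x, continuous f} <->
  forall e : R, 0 < e -> exists2 d : R, 0 < d & forall y, `|y - x| < d -> `|f y - f x| < e.
Proof.
split.
  move=> /cvgrPdist_lt fx e e0; have := fx _ e0.
  move=> /nbhs_ballP[d /= d0 dB]; exists d => // y yd.
  by rewrite distrC; apply: dB; rewrite /ball/= distrC.
move=> H; apply/cvgrPdist_lt => e /H[d d0 dB]; apply/nbhs_ballP; exists d => //=.
by move=> y; rewrite /ball/= distrC => /dB; rewrite distrC.
Qed.

(** The bound holds from [x] up to points arbitrarily close to the supremum [s0] of the points
    reached; the estimate around [s0], used once to its left and once to its right, carries it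
    beyond [s0] unless [s0 = y]. The hypothesis compares [D] only with its value at the centre [s],
    which is all that differentiability at [s] provides. *)
Lemma increment_le_local (D M : R -> R) (x y : R) : x <= y ->
  (forall s t, x <= s -> s <= t -> t <= y -> M s <= M t) ->
  (forall s, x <= s <= y -> exists2 d : R, 0 < d &
     forall t, x <= t <= y -> `|t - s| < d -> `|D t - D s| <= `|M t - M s|) ->
  `|D y - D x| <= M y - M x.
Proof.
move=> xy Mmono loc.
pose S := [set s | x <= s <= y /\ `|D s - D x| <= M s - M x].
have Sx : S x by split; [rewrite lexx xy|rewrite !subrr normr0].
have ubS : ubound S y by move=> s [/andP[]].
have supS : has_sup S by split; [exists x|exists y].
pose s0 := sup S.
have xs0 : x <= s0 by exact: (ub_le_sup (proj2 supS)).
have s0y : s0 <= y by apply: ge_sup => //; exists x.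
have s0I : x <= s0 <= y by rewrite xs0 s0y.
have [d d0 dB] := loc s0 s0I.
have [s1 [/andP[xs1 s1y] Ss1] s1s0] := sup_adherent d0 supS.
rewrite -/s0 in s1s0.
have s1les0 : s1 <= s0 by apply: (ub_le_sup (proj2 supS)); split => //; rewrite xs1.
have key t : s0 <= t -> t <= y -> `|t - s0| < d -> S t.
  move=> s0t ty td; split; first by rewrite (le_trans xs0 s0t).
  have h1 : `|D t - D s0| <= M t - M s0.
    rewrite (le_trans (dB _ _ td))// ?(le_trans xs0 s0t)//.
    by rewrite ger0_norm// subr_ge0 Mmono.
  have h2 : `|D s0 - D s1| <= M s0 - M s1.
    have s1d : `|s1 - s0| < d by rewrite distrC ger0_norm ?subr_ge0//; lra.
    have s1I : x <= s1 <= y by rewrite xs1.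
    rewrite distrC (le_trans (dB _ s1I s1d))// distrC ger0_norm//.
    by rewrite subr_ge0 Mmono.
  have -> : D t - D x = (D t - D s0) + (D s0 - D s1) + (D s1 - D x) by ring.
  have -> : M t - M x = (M t - M s0) + (M s0 - M s1) + (M s1 - M x) by ring.
  by rewrite (le_trans (ler_normD _ _))// lerD// (le_trans (ler_normD _ _))// lerD.
have [s0ly|ys0] := ltP s0 y; last first.
  have s0E : s0 = y by apply/eqP; rewrite eq_le s0y ys0.
  by have [] := key s0 (lexx _) s0y; rewrite ?subrr ?normr0 ?d0// s0E.
pose t := Num.min y (s0 + d / 2).
have s0t : s0 < t by rewrite /t lt_min s0ly ltrDl divr_gt0.
have ty : t <= y by rewrite /t ge_min lexx.
have td : t - s0 <= d / 2 by rewrite lerBlDl /t ge_min lexx orbT.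
have St : S t.
  apply: key => //; first exact: ltW.
  by rewrite ger0_norm ?subr_ge0 ?ltW//; lra.
by have := ub_le_sup (proj2 supS) St; rewrite leNgt s0t.
Qed.

(* Local absolute continuity; f is a Borel version of the derivative. *)
Definition ac (a b : R) (F f : R -> R) : Prop :=
  measurable_fun setT f /\
  forall x y, a < x -> x <= y -> y < b ->
    mu.-integrable `[x, y] (EFin \o f) /\
    F y - F x = \int[mu]_(t in `[x, y]) f t.

Lemma Rintegral_split (f : R -> R) (x y : R) (b : itv_bound R) :
  mu.-integrable [set` Interval (BLeft x) b] (EFin \o f) ->
  x <= y -> (BRight y <= b)%O ->
  \int[mu]_(t in [set` Interval (BLeft x) b]) f t =
  \int[mu]_(t in `[x, y]) f t + \int[mu]_(t in [set` Interval (BLeft y) b]) f t.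
Proof.
move=> fi xy yb; have := Rintegral_itvB fi; move=> /(_ y).
rewrite bnd_simp => /(_ xy yb).
have fi' : mu.-integrable [set` Interval (BRight y) b] (EFin \o f).
  apply: integrableS fi => //; apply: subset_itvr.
  by rewrite bnd_simp.
by rewrite (Rintegral_itv_obnd_cbnd fi') => <-; rewrite addrC subrK.
Qed.

Lemma integrable_itv_lclosed (f : R -> R) (x : R) (b : itv_bound R) :
  measurable_fun setT f ->
  mu.-integrable [set` Interval (BRight x) b] (EFin \o f) ->
  mu.-integrable [set` Interval (BLeft x) b] (EFin \o f).
Proof.
move=> mf /integrableP[_ foo]; apply/integrableP; split.
  by apply/measurable_EFinP; exact: measurable_funS mf.
rewrite -integral_itv_obnd_cbnd//; apply/measurable_EFinP.
by apply: measurableT_comp => //; exact: measurable_funS mf.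
Qed.

Lemma integrable_itv_rclosed (f : R -> R) (x : R) (a : itv_bound R) :
  measurable_fun setT f ->
  mu.-integrable [set` Interval a (BLeft x)] (EFin \o f) ->
  mu.-integrable [set` Interval a (BRight x)] (EFin \o f).
Proof.
move=> mf /integrableP[_ foo]; apply/integrableP; split.
  by apply/measurable_EFinP; exact: measurable_funS mf.
rewrite -integral_itv_bndo_bndc//; apply/measurable_EFinP.
by apply: measurableT_comp => //; exact: measurable_funS mf.
Qed.

Lemma Rintegral_split_oo (f : R -> R) (x y b : R) : measurable_fun setT f ->
  mu.-integrable `]x, b[ (EFin \o f) -> x <= y -> y < b ->
  \int[mu]_(t in `]x, b[) f t =
  \int[mu]_(t in `[x, y]) f t + \int[mu]_(t in `]y, b[) f t.
Proof.
move=> mf fi xy yb.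
have fi' := integrable_itv_lclosed mf fi.
have fi'' : mu.-integrable `]y, b[ (EFin \o f).
  by apply: integrableS fi => //; apply: subset_itvr; rewrite bnd_simp.
rewrite (Rintegral_itv_obnd_cbnd fi) (Rintegral_itv_obnd_cbnd fi'').
by apply: Rintegral_split => //; rewrite bnd_simp.
Qed.

Section basics.
Variables (a b : R).

Lemma ac_integrable (F f : R -> R) x y : ac a b F f -> a < x -> y < b ->
  mu.-integrable `[x, y] (EFin \o f).
Proof.
move=> [_ acF] ax yb; have [xy|yx] := leP x y; first by have [] := acF x y ax xy yb.
by rewrite set_itv_ge ?bnd_simp -?ltNge//; exact: integrable_set0.
Qed.

Lemma ac_continuous (F f : R -> R) x : ac a b F f -> a < x < b ->
  {for x, continuous F}.
Proof.
move=> acF /andP[ax xb]; pose u := (a + x) / 2; pose w := (x + b) / 2.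
have [au ux xw wb] : [/\ a < u, u < x, x < w & w < b] by split; rewrite /u /w; lra.
have fi := ac_integrable acF au wb.
have uw : u <= w by lra.
have := @parameterized_integral_continuous R u w f uw fi.
have xuw : (x \in `]u, w[%R) by rewrite in_itv/= ux.
move=> /continuous_within_itvP => /(_ (lt_trans ux xw))[/(_ x xuw) + _ _].
move=> /continuous_epsP H; apply/continuous_epsP => e /H[d d0 dB].
exists (Num.min d (Num.min (x - u) (w - x))).
  by rewrite !lt_min d0 !subr_gt0 ux xw.
move=> y; rewrite !lt_min => /and3P[yd + +]; rewrite ltr_norml => /andP[uy _] /ltr_normlP[_ yw].
have uley : u <= y by lra.
have yb : y < b by lra.
have xu : u <= x by lra.
have [_ h1] := proj2 acF u y au uley yb.
have [_ h2] := proj2 acF u x au xu xb.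
rewrite (_ : F y - F x = (F y - F u) - (F x - F u)); last by ring.
by rewrite h1 h2; exact: dB.
Qed.

Lemma ac_ext (F f F' f' : R -> R) : ac a b F f ->
  (forall x, a < x < b -> F x = F' x) -> measurable_fun setT f' ->
  ae_on a b (fun x => f x = f' x) -> ac a b F' f'.
Proof.
move=> acF FF' mf' /ae_onP ff'; split => // x y ax xy yb.
have [fi FE] := proj2 acF x y ax xy yb.
have ff'' : {ae mu, forall t, `[x, y]%classic t -> f t = f' t}.
  apply: aeS ff' => t tf; rewrite /= in_itv/= => /andP[xt ty]; apply: tf.
  by rewrite (lt_le_trans ax xt)/= (le_lt_trans ty yb).
split; first by apply: integrable_ae_eq fi _ ff'' => //; exact: measurable_funS mf'.
rewrite -!FF' ?FE//; first exact: eq_Rintegral_ae.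
- by rewrite ax (le_lt_trans xy yb).
- by rewrite yb (lt_le_trans ax xy).
Qed.

Lemma ac_cst c : ac a b (cst c) (cst 0).
Proof.
split => // x y ax xy yb; split; last by rewrite subrr Rintegral_cst// mul0r.
exact: integrable0.
Qed.

Lemma ac_lin (F f G g : R -> R) k : ac a b F f -> ac a b G g ->
  ac a b (fun x => F x + k * G x) (fun x => f x + k * g x).
Proof.
move=> [mf acF] [mg acG]; split.
  by apply: measurable_funD => //; exact: measurable_funM.
move=> x y ax xy yb; have [fi FE] := acF x y ax xy yb; have [gi GE] := acG x y ax xy yb.
have kgi : mu.-integrable `[x, y] (EFin \o (fun t => k * g t)).
  exact: integrable_scale.
split; first exact: integrable_add.
by rewrite RintegralD// RintegralZl// -FE -GE; ring.
Qed.

Lemma ac_sub c d (F f : R -> R) : a <= c -> d <= b -> ac a b F f -> ac c d F f.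
Proof.
move=> ca db [mf acF]; split=> // x y cx xy yd; apply: acF => //.
  exact: le_lt_trans ca cx.
exact: lt_le_trans yd db.
Qed.

Lemma ac_measurable (F f : R -> R) : ac a b F f -> measurable_fun `]a, b[ F.
Proof.
move=> acF; apply: open_continuous_measurable_fun => [|x].
  exact: itv_open.
by rewrite inE/= in_itv/=; exact: ac_continuous acF.
Qed.

(** The chain rule. Let [N] be the primitive of [|f|] and [K] that of [k]. Near each point the
    increments of [D = Phi o F - K] are at most [2 e] times those of [N]: one [e] comes from the
    difference quotient of [Phi] at [F s], the other from the continuity of [phi o F]. Then
    [increment_le_local] makes the estimate global, and [e] is arbitrary. The derivative is a
    separate argument [k] because it must be Borel on the whole line, while its formula is given on
    []a, b[] only. *)
Lemma ac_comp (F f : R -> R) (Phi phi k : R -> R) : ac a b F f ->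
  (forall x, a < x < b -> is_derive (F x) 1 Phi (phi (F x))) ->
  (forall x, a < x < b -> {for F x, continuous phi}) ->
  measurable_fun setT k -> (forall x, a < x < b -> k x = phi (F x) * f x) ->
  ac a b (fun x => Phi (F x)) k.
Proof.
move=> acF dPhi cphi mk kE; split => // x y ax xy yb.
have inI t : x <= t <= y -> a < t < b.
  by move=> /andP[xt ty]; rewrite (lt_le_trans ax)//= (le_lt_trans ty).
have fi : mu.-integrable `[x, y] (EFin \o f) by exact: ac_integrable acF _ _.
have cphiF t : x <= t <= y -> {for t, continuous (phi \o F)}.
  move=> /inI tI; apply: continuous_comp; first exact: ac_continuous acF tI.
  exact: cphi.
have mf : measurable_fun setT f by case: acF.
have nfi : mu.-integrable `[x, y] (EFin \o (fun t => `|f t|)) by exact: integrable_norm.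
have ki : mu.-integrable `[x, y] (EFin \o k).
  have /compact_bounded[M [_ HM]] : compact ((phi \o F) @` `[x, y]).
    apply: continuous_compact; last exact: segment_compact.
    by apply: continuous_in_subspaceT => t /set_mem/=; rewrite in_itv/=; exact: cphiF.
  have M1 : M < M + 1 by rewrite ltrDl.
  apply: (@integrable_le _ _ _ (fun t => (M + 1) * `|f t|)) => //.
  - exact: measurable_funS mk.
  - exact: integrable_scale.
  - move=> t; rewrite /= in_itv/= => txy; rewrite kE; last exact: inI.
    rewrite normrM ler_wpM2r//; apply: HM => //=.
    by exists t => //=; rewrite in_itv/=.
split => //.
have sub s t : x <= s -> t <= y -> `[s, t]%classic `<=` `[x, y]%classic.
  move=> xs ty r /=; rewrite !in_itv/= => /andP[sr rt].
  by rewrite (le_trans xs)//= (le_trans rt).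
have subi (g : R -> R) s t : x <= s -> t <= y -> mu.-integrable `[x, y] (EFin \o g) ->
    mu.-integrable `[s, t] (EFin \o g).
  by move=> xs ty; apply: integrableS => //; exact: sub.
pose N t := \int[mu]_(r in `[x, t]) `|f r|.
pose K t := \int[mu]_(r in `[x, t]) k r.
pose D t := Phi (F t) - K t.
have incr (g : R -> R) s t : mu.-integrable `[x, y] (EFin \o g) ->
    x <= s -> s <= t -> t <= y ->
    \int[mu]_(r in `[x, t]) g r = \int[mu]_(r in `[x, s]) g r + \int[mu]_(r in `[s, t]) g r.
  by move=> gi xs st ty; apply: Rintegral_split => //; exact: subi.
have Nmono s t : x <= s -> s <= t -> t <= y -> N s <= N t.
  by move=> xs st ty; rewrite /N (incr _ s t)// lerDl Rintegral_ge0.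
have est e : 0 < e -> `|D y - D x| <= 2 * e * N y - 2 * e * N x.
  move=> e0; apply: (@increment_le_local D (fun t => 2 * e * N t)) => //.
    by move=> s t xs st ty; rewrite ler_pM2l ?mulr_gt0//; exact: Nmono.
  move=> s sI.
  have /is_derive1_caratheodory[g [gE gc gs]] := dPhi s (inI _ sI).
  have gFc : {for s, continuous (g \o F)}.
    by apply: continuous_comp => //; exact: ac_continuous acF (inI _ sI).
  have /continuous_epsP/(_ _ e0)[d1 d10 H1] := gFc.
  have /continuous_epsP/(_ _ e0)[d2 d20 H2] := cphiF s sI.
  have core u w : x <= u -> u <= w -> w <= y -> (u = s \/ w = s) ->
      `|u - w| < Num.min d1 d2 -> `|D w - D u| <= 2 * e * (N w - N u).
    move=> xu uw wy us; rewrite lt_min => /andP[uw1 uw2].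
    have uI : x <= u <= y by rewrite xu (le_trans uw).
    have wI : x <= w <= y by rewrite wy (le_trans xu).
    have fuw := subi _ _ _ xu wy fi; have kuw := subi _ _ _ xu wy ki.
    have nuw := subi _ _ _ xu wy nfi.
    rewrite /D /K /N (incr k u w)// (incr (fun r => `|f r|) u w)//.
    have FE : F w - F u = \int[mu]_(r in `[u, w]) f r.
      by have [_ ->] := proj2 acF u w (lt_le_trans ax xu) uw (le_lt_trans wy yb).
    (* The endpoint other than [s]; the slope function [g] of [Phi] at [F s] is evaluated at
       [F t]. *)
    pose t := if u == s then w else u.
    have tE : F t - F s = F w - F u \/ F t - F s = - (F w - F u).
      rewrite /t; case: eqP => [<-|us']; first by left.
      by right; case: us => // ->; ring.
    have PE : Phi (F w) - Phi (F u) = g (F t) * (F w - F u).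
      rewrite /t; case: eqP => [->|us']; first by rewrite gE.
      by case: us => // ws; rewrite ws -[LHS]opprB gE; ring.
    have ts1 : `|t - s| < d1.
      by rewrite /t; case: eqP => [<-|us']; [rewrite distrC|case: us => // <-].
    have cfi (c : R) : mu.-integrable `[u, w] (EFin \o (fun r => c * f r)).
      exact: integrable_scale.
    rewrite [X in `|X|](_ : _ = (g (F t) - phi (F s)) * \int[mu]_(r in `[u, w]) f r
        + \int[mu]_(r in `[u, w]) (phi (F s) * f r - k r)); last first.
      rewrite RintegralB// RintegralZl// -FE mulrBl -PE; ring.
    rewrite [leRHS](_ : _ = e * \int[mu]_(r in `[u, w]) `|f r| +
        e * \int[mu]_(r in `[u, w]) `|f r|); last by ring.
    rewrite (le_trans (ler_normD _ _))// lerD//.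
      rewrite normrM ler_pM//; last exact: le_normr_Rintegral.
      by rewrite -gs ltW//; exact: H1.
    rewrite (le_trans (le_normr_Rintegral _ _))//.
      exact: integrable_sub.
    rewrite -RintegralZl//; apply: le_Rintegral => //.
    - apply: integrable_norm.
      exact: integrable_sub.
    - exact: integrable_scale.
    - move=> r; rewrite /= in_itv/= => /andP[ur rw].
      have rI : x <= r <= y by rewrite (le_trans xu)//= (le_trans rw).
      rewrite kE; last exact: inI.
      rewrite -mulrBl normrM ler_wpM2r// distrC ltW//; apply: H2.
      move: uw2; rewrite distrC ger0_norm ?subr_ge0//.
      by case: us => us wu; rewrite -us ltr_norml; apply/andP; split; clear -ur rw wu; lra.
  exists (Num.min d1 d2); first by rewrite lt_min d10.
  move=> t tI; have /andP[xs sy] := sI; have /andP[xt ty] := tI.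
  have [st|/ltW ts] := leP s t.
    rewrite distrC => td.
    rewrite -mulrBr [leRHS]ger0_norm ?mulr_ge0 ?subr_ge0 ?Nmono// ?(ltW e0)//.
    by apply: core => //; left.
  move=> td.
  rewrite distrC [leRHS]distrC.
  rewrite -mulrBr [leRHS]ger0_norm ?mulr_ge0 ?subr_ge0 ?Nmono// ?(ltW e0)//.
  by apply: core => //; right.
have Nge0 : 0 <= N y by rewrite /N Rintegral_ge0.
have Nx0 : N x = 0 by rewrite /N set_itv1 Rintegral_set1.
have Kx0 : K x = 0 by rewrite /K set_itv1 Rintegral_set1.
apply/eqP; rewrite -subr_eq0 -normr_le0; apply/ler_addgt0Pr => e e0.
(* This choice makes the bound at most the prescribed error; the summand 1 keeps the denominator
   positive when [N y] is zero. *)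
have := est (e / (2 * (N y + 1))).
rewrite divr_gt0 ?mulr_gt0 ?ltr_wpDl// => /(_ isT).
rewrite /D Kx0 Nx0 mulr0 !subr0 add0r -/(K y) addrAC => /le_trans; apply.
rewrite (_ : _ * N y = e * (N y / (N y + 1))); last by field; rewrite gt_eqF// ltr_wpDl.
by rewrite ger_pMr// ler_pdivrMr ?ltr_wpDl// mul1r lerDl.
Qed.

(** By polarization: [F G] is half of [(F + G)^2 - F^2 - G^2], and the chain rule covers squares. *)
Lemma ac_mul (F f G g : R -> R) : ac a b F f -> ac a b G g ->
  measurable_fun setT F -> measurable_fun setT G ->
  ac a b (fun x => F x * G x) (fun x => f x * G x + F x * g x).
Proof.
move=> acF acG mF mG.
have [mf _] := acF; have [mg _] := acG.
have sq (H h : R -> R) : ac a b H h -> measurable_fun setT H ->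
    ac a b (fun x => H x ^+ 2) (fun x => 2 * H x * h x).
  move=> acH mH; apply: (@ac_comp H h (fun z => z ^+ 2) (fun z => 2 * z)) => //.
  - by move=> x _; apply: DeriveDef; [exact: exprn_derivable|rewrite exp_derive /= expr1 /GRing.scale/= mulr1].
  - by move=> x _; apply: continuousM => //; exact: cst_continuous.
  - apply: measurable_funM; last by case: acH.
    exact: measurable_funM.
have acFG := ac_lin 1 acF acG.
have mFG : measurable_fun setT (fun x => F x + 1 * G x).
  by apply: measurable_funD => //; exact: measurable_funM.
have h1 := sq _ _ acFG mFG.
have h2 := ac_lin (-1) (ac_lin (-1) h1 (sq _ _ acF mF)) (sq _ _ acG mG).
apply: (ac_ext (ac_lin (2^-1) (ac_cst 0) h2)).
- by move=> x _ /=; field.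
- by apply: measurable_funD; exact: measurable_funM.
- by apply/ae_onP; apply: aeW => x _ /=; field.
Qed.

End basics.
End absolutely_continuous.

(** * Uniqueness, monotonicity and primitives for absolutely continuous functions *)

Section ac_theory.
Context {R : realType}.
Notation mu := (@lebesgue_measure R).

Lemma ae_on_exists (a b : R) (P : R -> Prop) : a < b -> ae_on a b P ->
  exists2 x, a < x < b & P x.
Proof.
move=> ab [N [mN N0 PN]]; apply: contrapT => nP.
have abN : `]a, b[%classic `<=` N.
  move=> x xab; apply: PN => /= Px; apply: nP; exists x.
    by move: xab; rewrite /= in_itv.
  by apply: Px; rewrite inE.
have : (mu `]a, b[ <= mu N)%E by apply: le_measure => //; rewrite inE.
by rewrite N0 lebesgue_measure_itv/= lte_fin ab -EFinD lee_fin leNgt subr_gt0 ab.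
Qed.

Lemma ae_ge0_continuous (a b : R) (F : R -> R) (x : R) :
  ae_on a b (fun t => 0 <= F t) -> {for x, continuous F} -> a < x < b -> 0 <= F x.
Proof.
move=> F0 /continuous_epsP cF /andP[ax xb]; rewrite leNgt; apply/negP => Fx.
have /cF[d d0 dB] : 0 < - F x by rewrite oppr_gt0.
pose u := Num.max a (x - d); pose w := Num.min b (x + d).
have au : a <= u by rewrite le_max lexx.
have wb : w <= b by rewrite ge_min lexx.
have uw : u < w.
  by rewrite lt_min !gt_max; apply/andP; split; apply/andP; split; lra.
have [t /andP[ut tw] Ft] := ae_on_exists uw (itv_subset_ae au wb F0).
have /ltr_normlP[] : `|F t - F x| < - F x.
  apply: dB; rewrite ltr_norml; move: ut tw.
  by rewrite gt_max lt_min => /andP[_ h1] /andP[_ h2]; apply/andP; split; lra.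
lra.
Qed.

Lemma ae_eq_continuous (a b : R) (F G : R -> R) :
  (forall x, a < x < b -> {for x, continuous F}) ->
  (forall x, a < x < b -> {for x, continuous G}) ->
  ae_on a b (fun x => F x = G x) -> forall x, a < x < b -> F x = G x.
Proof.
move=> cF cG FG x xab; apply/eqP; rewrite eq_le -subr_ge0 -[X in _ && X]subr_ge0.
apply/andP; split.
- apply: (@ae_ge0_continuous a b (fun t => G t - F t)) (xab).
    by apply: aeS FG => t FG /FG ->; rewrite subrr.
  by apply: continuousB; [exact: cG|exact: cF].
- apply: (@ae_ge0_continuous a b (fun t => F t - G t)) (xab).
    by apply: aeS FG => t FG /FG ->; rewrite subrr.
  by apply: continuousB; [exact: cF|exact: cG].
Qed.

Lemma ae_on_exhaust (a b : R) (P : R -> Prop) :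
  (forall u w, a < u -> u < w -> w < b -> ae_on u w P) -> ae_on a b P.
Proof.
move=> H.
suff : {ae mu, forall x, forall n : nat, a + n.+1%:R^-1 < x < b - n.+1%:R^-1 -> P x}.
  apply: aeS => x Hx; rewrite inE/= in_itv/= => /andP[ax xb].
  pose e := Num.min (x - a) (b - x).
  have e0 : 0 < e by rewrite lt_min !subr_gt0 ax.
  have [n _ /(_ n (leqnn n)) /= ne] := near_infty_natSinv_lt (PosNum e0).
  apply: (Hx n); move: ne; rewrite lt_min => /andP[h1 h2].
  by rewrite -ltrBrDl h1/= ltrBrDr -ltrBrDl h2.
apply/ae_foralln => n.
have : 0 < n.+1%:R^-1 :> R by rewrite invr_gt0 ltr0n.
move: (n.+1%:R^-1 : R) => e e0.
have [h|h] := ltP (a + e) (b - e).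
  by apply/ae_onP; apply: H => //; lra.
by apply: aeW => x /andP[h1 h2]; exfalso; lra.
Qed.

(** By Lebesgue differentiation, [f x] is almost everywhere the derivative of the integral of [f]
    from [u] to [x], which is constant here. *)
Lemma ae_eq0_of_itv_integrals (a b : R) (f : R -> R) :
  (forall x y, a < x -> x <= y -> y < b ->
     mu.-integrable `[x, y] (EFin \o f) /\ \int[mu]_(t in `[x, y]) f t = 0) ->
  ae_on a b (fun x => f x = 0).
Proof.
move=> H; apply: ae_on_exhaust => u w au uw wb.
have [fi _] := H u w au (ltW uw) wb.
have muw : measurable `[u, w]%classic by exact: measurable_itv.
pose g := f \_ `[u, w].
have lg : locally_integrable [set: R] g by exact: integrable_locally_restrict.
have gi y : mu.-integrable [set` Interval (BLeft u) (BRight y)] (EFin \o g).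
  apply: (@integrableS _ _ _ mu setT) => //.
  by rewrite -restrict_EFin; exact: (integrable_mkcond (mu := mu) (EFin \o f) muw).1.
have := FTC1 gi lg; apply: aeS => x FTC; rewrite inE/= in_itv/= => /andP[ux xw].
have uBx : (BLeft u < BRight x)%E by rewrite lte_fin.
have [_] := FTC uBx.
rewrite /g patchE mem_set/=; last by rewrite /= in_itv/= !ltW.
move=> <-; rewrite derive1E (@near_eq_derive _ _ _ _ (cst 0)) ?derive_cst//.
near=> y.
have : (y \in `]u, w[%R) by near: y; apply: near_in_itvoo; rewrite in_itv/= ux.
rewrite in_itv/= => /andP[/ltW uy /ltW yw].
transitivity (\int[mu]_(t in `[u, y]) f t).
  apply: eq_Rintegral => t; rewrite inE/= in_itv/= => /andP[ut ty].
  by rewrite patchE mem_set//= in_itv/= ut (le_trans ty).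
by have [] := H u y au uy (le_lt_trans yw wb).
Unshelve. all: by end_near. Qed.

Lemma ac_unique_ae (a b : R) (F f G g : R -> R) : ac a b F f -> ac a b G g ->
  ae_on a b (fun x => F x = G x) -> ae_on a b (fun x => f x = g x).
Proof.
move=> acF acG FG.
have FGx : forall x, a < x < b -> F x = G x.
  by apply: ae_eq_continuous FG => x; [exact: ac_continuous acF|exact: ac_continuous acG].
have : ae_on a b (fun x => f x - g x = 0).
  apply: ae_eq0_of_itv_integrals => x y ax xy yb.
  have [fi FE] := proj2 acF x y ax xy yb; have [gi GE] := proj2 acG x y ax xy yb.
  split; first exact: integrable_sub.
  rewrite RintegralB// -FE -GE !FGx ?subrr//.
    by rewrite ax (le_lt_trans xy).
  by rewrite (lt_le_trans ax xy).
by apply: aeS => x h /h/eqP; rewrite subr_eq0 => /eqP.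
Qed.

(** Equal values at [x] and [y] would make the nondecreasing [F] constant in between, so that [f]
    would vanish almost everywhere there. *)
Lemma ac_lt (a b : R) (F f : R -> R) x y : ac a b F f -> ae_on a b (fun t => 0 < f t) ->
  a < x -> x < y -> y < b -> F x < F y.
Proof.
move=> acF f0.
have le u w : a < u -> u <= w -> w < b -> F u <= F w.
  move=> au uw wb; have [fi FE] := proj2 acF u w au uw wb.
  rewrite -subr_ge0 FE (@eq_Rintegral_ae _ _ _ (fun t => `|f t|)) ?Rintegral_ge0//.
  apply: aeS f0 => t + /= /[!in_itv]/= /andP[ut tw].
  rewrite inE/= in_itv/= (lt_le_trans au ut) (le_lt_trans tw wb) => /(_ isT) ft.
  by rewrite gtr0_norm.
move=> ax xy yb; rewrite lt_neqAle le ?ltW// andbT; apply/eqP => Fxy.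
have acF' : ac x y F f by apply: ac_sub acF; exact: ltW.
have : ae_on x y (fun t => f t = cst 0 t).
  apply: (@ac_unique_ae x y F f (cst (F x)) (cst 0)) => //; first exact: ac_cst.
  apply/ae_onP; apply: aeW => t /andP[xt ty] /=.
  apply/eqP; rewrite eq_le; apply/andP; split.
    by rewrite Fxy; apply: le => //; [exact: lt_trans xt|exact: ltW].
  by apply: le => //; [exact: ltW|exact: lt_trans yb].
move=> f00; have f0' := itv_subset_ae (ltW ax) (ltW yb) f0.
have : ae_on x y (fun t => False).
  by apply: aeS2 f00 f0' => t /= h1 h2 txy; move: (h2 txy); rewrite h1// ltxx.
by move=> /(ae_on_exists xy)[].
Qed.

(** The primitive starts from the midpoint, since [f] may fail to be integrable up to [a] or [b]. *)
Lemma ac_primitive (a b : R) (f : R -> R) : a < b -> measurable_fun setT f ->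
  (forall x y, a < x -> x <= y -> y < b -> mu.-integrable `[x, y] (EFin \o f)) ->
  exists F, ac a b F f.
Proof.
move=> ab mf fi; pose m := (a + b) / 2.
have am : a < m by rewrite /m; lra.
have mb : m < b by rewrite /m; lra.
pose F x := if m <= x then \int[mu]_(t in `[m, x]) f t
            else - \int[mu]_(t in `[x, m]) f t.
exists F; split => // x y ax xy yb; split; first exact: fi.
have sp u v w : a < u -> u <= v -> v <= w -> w < b ->
    \int[mu]_(t in `[u, w]) f t = \int[mu]_(t in `[u, v]) f t + \int[mu]_(t in `[v, w]) f t.
  by move=> au uv vw wb; apply: Rintegral_split => //; apply: fi => //; exact: le_trans vw.
rewrite /F; case: ifPn => [my|]; case: ifPn => [mx|].
- by rewrite (sp m x y)//; ring.
- by rewrite -ltNge => xm; rewrite (sp x m y)// ?ltW//; ring.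
- by rewrite -ltNge => ym; exfalso; lra.
- by rewrite -!ltNge => xm ym; rewrite (sp x y m)// ?ltW//; ring.
Qed.

Lemma ac_tail (a b : R) (f : R -> R) : measurable_fun setT f ->
  (forall x, a < x < b -> mu.-integrable `]x, b[ (EFin \o f)) ->
  ac a b (fun x => - \int[mu]_(t in `]x, b[) f t) f.
Proof.
move=> mf fi; split => // x y ax xy yb.
have xI : a < x < b by rewrite ax (le_lt_trans xy).
split.
  apply: integrableS (integrable_itv_lclosed mf (fi x xI)) => //.
  by apply: subset_itvl; rewrite bnd_simp.
by rewrite (Rintegral_split_oo mf (fi x xI) xy yb); ring.
Qed.

Lemma ac_tail_repr (a b : R) (F f : R -> R) : ac a b F f ->
  (forall x, a < x < b -> mu.-integrable `]x, b[ (EFin \o f)) ->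
  exists c, forall x, a < x < b -> F x = - (\int[mu]_(t in `]x, b[) f t) + c.
Proof.
move=> acF fi; have acT := ac_tail (proj1 acF) fi.
pose m := (a + b) / 2; exists (F m + \int[mu]_(t in `]m, b[) f t) => x /andP[ax xb].
have am : a < m by rewrite /m; lra.
have mb : m < b by rewrite /m; lra.
have [xm|/ltW mx] := leP x m.
  have [_ h1] := proj2 acF x m ax xm mb; have [_ h2] := proj2 acT x m ax xm mb.
  by move: h1; rewrite -h2; lra.
have [_ h1] := proj2 acF m x am mx xb; have [_ h2] := proj2 acT m x am mx xb.
by move: h1; rewrite -h2; lra.
Qed.

Lemma ac_bounded (a b c : R) (F f : R -> R) : ac a b F f -> a < c < b ->
  mu.-integrable `]c, b[ (EFin \o f) ->
  exists2 M, 0 <= M & forall x, c <= x < b -> `|F x| <= M.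
Proof.
move=> acF /andP[ac cb] fi; have mf := proj1 acF.
exists (`|F c| + \int[mu]_(t in `[c, b[) `|f t|).
  by rewrite addr_ge0// Rintegral_ge0.
have fi' := integrable_itv_lclosed mf fi.
move=> x /andP[cx xb]; have [fix_ FE] := proj2 acF c x ac cx xb.
rewrite (_ : F x = F c + (F x - F c)); last by ring.
rewrite (le_trans (ler_normD _ _))// lerD2l FE.
rewrite (le_trans (le_normr_Rintegral _ _))//.
rewrite (@Rintegral_split _ _ c x (BLeft b)) ?bnd_simp//; last exact: integrable_norm.
by rewrite lerDl Rintegral_ge0.
Qed.

End ac_theory.

(** * Smooth bump functions *)

Section smooth.
Context {R : realType}.
Implicit Types (f g : R -> R).

Definition smooth f := forall n x, derivable f^`(n) x 1.

(** Smoothness of finite order with the derivative taken first: the sum and product rules then go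
    through by induction on the order. *)
Fixpoint smoothn (n : nat) f : Prop :=
  (forall x, derivable f x 1) /\ if n is m.+1 then smoothn m (f^`()%classic) else True.

Lemma smoothP f : smooth f <-> forall n, smoothn n f.
Proof.
split=> [sf n|H n x].
  elim: n f sf => [|n IH] f sf; split => //; try exact: (sf 0%N).
  by apply: IH => k x; rewrite -derive1Sn.
elim: n f H x => [|n IH] f H x; first by have [] := H 0%N.
by rewrite derive1Sn; apply: IH => k; have [] := H k.+1.
Qed.

Lemma smooth_cons f : (forall x, derivable f x 1) -> smooth f^`()%classic -> smooth f.
Proof. by move=> df /smoothP sf; apply/smoothP => -[|n]; split. Qed.

Lemma smooth_continuous f : smooth f -> continuous f.
Proof.
by move=> sf x; apply/differentiable_continuous/derivable1_diffP; exact: (sf 0%N).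
Qed.

Lemma smooth_derive f : smooth f -> smooth f^`()%classic.
Proof. by move=> sf n x; rewrite -derive1Sn. Qed.

Lemma smoothnW n f : smoothn n.+1 f -> smoothn n f.
Proof. by elim: n f => [|n IH] f [df sf]; split => //; exact: IH. Qed.

Lemma smoothn_add n f g : smoothn n f -> smoothn n g -> smoothn n (fun x => f x + g x).
Proof.
elim: n f g => [|n IH] f g [df sf] [dg sg]; split; try by move=> x; exact: derivableD.
  by [].
rewrite (_ : _^`()%classic = fun x => f^`()%classic x + g^`()%classic x); first exact: IH.
by apply/funext => x; rewrite !derive1E deriveD.
Qed.

Lemma smoothn_mul n f g : smoothn n f -> smoothn n g -> smoothn n (fun x => f x * g x).
Proof.
elim: n f g => [|n IH] f g; first by move=> [df sf] [dg sg]; split; [move=> x; exact: derivableM|].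
move=> sfn sgn; have [df sf] := sfn; have [dg sg] := sgn.
split; first by move=> x; exact: derivableM.
rewrite (_ : _^`()%classic =
    fun x => f x * g^`()%classic x + g x * f^`()%classic x).
  by apply: smoothn_add; apply: IH => //; exact: smoothnW.
by apply/funext => x; rewrite !derive1E deriveM.
Qed.

Lemma smooth_add f g : smooth f -> smooth g -> smooth (fun x => f x + g x).
Proof. by move=> /smoothP sf /smoothP sg; apply/smoothP => n; exact: smoothn_add. Qed.

Lemma smooth_mul f g : smooth f -> smooth g -> smooth (fun x => f x * g x).
Proof. by move=> /smoothP sf /smoothP sg; apply/smoothP => n; exact: smoothn_mul. Qed.

Lemma smooth_cst c : smooth (cst c : R -> R).
Proof.
apply/smoothP => n; elim: n c => [|n IH] c; split => //.
rewrite (_ : _^`()%classic = cst 0); first exact: IH.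
by apply/funext => x; rewrite derive1_cst.
Qed.

Lemma smooth_scale k f : smooth f -> smooth (fun x => k * f x).
Proof. by move=> sf; exact: (smooth_mul (@smooth_cst k) sf). Qed.

Lemma is_derive_affine (k c x : R) : is_derive x 1 (fun y => k * y + c) k.
Proof.
have dk : is_derive x 1 (k \*: (@id R)) (k *: (1 : R)) by exact: is_deriveZ.
have := is_deriveD dk (is_derive_cst c x (1 : R)).
by rewrite addr0 /GRing.scale/= mulr1.
Qed.

Lemma smooth_affine f k c : smooth f -> smooth (fun x => f (k * x + c)).
Proof.
move=> /smoothP sf; apply/smoothP => n; elim: n f sf => [|n IH] f sf.
  split => // x; have [df _] := sf 0%N.
  have H := @is_derive1_comp R f (fun y => k * y + c) x _ _ (derivableP (df _)) (is_derive_affine k c x).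
  by case: H.
have [df sf'] := sf n.+1.
have H x := @is_derive1_comp R f (fun y => k * y + c) x _ _ (derivableP (df _)) (is_derive_affine k c x).
split => [x|]; first by case: (H x).
rewrite (_ : _^`()%classic = fun x => cst k x * f^`()%classic (k * x + c)).
  apply: (@smoothn_mul n (cst k) (fun x => f^`()%classic (k * x + c))); first exact: ((smoothP _).1 (@smooth_cst k) n).
  by apply: IH => m; have [] := sf m.+1.
by apply/funext => x; rewrite !derive1E; case: (H x) => _ ->; rewrite mulrC.
Qed.

(** Carrying a polynomial in [x^-1] makes this family of flat functions stable under
    differentiation, so that one induction proves them smooth. *)
Definition flat (P : {poly R}) (x : R) : R :=
  if 0 < x then P.[x^-1] * expR (- x^-1) else 0.

(** With [t = x^-1] and [n] the size of [P], the polynomial is at most [S t^n], while [expR t] is at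
    least [t^(n+1) / (n+1)!]; the quotient is of order [t^-1 = x]. *)
Lemma flat_bound (P : {poly R}) : exists2 C : R, 0 <= C &
  forall x : R, 0 < x <= 1 -> `|flat P x| <= C * x.
Proof.
pose n := size P; pose S := \sum_(i < n) `|P`_i|.
have S0 : 0 <= S by exact: sumr_ge0.
exists (S * n.+1`!%:R); first by rewrite mulr_ge0.
move=> x /andP[x0 x1]; rewrite /flat x0.
pose t := x^-1; have t1 : 1 <= t by rewrite invf_ge1.
have t0 : 0 < t by rewrite invr_gt0.
rewrite -/t (_ : x = t^-1); last by rewrite invrK.
rewrite normrM (ger0_norm (expR_ge0 _)) expRN.
have Pt : `|P.[t]| <= S * t ^+ n.
  rewrite horner_coef (le_trans (ler_norm_sum _ _ _))// mulr_suml.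
  apply: ler_sum => i _; rewrite normrM ler_wpM2l//.
  rewrite ger0_norm; last by rewrite exprn_ge0// ltW.
  by apply: (ler_weXn2l t1); exact: ltnW.
have Et : t ^+ n.+1 / n.+1`!%:R <= expR t.
  by apply: le_trans (expR_ge1Dxn n (ltW t0)); rewrite lerDr.
rewrite ler_pdivrMr ?expR_gt0// (le_trans Pt)// -!mulrA ler_wpM2l//.
rewrite -ler_pdivrMl ?ltr0n ?fact_gt0// -ler_pdivrMl ?invr_gt0// invrK.
by rewrite mulrCA -exprS mulrC.
Qed.

Lemma flat_is_derive (P : {poly R}) (x : R) : is_derive x 1 (flat P) (flat ('X^2 * (P - P^`())) x).
Proof.
have [x0|x0|->] := ltgtP x 0.
- have -> : flat ('X^2 * (P - P^`())) x = 0 by rewrite /flat ltNge ltW.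
  apply: (@near_eq_is_derive _ _ _ (cst 0)).
  near=> y; rewrite /flat ifF//; apply/negbTE; rewrite -leNgt ltW//.
  by near: y; exact: lt_nbhsl.
- have -> : flat ('X^2 * (P - P^`())) x =
     P.[x^-1] * (expR (- x^-1) * (x ^-2)) + expR (- x^-1) * (P^`().[x^-1] * - x ^-2).
    by rewrite /flat x0 hornerM hornerXn hornerD hornerN -exprVn; ring.
  apply: (@near_eq_is_derive _ _ _ (fun y : R => P.[y^-1] * expR (- y^-1))).
    near=> y; rewrite /flat ifT//.
    by near: y; exact: lt_nbhsr.
  have xn0 : x != 0 by rewrite gt_eqF.
  have dV : is_derive x 1 (fun y : R => y^-1) (- x ^-2).
    have := @is_deriveV R id x 1 1 xn0 (is_derive_id _ _).
    by rewrite /GRing.scale/= mulr1.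
  have dP : is_derive x 1 (fun y : R => P.[y^-1]) (P^`().[x^-1] * - x ^-2).
    apply: (@is_derive1_comp R (horner P) (fun y => y^-1)) => //.
  have dE : is_derive x 1 (fun y : R => expR (- y^-1)) (expR (- x^-1) * x ^-2).
    apply: (@is_derive1_comp R expR (fun y => - y^-1)) => //.
    have := @is_deriveN _ _ _ (fun y : R => y^-1) x 1 _ dV.
    by rewrite opprK.
  exact: is_deriveM.
- have -> : flat ('X^2 * (P - P^`())) 0 = 0 by rewrite /flat ltxx.
  (* At [0] the slope function of [flat P] is again flat, for the polynomial ['X * P], and
     [flat_bound] gives its continuity. *)
  apply/is_derive1_caratheodory; exists (flat ('X * P)); split.
  + move=> z; rewrite /flat ltxx !subr0; case: ifPn => z0; last by rewrite mul0r.
    by rewrite hornerM hornerX; field; rewrite gt_eqF.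
  + have [C C0 HC] := flat_bound ('X * P).
    apply/cvgrPdist_lt => e e0; near=> y.
    rewrite {1}/flat ltxx sub0r normrN.
    have [y0|y0] := ltP 0 y; last by rewrite /flat (ltNge 0 y) y0 normr0.
    have y1 : y <= 1 by apply: ltW; near: y; exact: lt_nbhsl.
    rewrite (le_lt_trans (HC _ _)) ?y0 ?y1//.
    have : y < e / (C + 1) by near: y; apply: lt_nbhsl; rewrite divr_gt0// ltr_wpDl.
    rewrite ltr_pdivlMr ?ltr_wpDl//; nra.
  + by rewrite /flat ltxx.
Unshelve. all: by end_near. Qed.

Lemma smooth_flat (P : {poly R}) : smooth (flat P).
Proof.
move=> n; elim: n P => [|n IH] P x; first by case: (flat_is_derive P x).
rewrite derive1Sn (_ : (flat P)^`()%classic = flat ('X^2 * (P - P^`()))); first exact: IH.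
by apply/funext => y; rewrite derive1E; case: (flat_is_derive P y).
Qed.

(* As n grows these increase to the indicator of ]c, d[. *)
Definition bump (c d : R) (n : nat) (x : R) : R :=
  flat 1 (n.+1%:R * (x - c)) * flat 1 (n.+1%:R * (d - x)).

Lemma flat1_itv (x : R) : 0 <= flat 1 x <= 1.
Proof.
rewrite /flat; case: ifPn => x0; last by rewrite lexx ler01.
by rewrite hornerC mul1r expR_ge0 expR_le1 oppr_le0 invr_ge0 ltW.
Qed.

Lemma bump_itv (c d : R) n x : 0 <= bump c d n x <= 1.
Proof.
have /andP[h1 h2] := flat1_itv (n.+1%:R * (x - c)).
have /andP[h3 h4] := flat1_itv (n.+1%:R * (d - x)).
by rewrite /bump mulr_ge0//= mulr_ile1.
Qed.

Lemma bump_gt0 (c d : R) n x : c < x < d -> 0 < bump c d n x.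
Proof.
move=> /andP[cx xd].
by apply: mulr_gt0; rewrite /flat pmulr_rgt0 ?ltr0n// subr_gt0 ?cx ?xd hornerC mul1r expR_gt0.
Qed.

Lemma bump_out (c d : R) n x : ~~ (c < x < d) -> bump c d n x = 0.
Proof.
have flat0 (k : nat) y : y <= 0 -> flat 1 (k.+1%:R * y) = 0.
  by move=> y0; rewrite /flat pmulr_rgt0 ?ltr0n// ltNge y0.
rewrite negb_and -!leNgt => /orP[] h; rewrite /bump.
  by rewrite flat0 ?mul0r// subr_le0.
by rewrite mulrC flat0 ?mul0r// subr_le0.
Qed.

Lemma smooth_bump (c d : R) n : smooth (bump c d n).
Proof.
apply: smooth_mul.
  rewrite (_ : (fun x => _) = fun x => flat 1 (n.+1%:R * x + - (n.+1%:R * c))).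
    by apply: smooth_affine; exact: smooth_flat.
  by apply/funext => x; congr flat; ring.
rewrite (_ : (fun x => _) = fun x => flat 1 (- n.+1%:R * x + n.+1%:R * d)).
  by apply: smooth_affine; exact: smooth_flat.
by apply/funext => x; congr flat; ring.
Qed.

Lemma flat1_cvg (y : R) : 0 < y -> flat 1 (n.+1%:R * y) @[n --> \oo] --> (1 : R).
Proof.
move=> y0.
rewrite (_ : (fun n => _) = (fun n => expR (- (y^-1 * n.+1%:R^-1)))); last first.
  by apply/funext => n; rewrite /flat pmulr_rgt0 ?ltr0n// y0 hornerC mul1r invfM mulrC.
rewrite -[X in _ --> X]expR0; apply: continuous_cvg; first exact: continuous_expR.
rewrite -oppr0; apply: cvgN; rewrite -(mulr0 y^-1); apply: cvgMr.
exact: cvg_harmonic.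
Qed.

Lemma bump_cvg (c d x : R) : bump c d n x @[n --> \oo] --> (if c < x < d then 1 else 0 : R).
Proof.
case: ifPn => [/andP[cx xd]|cxd].
  rewrite -[X in _ --> X](mulr1 1); apply: cvgM; apply: flat1_cvg; rewrite subr_gt0//.
by under eq_fun do rewrite bump_out//; exact: cvg_cst.
Qed.

End smooth.

(** * Weak derivatives *)

Section weak_derivative.
Context {R : realType}.
Notation mu := (@lebesgue_measure R).

Lemma Rintegral_support (D E : set R) (f : R -> R) : E `<=` D ->
  (forall x, D x -> ~ E x -> f x = 0) ->
  \int[mu]_(x in D) f x = \int[mu]_(x in E) f x.
Proof.
move=> ED f0; rewrite Rintegral_mkcond [RHS]Rintegral_mkcond.
apply: eq_Rintegral => x _; rewrite /patch; case: ifPn => xD; case: ifPn => xE //.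
- by rewrite f0//; [exact/set_mem|move/mem_set; exact/negP].
- by move: xD; rewrite mem_set//; apply: ED; exact/set_mem.
Qed.

Lemma integrable_support (D E : set R) (f : R -> R) : measurable D -> measurable E ->
  E `<=` D -> (forall x, D x -> ~ E x -> f x = 0) ->
  mu.-integrable E (EFin \o f) -> mu.-integrable D (EFin \o f).
Proof.
move=> mD mE ED f0 /(integrable_mkcond (mu := mu) _ mE).1 fE.
apply/(integrable_mkcond (mu := mu) _ mD); apply: eq_integrable fE => // x _.
rewrite /patch; case: ifPn => xE; case: ifPn => xD //=.
- by move: xD; rewrite mem_set//; apply: ED; exact/set_mem.
- by rewrite f0//; [exact/set_mem|move/mem_set; exact/negP].
Qed.

Lemma Rintegral_dominated_cvg (D : set R) (f_ : nat -> R -> R) (f g : R -> R) :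
  measurable D -> (forall n, measurable_fun D (f_ n)) -> measurable_fun D f ->
  (forall x, D x -> f_ n x @[n --> \oo] --> f x) ->
  mu.-integrable D (EFin \o g) -> (forall n x, D x -> `|f_ n x| <= g x) ->
  mu.-integrable D (EFin \o f) /\
  \int[mu]_(x in D) f_ n x @[n --> \oo] --> \int[mu]_(x in D) f x.
Proof.
move=> mD mf_ mf cf gi fg.
have [||||fi _ H] := @dominated_convergence _ _ R mu D mD (fun n => EFin \o f_ n)
  (EFin \o f) (EFin \o g) _ _ _ gi.
- by move=> n; apply/measurable_EFinP; exact: mf_.
- exact/measurable_EFinP.
- by apply: aeW => x Dx; apply/fine_cvgP; split; [exact: nearW|exact: cf].
- by apply: aeW => x n Dx; rewrite /= lee_fin; exact: fg.
split => //; apply: fine_cvg; rewrite fineK//.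
exact: integrable_fin_num.
Qed.

Lemma compact_sub_segment (a b : R) (K : set R) : compact K ->
  K `<=` `]a, b[ -> K !=set0 -> exists u w, [/\ a < u, u <= w, w < b & K `<=` `[u, w]].
Proof.
move=> cK Kab K0.
have cid : {within K, continuous (@id R)} by apply: continuous_subspaceT => x.
have [w wK Hw] := compact_EVT_max K0 cK cid.
have [u uK Hu] := compact_EVT_min K0 cK cid.
exists u, w; split.
- by move/set_mem: uK => /Kab; rewrite /= in_itv/= => /andP[].
- exact: Hu.
- by move/set_mem: wK => /Kab; rewrite /= in_itv/= => /andP[].
- by move=> x /mem_set xK; rewrite /= in_itv/= Hu// Hw.
Qed.

Lemma locally_integrable_itvP (a b : R) (f : R -> R) :
  measurable_fun `]a, b[ f ->
  (locally_integrable `]a, b[ f <->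
   forall x y, a < x -> x <= y -> y < b -> mu.-integrable `[x, y] (EFin \o f)).
Proof.
move=> mf; split.
  move=> [_ _ H] x y ax xy yb.
  have sub : `[x, y]%classic `<=` `]a, b[%classic.
    move=> t /=; rewrite !in_itv/= => /andP[xt ty].
    by rewrite (lt_le_trans ax)//= (le_lt_trans ty).
  apply/integrableP; split.
    by apply/measurable_EFinP; apply: measurable_funS mf.
  by apply: H => //; exact: segment_compact.
move=> H; split => // K Kab cK.
have [->|/set0P K0] := eqVneq K set0; first by rewrite integral_set0.
have [u [w [au uw wb Kuw]]] := compact_sub_segment cK Kab K0.
have /integrableP[mf' fi] := H u w au uw wb.
apply: le_lt_trans fi; apply: ge0_subset_integral => //.
  exact: compact_measurable.
by apply/measurable_EFinP; apply: measurableT_comp => //; exact/measurable_EFinP.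
Qed.

Lemma smooth_ac (a b : R) (u : R -> R) : smooth u -> ac a b u u^`()%classic.
Proof.
move=> su; have cu := smooth_continuous su.
have cu' := smooth_continuous (smooth_derive su).
split; first exact: continuous_measurable_fun.
move=> x y _ xy _; have fi : mu.-integrable `[x, y] (EFin \o u^`()%classic).
  apply: continuous_compact_integrable; first exact: segment_compact.
  exact: continuous_subspaceT.
split => //; move: xy; rewrite le_eqVlt => /predU1P[->|xy].
  by rewrite subrr set_itv1 Rintegral_set1.
rewrite /Rintegral (@continuous_FTC2 _ u^`()%classic u)//.
- exact: continuous_subspaceT.
- split => [t _||]; first exact: (su 0%N).
    by apply: cvg_at_right_filter; exact: cu.
  by apply: cvg_at_left_filter; exact: cu.
Qed.

Lemma derive1_outside (c d : R) (u : R -> R) :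
  (forall x, x \notin `[c, d]%classic -> u x = 0) ->
  forall x, x \notin `[c, d]%classic -> u^`()%classic x = 0.
Proof.
move=> u0 x xcd; rewrite derive1E (@near_eq_derive _ _ _ _ (cst 0)) ?derive_cst//.
have : nbhs x (~` `[c, d]%classic).
  apply: open_nbhs_nbhs; split; last by move/negP: xcd; rewrite inE.
  by rewrite openC; exact: itv_closed.
by apply: filterS => y /= ycd; rewrite u0// notin_setE.
Qed.

(** The segment in the definition of a test function may be empty or a point; it is enlarged around
    the midpoint so that [c < d]. *)
Lemma test_function_smooth (a b : R) (u : R -> R) : a < b -> test_function a b u ->
  smooth u /\ exists c d, [/\ a < c, c < d, d < b &
    forall x, x \notin `[c, d]%classic -> u x = 0].
Proof.
move=> ab [su [c [d [ac db u0]]]]; split => //.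
pose m := (a + b) / 2.
exists (Num.min c ((a + m) / 2)), (Num.max d ((m + b) / 2)); split.
- by rewrite lt_min ac /m; lra.
- by rewrite gt_min !lt_max; apply/orP; right; apply/orP; right; rewrite /m; lra.
- by rewrite gt_max db /m; lra.
- move=> x /negP; rewrite inE/= in_itv/= => H; apply: u0.
  apply/negP; rewrite ?inE/= in_itv/= => /andP[cx xd]; apply: H.
  by rewrite ge_min cx le_max xd.
Qed.

(** The product [F u] is absolutely continuous and vanishes at [x0] and [y0], which lie strictly
    between the ends of the interval and the segment [[c, d]] carrying [u]. *)
Lemma ac_weak_integral (a b : R) (F f u : R -> R) : a < b ->
  ac a b F f -> measurable_fun setT F -> test_function a b u ->
  \int[mu]_(x in `]a, b[) (F x * u^`()%classic x) =
  - \int[mu]_(x in `]a, b[) (f x * u x).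
Proof.
move=> ab acF mF /(test_function_smooth ab)[su [c [d [ac cd db u0]]]].
have u0' := derive1_outside u0.
have cu := smooth_continuous su.
have mu_ : measurable_fun setT u by exact: continuous_measurable_fun.
have acP := ac_mul acF (smooth_ac a b su) mF mu_.
pose x0 := (a + c) / 2; pose y0 := (d + b) / 2.
have ax0 : a < x0 by rewrite /x0; lra.
have xc : x0 < c by rewrite /x0; lra.
have dy : d < y0 by rewrite /y0; lra.
have yb : y0 < b by rewrite /y0; lra.
have xy : x0 <= y0 by lra.
have [Pi PE] := proj2 acP x0 y0 ax0 xy yb.
have out x : (x < c) || (d < x) -> x \notin `[c, d]%classic.
  move=> h; rewrite notin_setE/= in_itv/=; apply/negP.
  by rewrite negb_and -!ltNge.
have sub : `[x0, y0]%classic `<=` `]a, b[%classic.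
  move=> t /=; rewrite !in_itv/= => /andP[xt ty].
  by rewrite (lt_le_trans ax0)//= (le_lt_trans ty).
have sup x : `]a, b[%classic x -> ~ `[x0, y0]%classic x -> x \notin `[c, d]%classic.
  move=> _; rewrite /= in_itv/= => /negP; rewrite negb_and -!ltNge => h.
  by apply: out; case/orP: h => h; apply/orP; [left|right]; lra.
have restr (g v : R -> R) : (forall x, x \notin `[c, d]%classic -> v x = 0) ->
    \int[mu]_(x in `]a, b[) (g x * v x) = \int[mu]_(x in `[x0, y0]) (g x * v x).
  by move=> v0; apply: Rintegral_support => // x xab xx; rewrite v0 ?mulr0//; exact: sup.
rewrite !restr//.
have mul_int (g v : R -> R) : mu.-integrable `[x0, y0] (EFin \o g) -> continuous v ->
    mu.-integrable `[x0, y0] (EFin \o (fun x => g x * v x)).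
  move=> gi cv; have /compact_bounded[M [_ HM]] : compact (v @` `[x0, y0]).
    apply: continuous_compact; last exact: segment_compact.
    exact: continuous_subspaceT.
  apply: (@integrable_le _ _ _ (fun t => (M + 1) * `|g t|)) => //.
  - apply: measurable_funM; first by case/integrableP: gi => /measurable_EFinP.
    by apply: measurable_funTS; exact: continuous_measurable_fun.
  - by apply: integrable_scale => //; exact: integrable_norm.
  - move=> t txy; rewrite normrM mulrC ler_wpM2r//.
    by apply: (HM (M + 1)); [rewrite ltrDl|exists t].
have Fi : mu.-integrable `[x0, y0] (EFin \o F).
  apply: continuous_compact_integrable; first exact: segment_compact.
  apply: continuous_in_subspaceT => t /set_mem /sub; rewrite /= in_itv/=.
  exact: ac_continuous acF.
have i1 := mul_int _ _ Fi (smooth_continuous (smooth_derive su)).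
have i2 := mul_int _ _ (ac_integrable acF ax0 yb) cu.
apply/eqP; rewrite -subr_eq0 opprK addrC -RintegralD//.
by rewrite -PE (u0 y0) ?(u0 x0) ?mulr0 ?subrr//; apply: out; rewrite ?xc ?dy ?orbT.
Qed.

Lemma ac_weak_derivative (a b : R) (F f F' f' : R -> R) : a < b ->
  ac a b F f -> measurable_fun setT F ->
  ae_on a b (fun x => F' x = F x) -> ae_on a b (fun x => f' x = f x) ->
  is_weak_derivative a b F' f'.
Proof.
move=> ab acF mF FF' ff'; have mf := proj1 acF; split.
- exists F => //; apply/locally_integrable_itvP; first exact: measurable_funS mF.
  move=> x y ax xy yb; apply: continuous_compact_integrable; first exact: segment_compact.
  apply: continuous_in_subspaceT => t; rewrite inE/= in_itv/= => /andP[xt ty].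
  by apply: ac_continuous acF _; rewrite (lt_le_trans ax)//= (le_lt_trans ty).
- exists f => //; apply/locally_integrable_itvP; first exact: measurable_funS mf.
  by move=> x y ax xy yb; exact: ac_integrable acF _ _.
- move=> u tu; have := ac_weak_integral ab acF mF tu.
  rewrite (@eq_Rintegral_ae _ _ _ (fun x => F' x * u^`()%classic x)).
    move=> ->; congr (- _); apply: eq_Rintegral_ae.
    by apply: aeS ff' => x ffx xab; rewrite ffx// inE.
  by apply: aeS FF' => x ffx xab; rewrite ffx// inE.
Qed.

(** The primitive from minus infinity vanishes to the left of [c] by the support of [theta], and to
    the right of [d] by its zero mean. *)
Lemma smooth_primitive (c d : R) (theta : R -> R) : smooth theta -> c <= d ->
  (forall x, x \notin `[c, d]%classic -> theta x = 0) ->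
  \int[mu]_(x in `[c, d]) theta x = 0 ->
  exists u, [/\ smooth u, u^`()%classic = theta &
    forall x, x \notin `[c, d]%classic -> u x = 0].
Proof.
move=> st cd t0 It.
have ct := smooth_continuous st.
have ti : mu.-integrable setT (EFin \o theta).
  apply: (@integrable_support setT `[c, d]) => //.
    by move=> x _ xcd; apply: t0; rewrite notin_setE.
  apply: continuous_compact_integrable; first exact: segment_compact.
  exact: continuous_subspaceT.
pose u x := \int[mu]_(t in `]-oo, x]) theta t.
have du x : derivable u x 1 /\ u^`()%classic x = theta x.
  apply: (@continuous_FTC1 R theta -oo%O x (x + 1)) => //; first by rewrite ltrDl.
  - exact: integrableS ti.
  - exact: ltNyr.
  - exact: ct.
have u' : u^`()%classic = theta by apply/funext => x; case: (du x).
exists u; split; [|exact: u'|].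
  by apply: smooth_cons; [move=> x; case: (du x)|rewrite u'].
move=> x; rewrite notin_setE/= in_itv/= => /negP; rewrite negb_and -!ltNge => /orP[xc|dx].
  rewrite /u (@Rintegral_support _ set0) ?Rintegral_set0// => t /=.
  rewrite in_itv/= => tx _; apply: t0; rewrite notin_setE/= in_itv/=; apply/negP.
  by rewrite negb_and -ltNge (le_lt_trans tx).
rewrite -It /u; apply: Rintegral_support => t /=; rewrite !in_itv/=.
  by move=> /andP[_ td]; rewrite (le_trans td)// ltW.
by move=> _ tcd; apply: t0; rewrite notin_setE/= in_itv.
Qed.

(* Du Bois-Reymond. *)
Lemma weak_derivative0_const (a b : R) (w : R -> R) : a < b ->
  measurable_fun setT w ->
  (forall x y, a < x -> x <= y -> y < b -> mu.-integrable `[x, y] (EFin \o w)) ->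
  (forall u, test_function a b u ->
     \int[mu]_(x in `]a, b[) (w x * u^`()%classic x) = 0) ->
  exists k, ae_on a b (fun x => w x = k).
Proof.
move=> ab mw wi H.
pose m1 := (2 * a + b) / 3; pose m2 := (a + 2 * b) / 3.
have am1 : a < m1 by rewrite /m1; lra.
have m12 : m1 < m2 by rewrite /m1 /m2; lra.
have m2b : m2 < b by rewrite /m2; lra.
(* Subtracting a multiple of this fixed bump gives any other bump mean zero, hence a test function
   as primitive. The constant sought is the mean [K] of [w] with weight [t0]. *)
pose t0 := bump m1 m2 0.
have cb c d n : continuous (bump c d n : R -> R).
  by apply: smooth_continuous; exact: smooth_bump.
have mb c d n : measurable_fun setT (bump c d n : R -> R).
  exact: continuous_measurable_fun.
have bi (c d : R) n (x y : R) : mu.-integrable `[x, y] (EFin \o bump c d n).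
  apply: continuous_compact_integrable; first exact: segment_compact.
  exact: continuous_subspaceT.
have bout c d n (x y : R) : x <= c -> d <= y ->
    forall t, t \notin `[x, y]%classic -> bump c d n t = 0.
  move=> xc dy t; rewrite notin_setE/= in_itv/= => /negP txy; apply: bump_out.
  by apply: contra txy => /andP[ct td]; apply/andP; split; lra.
have wbi c d n x y : a < x -> x <= y -> y < b ->
    mu.-integrable `[x, y] (EFin \o (fun t => w t * bump c d n t)).
  move=> ax xy yb; apply: (@integrable_le _ _ _ (fun t => `|w t|)) => //.
  - by apply: measurable_funTS; exact: measurable_funM.
  - by apply: integrable_norm; exact: wi.
  - move=> t _; have /andP[h1 h2] := bump_itv c d n t.
    by rewrite normrM (ger0_norm h1) ler_piMr.
pose I0 := \int[mu]_(x in `[m1, m2]) t0 x.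
have I0gt0 : 0 < I0.
  have I0ge0 : 0 <= I0.
    by apply: Rintegral_ge0 => x _; case/andP: (bump_itv m1 m2 0 x).
  rewrite lt_neqAle I0ge0 andbT eq_sym; apply/eqP => I00.
  (* A primitive of [t0] increases strictly on []m1, m2[], where [t0] is positive, so the integral
     [I0] cannot vanish. *)
  have [P acP] := ac_primitive ab (mb m1 m2 0%N) (fun x y _ _ _ => bi m1 m2 0%N x y).
  have acP' := ac_sub (ltW am1) (ltW m2b) acP.
  have Ppos : ae_on m1 m2 (fun t => 0 < t0 t).
    by apply/ae_onP; apply: aeW => t; exact: bump_gt0.
  pose x1 := (2 * m1 + m2) / 3; pose x2 := (m1 + 2 * m2) / 3.
  have mx1 : m1 < x1 by rewrite /x1; lra.
  have x12 : x1 < x2 by rewrite /x1 /x2; lra.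
  have x2m : x2 < m2 by rewrite /x2; lra.
  have P12 : P x1 < P x2 by exact: ac_lt acP' Ppos _ _ _.
  have le (x y : R) : a < x -> x <= y -> y < b -> P x <= P y.
    move=> ax xy yb; have [_ PE] := proj2 acP x y ax xy yb.
    by rewrite -subr_ge0 PE; apply: Rintegral_ge0 => t _; case/andP: (bump_itv m1 m2 0 t).
  have [_ PE] := proj2 acP m1 m2 am1 (ltW m12) m2b.
  have h1 : P m1 <= P x1 by apply: le; lra.
  have h2 : P x2 <= P m2 by apply: le; lra.
  move: PE; rewrite -/t0 -/I0 I00; lra.
pose K := (\int[mu]_(x in `[m1, m2]) (w x * t0 x)) / I0.
exists K.
have testI (c d : R) n : a < c -> c <= d -> d < b ->
    \int[mu]_(x in `[c, d]) (w x * bump c d n x) =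
    K * \int[mu]_(x in `[c, d]) bump c d n x.
  move=> ac cd db.
  pose x1 := Num.min c m1; pose x2 := Num.max d m2.
  have ax1 : a < x1 by rewrite lt_min ac am1.
  have x2b : x2 < b by rewrite gt_max db m2b.
  have x1c : x1 <= c by rewrite ge_min lexx.
  have x1m : x1 <= m1 by rewrite ge_min lexx orbT.
  have dx2 : d <= x2 by rewrite le_max lexx.
  have mx2 : m2 <= x2 by rewrite le_max lexx orbT.
  have x12 : x1 <= x2 by lra.
  have ext (c' d' : R) n' (v : R -> R) : x1 <= c' -> d' <= x2 ->
      \int[mu]_(x in `[c', d']) (v x * bump c' d' n' x) =
      \int[mu]_(x in `[x1, x2]) (v x * bump c' d' n' x).
    move=> x1c' dx2'; apply/esym; apply: Rintegral_support => t /=; rewrite !in_itv/=.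
      by move=> /andP[ct td]; apply/andP; split; lra.
    by move=> _ tcd; rewrite (bout c' d' n' c' d') ?mulr0// notin_setE/= in_itv.
  have ext1 (c' d' : R) n' : x1 <= c' -> d' <= x2 ->
      \int[mu]_(x in `[c', d']) bump c' d' n' x =
      \int[mu]_(x in `[x1, x2]) bump c' d' n' x.
    move=> h1 h2; have := ext c' d' n' (cst 1) h1 h2.
    by under eq_Rintegral do rewrite mul1r; under [RHS]eq_Rintegral do rewrite mul1r.
  pose J := \int[mu]_(x in `[c, d]) bump c d n x.
  pose theta x := bump c d n x + (- (J / I0)) * t0 x.
  have st : smooth theta.
    apply: smooth_add; first exact: smooth_bump.
    by apply: smooth_scale; exact: smooth_bump.
  have th0 x : x \notin `[x1, x2]%classic -> theta x = 0.
    by move=> xx; rewrite /theta /t0 !(bout _ _ _ x1 x2)// mulr0 addr0.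
  have Ith : \int[mu]_(x in `[x1, x2]) theta x = 0.
    have h1 := bi c d n x1 x2; have h2 := bi m1 m2 0%N x1 x2.
    rewrite RintegralD//; last by apply: integrable_scale.
    by rewrite RintegralZl// /t0 -!ext1// -/J -/t0 -/I0 mulNr divfK ?subrr// gt_eqF.
  have [u [su u' u0]] := smooth_primitive st x12 th0 Ith.
  have tu : test_function a b u by split => //; exists x1, x2; split.
  have Hu := H u tu; rewrite u' in Hu.
  have {}Hu : \int[mu]_(x in `[x1, x2]) (w x * theta x) = 0.
    rewrite -Hu; apply/esym; apply: Rintegral_support => t /=; rewrite !in_itv/=.
      by move=> /andP[h1 h2]; apply/andP; split; lra.
    by move=> _ xx; rewrite th0 ?mulr0// notin_setE/= in_itv.
  have : \int[mu]_(x in `[x1, x2]) (w x * bump c d n x + - (J / I0) * (w x * t0 x)) = 0.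
    by rewrite -Hu; apply: eq_Rintegral => x _; rewrite /theta; ring.
  rewrite RintegralD//; last 2 first.
  - exact: wbi.
  - by apply: integrable_scale => //; exact: wbi.
  rewrite RintegralZl//; last exact: wbi.
  rewrite /t0 -!ext// -/t0 => /eqP; rewrite mulNr subr_eq0 => /eqP ->.
  by rewrite /K -/J; ring.
have : ae_on a b (fun x => w x - K = 0).
  apply: ae_eq0_of_itv_integrals => c d ac cd db.
  have Ki : mu.-integrable `[c, d] (EFin \o cst K).
    apply: continuous_compact_integrable; first exact: segment_compact.
    by apply: continuous_subspaceT => ?; exact: cvg_cst.
  split; first by apply: integrable_sub => //; exact: wi.
  rewrite -Rintegral_itv_bndo_bndc; last first.
    by apply: integrableS (integrable_sub _ (wi c d ac cd db) Ki) => //; apply: subset_itvl; rewrite bnd_simp.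
  rewrite -Rintegral_itv_obnd_cbnd; last first.
    by apply: integrableS (integrable_sub _ (wi c d ac cd db) Ki) => //; apply: subset_itv; rewrite bnd_simp.
  have sub : `]c, d[%classic `<=` `[c, d]%classic.
    by apply: subset_itv; rewrite bnd_simp.
  have mwK : measurable_fun setT (fun x => w x - K) by exact: measurable_funB.
  (* The bumps tend to 1 on []c, d[]; the identity [testI] for each of them passes to the limit and
     makes the integral of [w - K] over the segment vanish. *)
  have [|||||_ H1] := @Rintegral_dominated_cvg `]c, d[ (fun n x => (w x - K) * bump c d n x)
      (fun x => w x - K) (fun x => `|w x - K|) (measurable_itv _).
  - by move=> n; apply: measurable_funTS; exact: measurable_funM.
  - exact: measurable_funTS.
  - move=> x; rewrite /= in_itv/= => xcd; rewrite -[X in _ --> X]mulr1.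
    by apply: cvgMr; have := @bump_cvg R c d x; rewrite xcd.
  - apply: integrable_norm; apply: integrableS (integrable_sub _ (wi c d ac cd db) Ki) => //.
  - move=> n x _; have /andP[h1 h2] := bump_itv c d n x.
    by rewrite normrM (ger0_norm h1) ler_piMr.
  have H0 : (fun n => \int[mu]_(x in `]c, d[) ((w x - K) * bump c d n x)) = cst 0.
    apply/funext => n.
    have ci := integrable_scale K (measurable_itv _) (bi c d n c d).
    have := testI c d n ac cd db; rewrite -RintegralZl// => /eqP.
    rewrite -subr_eq0 -RintegralB//; last exact: wbi.
    rewrite (@Rintegral_support _ `]c, d[)//; last first.
      by move=> x _; rewrite /= in_itv/= => /negP xcd; rewrite bump_out// !mulr0 subrr.
    move=> /eqP <-; apply: eq_Rintegral => x _; ring.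
  by move: H1; rewrite H0 => /(cvg_unique _ (cvg_cst 0)) <-.
by apply: aeS => x h /h/eqP; rewrite subr_eq0 => /eqP.
Qed.

End weak_derivative.

(** * Representatives in Sobolev and Lebesgue classes *)

Section sobolev.
Context {R : realType}.
Notation mu := (@lebesgue_measure R).

Lemma integrable_mul_test (a b : R) (g u : R -> R) : a < b ->
  measurable_fun setT g ->
  (forall x y, a < x -> x <= y -> y < b -> mu.-integrable `[x, y] (EFin \o g)) ->
  test_function a b u ->
  mu.-integrable `]a, b[ (EFin \o (fun x => g x * u x)) /\
  mu.-integrable `]a, b[ (EFin \o (fun x => g x * u^`()%classic x)).
Proof.
move=> ab mg gi /(test_function_smooth ab)[su [c [d [ac cd db u0]]]].
suff H (v : R -> R) : smooth v -> (forall x, x \notin `[c, d]%classic -> v x = 0) ->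
    mu.-integrable `]a, b[ (EFin \o (fun x => g x * v x)).
  by split; apply: H => //; [exact: smooth_derive|exact: derive1_outside].
move=> sv v0; have cv := smooth_continuous sv.
apply: (@integrable_support _ _ `[c, d]) => //.
- move=> t /=; rewrite !in_itv/= => /andP[ct td].
  by rewrite (lt_le_trans ac)//= (le_lt_trans td).
- by move=> x _ xcd; rewrite v0 ?mulr0// notin_setE.
have gcd := gi c d ac (ltW cd) db.
have /compact_bounded[M [_ HM]] : compact (v @` `[c, d]).
  apply: continuous_compact; last exact: segment_compact.
  exact: continuous_subspaceT.
apply: (@integrable_le _ _ _ (fun t => (M + 1) * `|g t|)) => //.
- apply: measurable_funM; first exact: measurable_funTS.
  by apply: measurable_funTS; exact: continuous_measurable_fun.
- by apply: integrable_scale => //; exact: integrable_norm.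
- move=> t tcd; rewrite normrM mulrC ler_wpM2r//.
  by apply: (HM (M + 1)); [rewrite ltrDl|exists t].
Qed.

Lemma in_L1loc_borel (a b : R) (f : R -> R) : in_L1loc a b f ->
  exists g, [/\ measurable_fun setT g, ae_on a b (fun x => f x = g x) &
   forall x y, a < x -> x <= y -> y < b -> mu.-integrable `[x, y] (EFin \o g)].
Proof.
move=> [g0 lg fg]; have [mg0 _ _] := lg.
have gi := (locally_integrable_itvP mg0).1 lg.
have mab : measurable `]a, b[%classic by exact: measurable_itv.
exists (g0 \_ `]a, b[); split.
- by apply: (measurable_restrictT _ mab).1; exact: mg0.
- by apply: aeS fg => x fg xab; rewrite fg// patchE xab.
- move=> x y ax xy yb; apply: eq_integrable (gi x y ax xy yb) => //.
  move=> t; rewrite inE/= in_itv/= => /andP[xt ty].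
  rewrite patchE mem_set//= in_itv/=.
  by rewrite (lt_le_trans ax)//= (le_lt_trans ty).
Qed.

(** The difference of [f] and a primitive of [f'] has zero weak derivative, hence is constant by du
    Bois-Reymond; adding this constant to the primitive gives the representative. *)
Lemma weak_derivative_ac (a b : R) (f f' : R -> R) : a < b ->
  is_weak_derivative a b f f' ->
  exists F f1, [/\ ac a b F f1, measurable_fun setT F,
    ae_on a b (fun x => f x = F x) & ae_on a b (fun x => f' x = f1 x)].
Proof.
move=> ab [/in_L1loc_borel[g [mg fg gi]] /in_L1loc_borel[f1 [mf1 ff1 f1i]] H].
have mab : measurable `]a, b[%classic by exact: measurable_itv.
have [H0 acH0] := ac_primitive ab mf1 f1i.
pose F0 := H0 \_ `]a, b[.
have mF0 : measurable_fun setT F0.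
  by apply: (measurable_restrictT _ mab).1; exact: ac_measurable acH0.
have acF0 : ac a b F0 f1.
  apply: ac_ext acH0 _ mf1 (aeW _ (fun _ _ => erefl)) => x xab.
  by rewrite /F0 patchE mem_set//= in_itv.
have F0i x y : a < x -> x <= y -> y < b -> mu.-integrable `[x, y] (EFin \o F0).
  move=> ax xy yb; apply: continuous_compact_integrable; first exact: segment_compact.
  apply: continuous_in_subspaceT => t; rewrite inE/= in_itv/= => /andP[xt ty].
  by apply: ac_continuous acF0 _; rewrite (lt_le_trans ax)//= (le_lt_trans ty).
have [k wk] : exists k, ae_on a b (fun x => g x - F0 x = k).
  apply: weak_derivative0_const => //.
  - exact: measurable_funB.
  - by move=> x y ax xy yb; apply: integrable_sub => //; [exact: gi|exact: F0i].
  - move=> u tu.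
    have [_ gu] := integrable_mul_test ab mg gi tu.
    have [_ Fu] := integrable_mul_test ab mF0 F0i tu.
    rewrite (_ : \int[mu]_(x in _) _ =
        \int[mu]_(x in `]a, b[) (g x * u^`()%classic x - F0 x * u^`()%classic x)).
      rewrite RintegralB// (ac_weak_integral ab acF0 mF0 tu).
      rewrite (@eq_Rintegral_ae _ _ _ (fun x => f x * u^`()%classic x)).
        rewrite H// (@eq_Rintegral_ae _ _ _ (fun x => f1 x * u x)) ?subrr//.
        by apply: aeS ff1 => x ffx xab; rewrite ffx// inE.
      by apply: aeS fg => x ffx xab; rewrite ffx// inE.
    by apply: eq_Rintegral => x _; rewrite mulrBl.
exists (fun x => F0 x + 1 * cst k x), f1; split => //.
- apply: ac_ext (ac_lin 1 acF0 (ac_cst a b k)) _ mf1 _ => //.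
  by apply: aeW => x _ /=; rewrite mulr0 addr0.
- by apply: measurable_funD => //; exact: measurable_funM.
- apply: aeS2 fg wk => x fg wk xab.
  by rewrite fg// -(wk xab) /=; ring.
Qed.

Lemma W11loc_ac (a b : R) (f : R -> R) : a < b -> in_W11loc a b f ->
  exists F f1, [/\ ac a b F f1, measurable_fun setT F,
    ae_on a b (fun x => f x = F x) & ae_on a b (fun x => wderiv a b f x = f1 x)].
Proof.
move=> ab /(@xgetPex _ (cst 0) [set f' | is_weak_derivative a b f f']).
exact: weak_derivative_ac.
Qed.

(** The value of [wderiv] is an arbitrary choice; uniqueness of the derivative of an absolutely
    continuous function identifies it almost everywhere with [f1]. *)
Lemma ac_wderiv (a b : R) (f F f1 : R -> R) : a < b -> ac a b F f1 ->
  measurable_fun setT F -> ae_on a b (fun x => f x = F x) ->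
  in_W11loc a b f /\ ae_on a b (fun x => wderiv a b f x = f1 x).
Proof.
move=> ab acF mF fF.
have W : in_W11loc a b f.
  by exists f1; apply: ac_weak_derivative acF mF fF (aeW _ _).
split => //; have [G [g1 [acG mG fG wg]]] := W11loc_ac ab W.
have : ae_on a b (fun x => f1 x = g1 x).
  apply: ac_unique_ae acF acG _.
  by apply: aeS2 fF fG => x h1 h2 xab; rewrite -h1// h2.
by apply: aeS2 wg => x h1 h2 xab; rewrite h1// h2.
Qed.

(** The Lebesgue class for a representative that is Borel on the whole line, expressed by an
    integral instead of a norm, so that membership is proved by pointwise domination. *)
Definition Lr (a b r : R) (f : R -> R) : Prop :=
  measurable_fun setT f /\ mu.-integrable `]a, b[ (EFin \o (fun x => `|f x| `^ r)).

Lemma measurable_abs_powR (r : R) (D : set R) (f : R -> R) : measurable_fun D f ->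
  measurable_fun D (fun x => `|f x| `^ r).
Proof. by move=> mf; apply: measurable_fun_powR; exact: measurableT_comp. Qed.

Lemma in_LpP (a b r : R) (f : R -> R) : 0 < r ->
  in_Lp a b r f <-> exists2 g, Lr a b r g & ae_on a b (fun x => f x = g x).
Proof.
move=> r0; have mab : measurable `]a, b[%classic by exact: measurable_itv.
have restr (g : R -> R) : (\int[mu]_x `|((g \_ `]a, b[) x)%:E| `^ r =
    \int[mu]_(x in `]a, b[) (`|g x| `^ r)%:E)%E.
  rewrite [RHS]integral_mkcond; apply: eq_integral => x _.
  rewrite !patchE; case: ifPn => // _.
  by rewrite abse0 poweR0r// gt_eqF.
split.
  move=> [g]; rewrite inE => /andP[/[!inE]/= mg].
  rewrite /finite_norm unlock /Lnorm => /lty_poweRy.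
  rewrite invr_eq0 gt_eqF// => /(_ isT); rewrite restr => gi fg.
  exists (g \_ `]a, b[); last by apply: aeS fg => x fg xab; rewrite fg// patchE xab.
  split => //; apply/integrableP; split.
    by apply/measurable_EFinP; apply: measurable_abs_powR; exact: measurable_funTS.
  apply: le_lt_trans gi; rewrite le_eqVlt; apply/orP; left; apply/eqP.
  apply: eq_integral => x xab.
  by rewrite /= patchE xab ger0_norm ?powR_ge0.
move=> [g [mg /integrableP[_ gi]] fg]; exists g => //.
rewrite inE; apply/andP; split; rewrite inE/=.
  by apply: (measurable_restrictT _ mab).1; exact: measurable_funTS.
rewrite /finite_norm unlock /Lnorm; apply: poweR_lty; rewrite restr.
apply: le_lt_trans gi; rewrite le_eqVlt; apply/orP; left; apply/eqP.
by apply: eq_integral => x _ /=; rewrite [in RHS]ger0_norm ?powR_ge0.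
Qed.

Section Lr_theory.
Variables (a b r : R).
Hypothesis r0 : 0 < r.

Lemma Lr_le (f g : R -> R) (M : R) : measurable_fun setT f -> Lr a b r g -> 0 <= M ->
  (forall x, a < x < b -> `|f x| <= M * `|g x|) -> Lr a b r f.
Proof.
move=> mf [mg gi] M0 fg; split => //.
apply: (@integrable_le _ _ _ (fun x => M `^ r * `|g x| `^ r)) => //.
- by apply: measurable_abs_powR; exact: measurable_funTS.
- exact: integrable_scale.
- move=> x; rewrite /= in_itv/= => xab; rewrite ger0_norm ?powR_ge0// -powRM//.
  by apply: ge0_ler_powR; rewrite ?nnegrE ?mulr_ge0 ?(ltW r0)//; exact: fg.
Qed.

Lemma Lr_bounded (f : R -> R) (M : R) : measurable_fun setT f ->
  (forall x, a < x < b -> `|f x| <= M) -> Lr a b r f.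
Proof.
move=> mf fM; split => //; apply: (@integrable_bounded _ a b (M `^ r)) => //.
- by apply: subset_itv; rewrite bnd_simp.
- by apply: measurable_abs_powR; exact: measurable_funTS.
- move=> x; rewrite /= in_itv/= => xab; rewrite ger0_norm ?powR_ge0//.
  have := fM x xab => fxM.
  by apply: ge0_ler_powR; rewrite ?nnegrE ?(le_trans _ fxM) ?(ltW r0).
Qed.

Lemma Lr_add (f g : R -> R) : Lr a b r f -> Lr a b r g -> Lr a b r (fun x => f x + g x).
Proof.
move=> [mf fi] [mg gi]; split; first exact: measurable_funD.
apply: (@integrable_le _ _ _ (fun x => 2 `^ r * (`|f x| `^ r + `|g x| `^ r))) => //.
- by apply: measurable_abs_powR; apply: measurable_funTS; exact: measurable_funD.
- by apply: integrable_scale => //; exact: integrable_add.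
- move=> x _; rewrite ger0_norm ?powR_ge0//.
  have H (u v : R) : `|u| <= `|v| -> `|u + v| `^ r <= 2 `^ r * `|v| `^ r.
    move=> uv; rewrite -powRM//; apply: ge0_ler_powR; rewrite ?nnegrE ?mulr_ge0 ?(ltW r0)//.
    by rewrite (le_trans (ler_normD _ _))// mulrDl mul1r lerD2r.
  have [fg|/ltW gf] := leP `|f x| `|g x|.
    by rewrite (le_trans (H _ _ fg))// ler_wpM2l ?powR_ge0// lerDr powR_ge0.
  by rewrite addrC (le_trans (H _ _ gf))// ler_wpM2l ?powR_ge0// lerDl powR_ge0.
Qed.

Lemma Lr_mul (f g : R -> R) (M : R) : Lr a b r f -> measurable_fun setT g ->
  (forall x, a < x < b -> `|g x| <= M) -> Lr a b r (fun x => f x * g x).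
Proof.
move=> Lf mg gM; have [ab|ba] := ltP a b; last first.
  apply: (@Lr_bounded _ 0); first by apply: measurable_funM => //; case: Lf.
  by move=> x /andP[ax xb]; exfalso; lra.
have M0 : 0 <= M by rewrite (le_trans _ (gM ((a + b) / 2) _))//; apply/andP; split; lra.
apply: (Lr_le _ Lf M0); first by apply: measurable_funM => //; case: Lf.
by move=> x xab; rewrite normrM mulrC ler_wpM2r//; exact: gM.
Qed.

Lemma Lr_scale (f : R -> R) (k : R) : Lr a b r f -> Lr a b r (fun x => k * f x).
Proof.
move=> Lf; apply: (Lr_le _ Lf (normr_ge0 k)); last by move=> x _; rewrite normrM.
by apply: measurable_funM => //; case: Lf.
Qed.

Lemma Lr_sub (c d : R) (f : R -> R) : c <= a -> b <= d -> Lr c d r f -> Lr a b r f.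
Proof.
move=> ca bd [mf fi]; split => //; apply: integrableS fi => //.
by apply: subset_itv; rewrite bnd_simp.
Qed.

Lemma Lr_support (c d : R) (f : R -> R) : a <= c -> d <= b ->
  (forall x, ~~ (c < x < d) -> f x = 0) -> Lr c d r f -> Lr a b r f.
Proof.
move=> ac db f0 [mf fi]; split => //.
apply: (@integrable_support _ _ `]c, d[) => //.
  by apply: subset_itv; rewrite bnd_simp.
by move=> x _; rewrite /= in_itv/= => /negP xcd; rewrite f0// normr0 powR0// gt_eqF.
Qed.

Lemma Lr_ae_eq (f g : R -> R) : Lr a b r f -> measurable_fun setT g ->
  ae_on a b (fun x => f x = g x) -> Lr a b r g.
Proof.
move=> [mf fi] mg fg; split => //; apply: integrable_ae_eq fi _ _ => //.
  by apply: measurable_abs_powR; exact: measurable_funTS.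
by apply: aeS fg => x fg xab; rewrite fg// inE.
Qed.

Lemma Lr_integrable (f : R -> R) : 1 <= r -> Lr a b r f -> mu.-integrable `]a, b[ (EFin \o f).
Proof.
move=> r1 [mf fi]; apply: (@integrable_le _ _ _ (fun x => cst 1 x + `|f x| `^ r)) => //.
- exact: measurable_funTS.
- apply: integrable_add => //; apply: (@integrable_bounded _ a b 1) => //.
    by apply: subset_itv; rewrite bnd_simp.
  by move=> x _; rewrite normr1.
- move=> x _ /=; have [h|h] := leP 1 `|f x|.
    by rewrite (le_trans (le1r_powR h r1))// lerDr.
  by rewrite (le_trans (ltW h))// lerDl powR_ge0.
Qed.

End Lr_theory.

Lemma Lr1P (a b : R) (f : R -> R) : measurable_fun setT f ->
  Lr a b 1 f <-> mu.-integrable `]a, b[ (EFin \o f).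
Proof.
move=> mf; split; first exact: Lr_integrable.
move=> fi; split => //; have := integrable_norm fi; apply: eq_integrable => // x _ /=.
by rewrite powRr1.
Qed.

Lemma crepP (f : R -> R) :
  (exists g : R -> R, {within `[0, 1], continuous g} /\ ae_on 0 1 (fun x => f x = g x)) ->
  {within `[0, 1], continuous (crep f)} /\ ae_on 0 1 (fun x => f x = crep f x).
Proof.
exact: (@xgetPex _ (cst 0) [set g : R -> R | {within `[0, 1], continuous g} /\
                        ae_on 0 1 (fun x => f x = g x)]).
Qed.

Lemma within01_continuous_ext (f g : R -> R) :
  {within `[0, 1], continuous f} -> {within `[0, 1], continuous g} ->
  ae_on 0 1 (fun x => f x = g x) -> f 0 = g 0 /\ f 1 = g 1.
Proof.
move=> /continuous_within_itvP => /(_ ltr01)[cf f0 f1].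
move=> /continuous_within_itvP => /(_ ltr01)[cg g0 g1] fg.
have fgE x : 0 < x < 1 -> f x = g x.
  by move=> x01; apply: ae_eq_continuous fg x x01 => t t01; [apply: cf|apply: cg];
    rewrite in_itv.
have h0 : f x @[x --> 0^'+] --> g 0.
  apply: cvg_trans g0; apply: near_eq_cvg; near=> x; rewrite fgE//.
  apply/andP; split; near: x; first exact: nbhs_right_gt.
  exact: (nbhs_right_lt (@ltr01 R)).
have h1 : f x @[x --> 1^'-] --> g 1.
  apply: cvg_trans g1; apply: near_eq_cvg; near=> x; rewrite fgE//.
  apply/andP; split; near: x; last exact: nbhs_left_lt.
  exact: (nbhs_left_gt (@ltr01 R)).
split.
  exact: (cvg_unique (@Rhausdorff R) f0 h0).
exact: (cvg_unique (@Rhausdorff R) f1 h1).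
Unshelve. all: by end_near. Qed.

(** Integrability of [f] up to both ends extends [F] continuously to [[0, 1]]; this supplies the
    existence that [crepP] asks for. *)
Lemma ac_within01 (F f : R -> R) : ac 0 1 F f -> mu.-integrable `]0, 1[ (EFin \o f) ->
  exists G : R -> R, {within `[0, 1], continuous G} /\ forall x, 0 < x < 1 -> F x = G x.
Proof.
move=> acF fi; have mf := proj1 acF.
have fi' : mu.-integrable `[0, 1] (EFin \o f).
  exact: integrable_itv_rclosed mf (integrable_itv_lclosed mf fi).
have fsub (x : R) : x <= 1 -> mu.-integrable `[0, x] (EFin \o f).
  by move=> x1; apply: integrableS fi' => //; apply: subset_itvl; rewrite bnd_simp.
pose I x := \int[mu]_(t in `[0, x]) f t.
pose m : R := 1 / 2; have m0 : 0 < m by rewrite /m; lra.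
have m1 : m < 1 by rewrite /m; lra.
exists (fun x => I x + cst (F m - I m) x); split.
  move=> x; apply: continuousD; last exact: cst_continuous.
  exact: (parameterized_integral_continuous ler01 fi').
move=> x /andP[x0 x1] /=; rewrite /I.
have [xm|/ltW mx] := leP x m.
  have [_ FE] := proj2 acF x m x0 xm m1.
  rewrite (@Rintegral_split _ f 0 x (BRight m)) ?bnd_simp// ?ltW//; last exact: fsub (ltW m1).
  by rewrite -FE; ring.
have [_ FE] := proj2 acF m x m0 mx x1.
rewrite (@Rintegral_split _ f 0 m (BRight x)) ?bnd_simp// ?ltW//; last exact: fsub (ltW x1).
by rewrite -FE; ring.
Qed.

End sobolev.

(** * Convex integrands *)

Section convexity.
Context {R : realType}.
Notation mu := (@lebesgue_measure R).

(** Convexity in the form of supporting lines: these bound both the values along a line and the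
    products of the derivative with a direction. *)
Definition tangent_convex (D : set R) (f : R -> R) : Prop :=
  forall x y, D x -> D y -> f x + f^`()%classic x * (y - x) <= f y.

Lemma derive2_tangent_convex (D : set R) (f : R -> R) :
  (forall x y z, D x -> D y -> x <= z <= y -> D z) ->
  (forall x, D x -> derivable f x 1) ->
  (forall x, D x -> derivable f^`()%classic x 1) ->
  (forall x, D x -> 0 <= f^`(2)%classic x) -> tangent_convex D f.
Proof.
move=> convD df df' f2.
have mvt (k : R -> R) x y : (forall z, D z -> derivable k z 1) -> D x -> D y -> x <= y ->
    exists2 c, D c /\ x <= c <= y & k y - k x = k^`()%classic c * (y - x).
  move=> dk Dx Dy xy.
  have inD z : x <= z <= y -> D z by exact: convD.
  have [||c cxy E] := @MVT_segment R k k^`()%classic x y xy.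
  - move=> z; rewrite in_itv/= => /andP[/ltW xz /ltW zy].
    by rewrite derive1E; apply: derivableP; apply: dk; apply: inD; rewrite xz.
  - apply: derivable_within_continuous => z; rewrite in_itv/= => zxy.
    by apply: dk; exact: inD.
  - by exists c => //; move: cxy; rewrite in_itv/= => cxy; split => //; exact: inD.
have mono x y : D x -> D y -> x <= y -> f^`()%classic x <= f^`()%classic y.
  move=> Dx Dy xy; have [c [Dc _] E] := mvt _ x y df' Dx Dy xy.
  by rewrite -subr_ge0 E mulr_ge0 ?subr_ge0//; exact: f2.
move=> x y Dx Dy; have [xy|/ltW yx] := leP x y.
  have [c [Dc /andP[xc _]] E] := mvt _ x y df Dx Dy xy.
  by rewrite -lerBrDl E ler_wpM2r ?subr_ge0//; exact: mono.
have [c [Dc /andP[_ cx]] E] := mvt _ y x df Dy Dx yx.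
have {}E : f y - f x = f^`()%classic c * (y - x) by rewrite -[LHS]opprB E -mulrN opprB.
by rewrite -lerBrDl E ler_wnM2r ?subr_le0//; exact: mono.
Qed.

(* The consequences of convexity of k on [-1, 1] which involve the centre 0. *)
Definition centre_convex (k : R -> R) : Prop := forall s, 0 <= s <= 1 ->
  [/\ k s <= (1 - s) * k 0 + s * k 1, k (- s) <= (1 - s) * k 0 + s * k (-1)
    & 2 * k 0 <= k s + k (- s)].

Lemma centre_convexD k1 k2 : centre_convex k1 -> centre_convex k2 ->
  centre_convex (fun s => k1 s + k2 s).
Proof.
by move=> H1 H2 s s01; have [a1 a2 a3] := H1 s s01; have [b1 b2 b3] := H2 s s01; split; lra.
Qed.

Lemma centre_convexZ c k : 0 <= c -> centre_convex k -> centre_convex (fun s => c * k s).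
Proof.
move=> c0 H s s01; have [a1 a2 a3] := H s s01; split.
- by apply: le_trans (ler_wpM2l c0 a1) _; rewrite le_eqVlt; apply/orP; left; apply/eqP; ring.
- by apply: le_trans (ler_wpM2l c0 a2) _; rewrite le_eqVlt; apply/orP; left; apply/eqP; ring.
- by have := ler_wpM2l c0 a3; rewrite mulrDr mulrCA.
Qed.

(** For the first two bounds, take the supporting line at the intermediate point, at both ends of
    its segment, with weights [1 - s] and [s]: the slopes cancel. For the third, the supporting line
    at [x] is used in opposite directions. *)
Lemma tangent_convex_centre (D : set R) (f : R -> R) x y : tangent_convex D f ->
  (forall s, -1 <= s <= 1 -> D (x + s * y)) -> centre_convex (fun s => f (x + s * y)).
Proof.
move=> cf inD s /andP[s0 s1].
have D0 : D x by rewrite -(addr0 x) -(mul0r y); apply: inD; apply/andP; split; lra.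
have E0 : x + 0 * y = x by ring.
have D1 : D (x + 1 * y) by apply: inD; apply/andP; split; lra.
have DN1 : D (x + -1 * y) by apply: inD; apply/andP; split; lra.
have Ds : D (x + s * y) by apply: inD; apply/andP; split; lra.
have DNs : D (x + - s * y) by apply: inD; apply/andP; split; lra.
rewrite E0; split.
- have h1 := cf _ _ Ds D0; have h2 := cf _ _ Ds D1.
  have s1' : 0 <= 1 - s by lra.
  have := lerD (ler_wpM2l s1' h1) (ler_wpM2l s0 h2).
  move: (f^`()%classic _) => t; apply: le_trans.
  by rewrite le_eqVlt; apply/orP; left; apply/eqP; ring.
- have h1 := cf _ _ DNs D0; have h2 := cf _ _ DNs DN1.
  have s1' : 0 <= 1 - s by lra.
  have := lerD (ler_wpM2l s1' h1) (ler_wpM2l s0 h2).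
  move: (f^`()%classic _) => t; apply: le_trans.
  by rewrite le_eqVlt; apply/orP; left; apply/eqP; ring.
- have := lerD (cf _ _ D0 Ds) (cf _ _ D0 DNs).
  move: (f^`()%classic _) => t; apply: le_trans.
  by rewrite le_eqVlt; apply/orP; left; apply/eqP; ring.
Qed.

(** The quotient of [e s - e 0] by [s] is at most [e 1 - e 0] by convexity. It is at least
    [e 0 - e (-1)], since [e s - e 0] is at least [e 0 - e (- s)]. Both bounds are free of [s], so
    dominated convergence applies along [s = 1 / (n + 1)]. *)
Lemma right_variation (D : set R) (e : R -> R -> R) (q : R -> R) : measurable D ->
  (forall s, -1 <= s <= 1 -> mu.-integrable D (EFin \o e s)) ->
  (forall x, D x -> centre_convex (e ^~ x)) ->
  (forall x, D x -> is_derive (0 : R) 1 (e ^~ x) (q x)) ->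
  measurable_fun D q ->
  (forall s, -1 <= s <= 1 -> \int[mu]_(x in D) e 0 x <= \int[mu]_(x in D) e s x) ->
  mu.-integrable D (EFin \o q) /\ 0 <= \int[mu]_(x in D) q x.
Proof.
move=> mD ei ce de mq emin.
pose s_ (n : nat) : R := n.+1%:R^-1.
have s0 n : 0 < s_ n by rewrite invr_gt0.
have s1 n : s_ n <= 1 by rewrite invf_le1// ler1n.
have sI n : -1 <= s_ n <= 1 by rewrite s1 andbT (le_trans _ (ltW (s0 n))).
pose f_ n x := (s_ n)^-1 * (e (s_ n) x - e 0 x).
have I0 : -1 <= (0 : R) <= 1 by rewrite lerN10 ler01.
have I1 : -1 <= (1 : R) <= 1 by rewrite lexx andbT; lra.
have IN1 : -1 <= (-1 : R) <= 1 by rewrite lexx; lra.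
have fi n : mu.-integrable D (EFin \o f_ n).
  by apply: integrable_scale => //; apply: integrable_sub => //; exact: ei.
pose g x := (`|e 1 x| + `|e (-1) x|) + 2 * `|e 0 x|.
have [|||||qi Hlim] := @Rintegral_dominated_cvg R D f_ q g mD.
- by move=> n; case/integrableP: (fi n) => /measurable_EFinP.
- exact: mq.
- move=> x Dx; have /is_derive1_caratheodory[k [kE kc kq]] := de x Dx.
  rewrite (_ : (fun n => _) = k \o s_); last first.
    apply/funext => n; rewrite /f_ kE subr0 /= mulrC mulfK//.
    by rewrite gt_eqF.
  rewrite -kq; apply: continuous_cvg => //.
  exact: cvg_harmonic.
- apply: integrable_add => //; last by apply: integrable_scale => //; apply: integrable_norm; exact: ei.
  by apply: integrable_add => //; apply: integrable_norm; exact: ei.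
- move=> n x Dx; have sn01 : 0 <= s_ n <= 1 by rewrite (ltW (s0 n)) s1.
  have [h1 h2 h3] := ce x Dx (s_ n) sn01.
  have a1 := ler_norm (e 1 x); have a2 := ler_norm (e (-1) x).
  have a3 := ler_norm (e 0 x); have a3' := lerNnormlW (lexx `|e 0 x|).
  have a4 := normr_ge0 (e 1 x); have a5 := normr_ge0 (e (-1) x).
  rewrite /f_ ler_norml /g; apply/andP; split.
    rewrite ler_pdivlMl//.
    have := s0 n; move: (s_ n) h1 h2 h3 => s h1 h2 h3 s0'; nra.
  rewrite ler_pdivrMl//.
  have := s0 n; move: (s_ n) h1 h2 h3 => s h1 h2 h3 s0'; nra.
split => //.
rewrite -(cvg_lim _ Hlim)//; apply: limr_ge; first by apply/cvg_ex; eexists; exact: Hlim.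
apply: nearW => n; rewrite /f_ RintegralZl//; last by apply: integrable_sub => //; exact: ei.
rewrite mulr_ge0 ?invr_ge0 ?(ltW (s0 n))// RintegralB//; [|exact: ei|exact: ei].
by rewrite subr_ge0; exact: emin.
Qed.

(* Convexity bounds the difference quotients by the values at the two endpoints,
   so that no growth condition on derivatives is needed. *)
Lemma variation_eq0 (D : set R) (e : R -> R -> R) (q : R -> R) : measurable D ->
  (forall s, -1 <= s <= 1 -> mu.-integrable D (EFin \o e s)) ->
  (forall x, D x -> centre_convex (e ^~ x)) ->
  (forall x, D x -> is_derive (0 : R) 1 (e ^~ x) (q x)) ->
  measurable_fun D q ->
  (forall s, -1 <= s <= 1 -> \int[mu]_(x in D) e 0 x <= \int[mu]_(x in D) e s x) ->
  mu.-integrable D (EFin \o q) /\ \int[mu]_(x in D) q x = 0.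
Proof.
move=> mD ei ce de mq emin.
have [qi q0] := right_variation mD ei ce de mq emin; split => //.
have NI (s : R) : -1 <= s <= 1 -> -1 <= - s <= 1.
  by move=> /andP[h1 h2]; apply/andP; split; lra.
have [|||||_] := @right_variation D (fun s x => e (- s) x) (fun x => - q x) mD.
- by move=> s /NI; exact: ei.
- move=> x Dx s s01; have [h1 h2 h3] := ce x Dx s s01.
  by rewrite !opprK oppr0; split => //; rewrite addrC.
- move=> x Dx.
  have H := @is_derive1_comp R (e ^~ x) (fun s => - s) 0 (q x) (-1).
  rewrite -mulrN1; apply: H; first by rewrite oppr0; exact: de.
- exact: measurable_funN.
- by move=> s /NI sI; rewrite oppr0; exact: emin.
rewrite (_ : \int[mu]_(x in D) - q x = \int[mu]_(x in D) (-1 * q x)); last first.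
  by apply: eq_Rintegral => x _; rewrite mulN1r.
rewrite RintegralZl// mulN1r oppr_ge0 => q0'.
by apply/eqP; rewrite eq_le q0 q0'.
Qed.

Lemma norm_inftyP (f : R -> R) (c : R) : f x @[x --> norm_infty R] --> c ->
  exists M, forall x, M < `|x| -> `|f x - c| < 1.
Proof.
move=> /(_ (ball c 1)) H.
have : nbhs c (ball c 1) by exact: nbhsx_ballx.
move=> /H /= [M [_ HM]]; exists (M + 1) => x Mx.
have MM : M < M + 1 by rewrite ltrDl.
by have := HM (M + 1) MM x Mx; rewrite /= /ball/= distrC.
Qed.

Lemma power_growth_bound (f : R -> R) (r c : R) : 0 < r -> continuous f ->
  f x / `|x| `^ r @[x --> norm_infty R] --> c ->
  exists C, forall x, f x <= C * (1 + `|x| `^ r).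
Proof.
move=> r0 cf /norm_inftyP[M HM]; pose N := `|M| + 1.
have N0 : 0 < N by rewrite ltr_wpDl.
have NN : - N <= N by rewrite ge0_cp// ltW.
have [|t _ Ht] := @EVT_max R f (- N) N NN; first exact: continuous_subspaceT.
exists (`|f t| + `|c| + 1).
move=> x; have p0 := powR_ge0 `|x| r.
have [xN|Nx] := leP `|x| N.
  have : f x <= f t by apply: Ht; rewrite in_itv/= -ler_norml.
  have := ler_norm (f t); have := normr_ge0 c; have := normr_ge0 (f t); nra.
have Mx : M < `|x|.
  by rewrite (le_lt_trans _ Nx)// (le_trans (ler_norm M))// lerDl.
have x0 : 0 < `|x| `^ r by apply: powR_gt0; rewrite (lt_trans _ Nx).
have := HM x Mx => /ltr_normlP[_]; rewrite ltrBlDr ltr_pdivrMr//.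
have := ler_norm c; have := normr_ge0 c; have := normr_ge0 (f t); nra.
Qed.

Section growth.
Variables (a b r C : R) (f : R -> R).
Hypothesis r0 : 0 < r.
Hypothesis f0 : forall x, 0 <= f x.
Hypothesis mf : measurable_fun setT f.
Hypothesis fC : forall x, f x <= C * (1 + `|x| `^ r).

Lemma growth_integrable (X : R -> R) : Lr a b r X ->
  mu.-integrable `]a, b[ (EFin \o (fun x => f (X x))).
Proof.
move=> [mX Xi]; apply: (@integrable_le _ _ _ (fun x => C * (cst 1 x + `|X x| `^ r))) => //.
- by apply: measurable_funTS; exact: measurableT_comp.
- apply: integrable_scale => //; apply: integrable_add => //.
  apply: (@integrable_bounded _ a b 1) => //.
    by apply: subset_itv; rewrite bnd_simp.
  by move=> x _; rewrite normr1.
- by move=> x _; rewrite ger0_norm//; exact: fC.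
Qed.

(** As [f] is nonnegative, the supporting line at [X] bounds [f'(X) Y] by [f (X + Y)] and its
    opposite by [f (X - Y)]. *)
Lemma growth_derive_integrable (X Y : R -> R) : tangent_convex setT f ->
  measurable_fun setT f^`()%classic -> Lr a b r X -> Lr a b r Y ->
  mu.-integrable `]a, b[ (EFin \o (fun x => f^`()%classic (X x) * Y x)).
Proof.
move=> cf mf' LX LY.
have LXY := Lr_add r0 LX LY; have LXNY := Lr_add r0 LX (Lr_scale r0 (-1) LY).
have [mX _] := LX; have [mY _] := LY.
apply: (@integrable_le _ _ _ (fun x => f (X x + Y x) + f (X x + -1 * Y x))) => //.
- apply: measurable_funTS; apply: measurable_funM => //; exact: measurableT_comp.
- by apply: integrable_add => //; exact: growth_integrable.
- move=> x _; have h1 := cf (X x) (X x + Y x) I I.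
  have h2 := cf (X x) (X x + -1 * Y x) I I.
  have := f0 (X x); have := f0 (X x + Y x); have := f0 (X x + -1 * Y x).
  move: h1 h2; rewrite ![X x + _ - _]addrAC !subrr !add0r mulN1r mulrN.
  by rewrite ler_norml => *; apply/andP; split; lra.
Qed.

End growth.

End convexity.

(** * Partial derivatives of G and Omega *)

Section partials.
Context {R : realType}.

(** The two difference quotients are the same function of [t], so the derivatives agree whatever
    their convergence. *)
Lemma derive_affine_line n (F : 'rV[R]_n.+1 -> R) (v X : 'rV[R]_n.+1) (k : R -> R) (c C : R) :
  (forall t, F (t *: v + X) = k (t + c) + C) -> 'D_v F X = k^`()%classic c.
Proof.
move=> FE; rewrite derive1E /derive.
suff -> : (fun t : R => t^-1 *: ((F \o shift X) (t *: v) - F X)) =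
    (fun t : R => t^-1 *: ((k \o shift c) (t *: (1 : R)) - k c)) by [].
apply/funext => t /=; have FX : F X = k (0 + c) + C by rewrite -FE scale0r add0r.
rewrite FX add0r.
rewrite FE [t *: 1]mulr1.
by congr (_ *: _); ring.
Qed.

Lemma derive1_scale (f : R -> R) (k c : R) : derivable f (c * k) 1 ->
  (fun u => f (u * k))^`()%classic c = f^`()%classic (c * k) * k.
Proof.
move=> df.
have dk : is_derive c 1 (fun u : R => u * k) k.
  rewrite (_ : (fun u : R => u * k) = (fun u => k * u + 0)); first exact: (is_derive_affine k 0 c).
  by apply/funext => u; rewrite addr0 mulrC.
have [_ E] := @is_derive1_comp R f (fun u => u * k) c _ _ (derivableP df) dk.
by rewrite derive1E E derive1E.
Qed.

Lemma G_partials (phi g h : R -> R) (x : R) (X : 'rV[R]_7) :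
  (forall y, derivable g y 1) -> derivable h (X 0 6 * x `^ (- (2 / 3))) 1 ->
  [/\ partial 0 (Gfun phi g h x) X = phi^`()%classic (X 0 0),
     partial 1 (Gfun phi g h x) X = (psi phi)^`()%classic (X 0 1)
   & partial 2 (Gfun phi g h x) X = (psi phi)^`()%classic (X 0 2)] /\
  [/\ partial 3 (Gfun phi g h x) X =
       g^`()%classic (X 0 3 * x `^ (- (1 / 3))) * x `^ (- (1 / 3)),
     partial 4 (Gfun phi g h x) X =
       g^`()%classic (X 0 4 * x `^ (- (1 / 3))) * x `^ (- (1 / 3)),
     partial 5 (Gfun phi g h x) X =
       g^`()%classic (X 0 5 * x `^ (- (1 / 3))) * x `^ (- (1 / 3))
   & partial 6 (Gfun phi g h x) X =
       h^`()%classic (X 0 6 * x `^ (- (2 / 3))) * x `^ (- (2 / 3))].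
Proof.
move=> dg dh; rewrite -!(derive1_scale (dg _)) -(derive1_scale dh) /partial; split; split.
- apply: (@derive_affine_line _ _ _ _ phi _ (Gfun phi g h x X - phi (X 0 0))) => t.
  by rewrite /Gfun !mxE /= mulr1 !mulr0 !add0r; ring.
- apply: (@derive_affine_line _ _ _ _ (psi phi) _ (Gfun phi g h x X - psi phi (X 0 1))) => t.
  by rewrite /Gfun !mxE /= mulr1 !mulr0 !add0r; ring.
- apply: (@derive_affine_line _ _ _ _ (psi phi) _ (Gfun phi g h x X - psi phi (X 0 2))) => t.
  by rewrite /Gfun !mxE /= mulr1 !mulr0 !add0r; ring.
- apply: (@derive_affine_line _ _ _ _ (fun u => g (u * x `^ (- (1 / 3)))) _
    (Gfun phi g h x X - g (X 0 3 * x `^ (- (1 / 3))))) => t.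
  by rewrite /Gfun !mxE /= mulr1 !mulr0 !add0r; ring.
- apply: (@derive_affine_line _ _ _ _ (fun u => g (u * x `^ (- (1 / 3)))) _
    (Gfun phi g h x X - g (X 0 4 * x `^ (- (1 / 3))))) => t.
  by rewrite /Gfun !mxE /= mulr1 !mulr0 !add0r; ring.
- apply: (@derive_affine_line _ _ _ _ (fun u => g (u * x `^ (- (1 / 3)))) _
    (Gfun phi g h x X - g (X 0 5 * x `^ (- (1 / 3))))) => t.
  by rewrite /Gfun !mxE /= mulr1 !mulr0 !add0r; ring.
- apply: (@derive_affine_line _ _ _ _ (fun u => h (u * x `^ (- (2 / 3)))) _
    (Gfun phi g h x X - h (X 0 6 * x `^ (- (2 / 3))))) => t.
  by rewrite /Gfun !mxE /= mulr1 !mulr0 !add0r; ring.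
Qed.

Lemma derive1_linear (k c : R) : (fun u : R => k * u)^`()%classic c = k.
Proof.
have [_] := @is_derive_affine R k 0 c; rewrite derive1E.
by rewrite (_ : (fun u : R => k * u + 0) = (fun u => k * u))//; apply/funext => u; rewrite addr0.
Qed.

Lemma derive1_cube (c : R) : (fun u : R => u ^+ 3)^`()%classic c = 3 * c ^+ 2.
Proof. by rewrite exp_derive1. Qed.

Lemma partial_linear n (i : 'I_n.+1) (F : 'rV[R]_n.+1 -> R) (V : 'rV[R]_n.+1) (k : R) :
  (forall t, F (t *: delta_mx 0 i + V) = k * (t + V 0 i) + (F V - k * V 0 i)) ->
  partial i F V = k.
Proof. by move=> H; rewrite /partial (derive_affine_line H) derive1_linear. Qed.

Lemma partial_cube n (i : 'I_n.+1) (F : 'rV[R]_n.+1 -> R) (V : 'rV[R]_n.+1) :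
  (forall t, F (t *: delta_mx 0 i + V) = (t + V 0 i) ^+ 3 + (F V - V 0 i ^+ 3)) ->
  partial i F V = 3 * V 0 i ^+ 2.
Proof.
by move=> H; rewrite /partial (derive_affine_line (k := fun u => u ^+ 3) H) derive1_cube.
Qed.

Lemma Omega_partials (x : R) (V : 'rV[R]_3) (i : 'I_7) :
  let r := x `^ (1 / 3) in let r2 := x `^ (2 / 3) in
  [/\ partial 0 (fun V => Omega x V 0 i) V = nth 0
     [:: 1; 0; 0; 0; V 0 2 * r; V 0 1 * r; V 0 1 * V 0 2 * r2] i,
    partial 1 (fun V => Omega x V 0 i) V = nth 0
     [:: 0; 3 * V 0 1 ^+ 2; 0; V 0 2 * r; 0; V 0 0 * r; V 0 0 * V 0 2 * r2] i
  & partial 2 (fun V => Omega x V 0 i) V = nth 0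
     [:: 0; 0; 3 * V 0 2 ^+ 2; V 0 1 * r; V 0 0 * r; 0; V 0 0 * V 0 1 * r2] i].
Proof.
move=> r r2; case: i => -[|[|[|[|[|[|[|//]]]]]]] i7; split; rewrite [RHS]/=;
  ((by apply: partial_linear => t; rewrite !mxE /= ?mulr1 ?mulr0 ?add0r -/r -/r2; ring) ||
   (by apply: partial_cube => t; rewrite !mxE /= ?mulr1 ?mulr0 ?add0r; ring)).
Qed.

(** All fractional powers become integer powers of the cube root, on which [field] can compute. *)
Lemma powR_thirds (x : R) : 0 < x -> let r := x `^ (1 / 3) in
  [/\ 0 < r, x = r ^+ 3, x `^ (2 / 3) = r ^+ 2, x `^ (- (1 / 3)) = r^-1 &
      x `^ (- (2 / 3)) = (r ^+ 2)^-1].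
Proof.
move=> x0 r; have r0 : 0 < r by exact: powR_gt0.
have E2 : x `^ (2 / 3) = r ^+ 2.
  by rewrite -powR_mulrn ?ltW// -powRrM; congr (_ `^ _); field.
split => //; last 2 first.
- by rewrite powRN.
- by rewrite powRN E2.
by rewrite -powR_mulrn ?ltW// -powRrM (_ : 1 / 3 * 3 = 1) ?powRr1 ?ltW//; field.
Qed.

Lemma powR_div_third (y x : R) : 0 < y -> 0 < x ->
  (y / x) `^ (1 / 3) = y `^ (1 / 3) / x `^ (1 / 3).
Proof.
move=> y0 x0; rewrite powRM ?invr_ge0 ?ltW//; congr (_ * _).
by rewrite -powR_inv1 ?ltW// powRAC powR_inv1// powR_ge0.
Qed.

Section formulas.
Variables (phi g h al0 al be ga : R -> R) (x : R).
Hypothesis x0 : 0 < x.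
Hypothesis y0 : 0 < al0 x.
Hypothesis dg : forall y, derivable g y 1.
Hypothesis dh : derivable h (wderiv 0 1 al x) 1.
Let r := x `^ (1 / 3).
Let s := al0 x `^ (1 / 3).
Let T := 3 / 2 * wderiv 0 1 ga x * r.

(** Entries 1 and 2 of [Xi] and of [Gamma0] coincide, as do entries 4 and 5 of [Xi]; this produces
    the factors 2 and 6. Written in [r] and [s], the weights in [G] and [Omega] cancel. *)
Lemma G_formulas :
  G1 phi g h al0 al be ga x =
    phi^`()%classic (be x * r ^+ 2) + 2 * g^`()%classic T * (s / r)
    + h^`()%classic (wderiv 0 1 al x) * (s / r) ^+ 2 /\
  G2 phi g h al0 al be ga x =
    6 * (psi phi)^`()%classic (al x / x) * (s / r) ^+ 2
    + 2 * g^`()%classic (ga x / r ^+ 2) * (s / r)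
    + 2 * g^`()%classic T * wderiv 0 1 al0 x * (r / s) ^+ 2
    + 2 * h^`()%classic (wderiv 0 1 al x) * wderiv 0 1 al0 x * (r / s).
Proof.
have [r0 xr x2 xN1 xN2] := powR_thirds x0.
have [s0 ys _ _ _] := powR_thirds y0.
have E1 : (al0 x / x) `^ (1 / 3) = s / r by exact: powR_div_third.
have E2 : (x / al0 x) `^ (2 / 3) = (r / s) ^+ 2.
  have [_ _ -> _ _] := @powR_thirds (x / al0 x) (divr_gt0 x0 y0).
  by rewrite powR_div_third.
have rn : r != 0 by rewrite gt_eqF.
have sn : s != 0 by rewrite gt_eqF.
pose X := Xi al be ga x.
have X6 : X 0 6 * x `^ (- (2 / 3)) = wderiv 0 1 al x.
  by rewrite mxE /= x2 xN2 mulfK// expf_neq0.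
have X4 : X 0 4 * x `^ (- (1 / 3)) = T.
  by rewrite mxE /= x2 xN1 -/r /T; field.
have X5 : X 0 5 * x `^ (- (1 / 3)) = T.
  by rewrite mxE /= x2 xN1 -/r /T; field.
have X3 : X 0 3 * x `^ (- (1 / 3)) = ga x / r ^+ 2.
  by rewrite mxE /= xN1 -/r; field.
have X0 : X 0 0 = be x * r ^+ 2 by rewrite mxE /= x2.
have X1 : X 0 1 = al x / x by rewrite mxE.
have X2 : X 0 2 = al x / x by rewrite mxE.
have dh' : derivable h (X 0 6 * x `^ (- (2 / 3))) 1 by rewrite X6.
have [[P0 P1 P2] [P3 P4 P5 P6]] := G_partials phi dg dh'.
have V0 : Gamma0 al0 x 0 0 = wderiv 0 1 al0 x * (r / s) ^+ 2 by rewrite mxE /= E2.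
have V1 : Gamma0 al0 x 0 1 = s / r by rewrite mxE /= E1.
have V2 : Gamma0 al0 x 0 2 = s / r by rewrite mxE /= E1.
have I7 (F : 'I_7 -> R) : \sum_(i < 7) F i = F 0 + F 1 + F 2 + F 3 + F 4 + F 5 + F 6.
  rewrite !big_ord_recl big_ord0 addr0 !addrA.
  by do ?[congr (_ + _)]; congr F; apply: val_inj.
have O0 i := let: And3 e _ _ := Omega_partials x (Gamma0 al0 x) i in e.
have O1 i := let: And3 _ e _ := Omega_partials x (Gamma0 al0 x) i in e.
have O2 i := let: And3 _ _ e := Omega_partials x (Gamma0 al0 x) i in e.
split.
  rewrite /G1 I7 !O0 /= V1 V2 P0 P1 P2 P3 P4 P5 P6 X0 X4 X5 X6 xN1 xN2 x2 -/r.
  move: (phi^`()%classic _) (g^`()%classic _) (h^`()%classic _) => *.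
  by field; rewrite rn.
rewrite /G2 I7 !O1 !O2 /= V0 V1 V2 P0 P1 P2 P3 P4 P5 P6 X1 X2 X3 X4 X5 X6 xN1 xN2 x2 -/r.
by field; rewrite rn sn.
Qed.

End formulas.

End partials.

(** * Convex integrands along a line, test directions and representatives *)

Section integrands.
Context {R : realType}.
Notation mu := (@lebesgue_measure R).

Definition convex_growth (r : R) (f : R -> R) : Prop :=
  [/\ forall x, derivable f x 1, continuous f^`()%classic, tangent_convex setT f,
      forall x, 0 <= f x
    & exists C, forall x, f x <= C * (1 + `|x| `^ r)].

Definition convex_positive (h : R -> R) : Prop :=
  [/\ forall x, 0 < x -> derivable h x 1,
      forall x, 0 < x -> {for x, continuous h^`()%classic},
      tangent_convex [set x | 0 < x] h
    & forall x, 0 < x -> 0 <= h x].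

Lemma derivable_continuous (f : R -> R) x : derivable f x 1 -> {for x, continuous f}.
Proof. by move=> df; apply/differentiable_continuous/derivable1_diffP. Qed.

Lemma C2_convex_growth (r c : R) (f : R -> R) : 0 < r -> C2_on setT f ->
  (forall x, 0 <= f x) -> (forall x, 0 <= f^`(2)%classic x) ->
  f x / `|x| `^ r @[x --> norm_infty R] --> c -> convex_growth r f.
Proof.
move=> r0 C2 f0 f2 fc; split => //.
- by move=> x; have [df _ _] := C2 x I.
- by move=> x; have [_ df' _] := C2 x I; exact: (derivable_continuous df').
- by apply: derive2_tangent_convex => // x _; have [df df' _] := C2 x I.
- apply: power_growth_bound fc => // x.
  by have [df _ _] := C2 x I; exact: (derivable_continuous df).
Qed.

Lemma C2_convex_positive (h : R -> R) : C2_on `]0, +oo[ h ->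
  (forall x, 0 < x -> 0 <= h x /\ 0 < h^`(2)%classic x) -> convex_positive h.
Proof.
move=> C2 hpos; have {}C2 x : 0 < x -> derivable h x 1 /\ derivable h^`()%classic x 1.
  by move=> x0; have [] := C2 x; rewrite /= ?in_itv/= ?andbT.
split.
- by move=> x /C2[].
- by move=> x /C2[_ dh]; exact: (derivable_continuous dh).
- apply: derive2_tangent_convex => /=.
  + by move=> x y z x0 _ /andP[xz _]; exact: lt_le_trans xz.
  + by move=> x /C2[].
  + by move=> x /C2[].
  + by move=> x /hpos[_ /ltW].
- by move=> x /hpos[].
Qed.

Lemma is_derive_line (f : R -> R) (x y : R) : derivable f x 1 ->
  is_derive (0 : R) 1 (fun s => f (x + s * y)) (f^`()%classic x * y).
Proof.
move=> df; have dl : is_derive (0 : R) 1 (fun s => x + s * y) y.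
  rewrite (_ : (fun s : R => x + s * y) = (fun s => y * s + x)); first exact: is_derive_affine.
  by apply/funext => s; ring.
apply: (@is_derive1_comp R f (fun s => x + s * y)).
by rewrite mul0r addr0 derive1E; exact: derivableP.
Qed.

Section convex_growth_theory.
Variables (r : R) (f : R -> R).
Hypothesis r0 : 0 < r.
Hypothesis Hf : convex_growth r f.

Lemma convex_growth_measurable : measurable_fun setT f.
Proof.
case: Hf => df _ _ _ _; apply: continuous_measurable_fun => x.
exact: derivable_continuous.
Qed.

Lemma convex_growth_measurable' : measurable_fun setT f^`()%classic.
Proof. by case: Hf => _ cf' _ _ _; exact: continuous_measurable_fun. Qed.

Lemma convex_growth_integrable a b (X : R -> R) : Lr a b r X ->
  mu.-integrable `]a, b[ (EFin \o (fun x => f (X x))).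
Proof.
have [_ _ _ f0 [C fC]] := Hf.
by move=> LX; apply: (growth_integrable f0 _ fC) => //; exact: convex_growth_measurable.
Qed.

Lemma convex_growth_integrable' a b (X Y : R -> R) : Lr a b r X -> Lr a b r Y ->
  mu.-integrable `]a, b[ (EFin \o (fun x => f^`()%classic (X x) * Y x)).
Proof.
have [_ _ cf f0 [C fC]] := Hf.
move=> LX LY; apply: (growth_derive_integrable r0 f0 _ fC) => //.
  exact: convex_growth_measurable.
exact: convex_growth_measurable'.
Qed.

Lemma convex_growth_centre (x y : R) : centre_convex (fun s => f (x + s * y)).
Proof. by case: Hf => _ _ cf _ _; apply: tangent_convex_centre cf _. Qed.

Lemma convex_growth_line (x y : R) :
  is_derive (0 : R) 1 (fun s => f (x + s * y)) (f^`()%classic x * y).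
Proof. by case: Hf => df _ _ _ _; exact: is_derive_line. Qed.

End convex_growth_theory.

Section convex_positive_theory.
Variable h : R -> R.
Hypothesis Hh : convex_positive h.

Lemma positive_continuous_comp_measurable (k X : R -> R) :
  (forall x, 0 < x -> {for x, continuous k}) -> measurable_fun setT X ->
  (forall x, 0 < X x) -> measurable_fun setT (fun x => k (X x)).
Proof.
move=> ck mX X0; apply: (@measurable_comp _ _ _ R R R `]0, +oo[%classic k setT X) => //.
  by move=> _ [x _ <-]; rewrite /= in_itv/= X0.
apply: open_continuous_measurable_fun; first exact: rray_open.
by move=> x; rewrite inE/= in_itv/= andbT; exact: ck.
Qed.

Lemma convex_positive_measurable (X : R -> R) : measurable_fun setT X ->
  (forall x, 0 < X x) -> measurable_fun setT (fun x => h (X x)).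
Proof.
apply: positive_continuous_comp_measurable => x x0.
by case: Hh => dh _ _ _; apply: derivable_continuous; exact: dh.
Qed.

Lemma convex_positive_measurable' (X : R -> R) : measurable_fun setT X ->
  (forall x, 0 < X x) -> measurable_fun setT (fun x => h^`()%classic (X x)).
Proof. by apply: positive_continuous_comp_measurable; case: Hh. Qed.

Lemma convex_positive_bounded (u w : R) : 0 < u -> exists2 M, 0 <= M &
  forall x, u <= x <= w -> h x <= M.
Proof.
move=> u0; have [uw|wu] := leP u w; last first.
  by exists 0 => // x /andP[ux xw]; exfalso; lra.
have [|t tuw Ht] := @EVT_max R h u w uw.
  apply: continuous_in_subspaceT => x; rewrite inE/= in_itv/= => /andP[ux _].
  by case: Hh => dh _ _ _; apply: derivable_continuous; apply: dh; exact: lt_le_trans ux.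
exists `|h t| => // x xuw; rewrite (le_trans (Ht x _)) ?in_itv//.
exact: ler_norm.
Qed.

Lemma convex_positive_centre (x y : R) : `|y| < x -> centre_convex (fun s => h (x + s * y)).
Proof.
move=> yx; case: Hh => _ _ ch _; apply: tangent_convex_centre ch _ => s /andP[s1 s2] /=.
have : `|s * y| <= `|y|.
  by rewrite normrM ler_piMl// ler_norml s1.
move=> h1; have /ltr_normlP[h2 _] : `|s * y| < x by exact: le_lt_trans yx.
by lra.
Qed.

End convex_positive_theory.

Section test_pair.
Variables (d K : R) (theta : R -> R).
Hypothesis mtheta : measurable_fun setT theta.
Hypothesis thetaK : forall x, `|theta x| <= K.
Hypothesis theta0 : forall x, ~~ (d < x < 1 - d) -> theta x = 0.
Hypothesis theta_mean : \int[mu]_(x in `]0, 1[) theta x = 0.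

(** The primitive is normalised at [1]; the zero mean of [theta] makes it vanish to the left of [d]
    as well. As the interval has length 1, the bound [K] on [theta] also serves for [eta]. *)
Lemma test_primitive : exists eta, [/\ ac 0 1 eta theta, measurable_fun setT eta,
  forall x, `|eta x| <= K & forall x, ~~ (d < x < 1 - d) -> eta x = 0].
Proof.
have K0 : 0 <= K by rewrite (le_trans (normr_ge0 _) (thetaK 0)).
have thi (x : R) : 0 <= x -> mu.-integrable `]x, 1[ (EFin \o theta).
  move=> x0; apply: (@integrable_bounded _ x 1 K) => //.
    by apply: subset_itv; rewrite bnd_simp.
  exact: measurable_funTS.
have acT : ac 0 1 (fun x => - \int[mu]_(t in `]x, 1[) theta t) theta.
  by apply: ac_tail => // x /andP[/ltW x0 _]; exact: thi.
have m01 : measurable (`]0, 1[%classic : set R) by exact: measurable_itv.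
pose eta := (fun x => - \int[mu]_(t in `]x, 1[) theta t) \_ `]0, 1[.
have etaE x : 0 < x < 1 -> eta x = - \int[mu]_(t in `]x, 1[) theta t.
  by move=> x01; rewrite /eta patchE mem_set//= in_itv.
exists eta; split.
- by apply: ac_ext acT _ mtheta (aeW _ (fun _ _ => erefl)) => x x01; rewrite etaE.
- by apply: (measurable_restrictT _ m01).1; exact: ac_measurable acT.
- move=> x; rewrite /eta patchE; case: ifPn => [/set_mem/=|_]; last by rewrite normr0.
  rewrite in_itv/= => /andP[x0 x1]; rewrite normrN.
  rewrite (le_trans (le_normr_Rintegral _ (thi x (ltW x0))))//.
  apply: (@le_trans _ _ (\int[mu]_(t in `]x, 1[) cst K t)).
    apply: le_Rintegral => //; first by apply: integrable_norm; exact: thi (ltW x0).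
    apply: (@integrable_bounded _ x 1 K) => //.
      by apply: subset_itv; rewrite bnd_simp.
    by move=> t _ /=; rewrite ger0_norm.
  rewrite Rintegral_cst//= lebesgue_measure_itv/= lte_fin x1 /=.
  by rewrite ler_piMr// lerBlDr lerDl ltW.
- move=> x; rewrite negb_and -!leNgt => h.
  rewrite /eta patchE; case: ifPn => // /set_mem/=; rewrite in_itv/= => /andP[x0 x1].
  case/orP: h => h.
    rewrite -[RHS]oppr0 -theta_mean; congr (- _); apply/esym.
    apply: Rintegral_support => t /=; rewrite !in_itv/=.
      by move=> /andP[xt ->]; rewrite (lt_trans x0).
    move=> /andP[t0 t1] /negP; rewrite t1 andbT -leNgt => tx.
    by apply: theta0; rewrite negb_and -leNgt (le_trans tx).
  rewrite (@Rintegral_support _ _ set0) ?Rintegral_set0 ?oppr0// => t /=.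
  rewrite in_itv/= => /andP[xt _] _; apply: theta0.
  by rewrite negb_and -!leNgt (le_trans h) ?orbT// ltW.
Qed.

End test_pair.

Lemma ac_inv (a b : R) (F f : R -> R) : ac a b F f -> measurable_fun setT F ->
  (forall x, a < x < b -> 0 < F x) ->
  ac a b (fun x => (F x)^-1) (fun x => - (F x)^-2 * f x).
Proof.
move=> acF mF F0; apply: (@ac_comp _ _ _ F f (fun z => z^-1) (fun z => - z^-2)) => //.
- move=> x /F0 Fx.
  have := @is_deriveV R id (F x) 1 1 (lt0r_neq0 Fx) (is_derive_id _ _).
  by rewrite /GRing.scale/= mulr1.
- move=> x /F0 Fx; apply: continuousN.
  rewrite (_ : (fun z : R => z^-2) = (fun z => z^-1 * z^-1)); last first.
    by apply/funext => z; rewrite -invfM expr2.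
  by apply: continuousM; apply: inv_continuous; rewrite gt_eqF.
- apply: measurable_funM; last by case: acF.
  by apply: measurableT_comp => //; apply: measurable_funV; exact: measurable_funX.
Qed.

Lemma ac_cuberoot (a b : R) (F f : R -> R) : ac a b F f -> measurable_fun setT F ->
  (forall x, a < x < b -> 0 < F x) ->
  ac a b (fun x => F x `^ (1 / 3)) (fun x => (3 * (F x `^ (1 / 3)) ^+ 2)^-1 * f x).
Proof.
move=> acF mF F0.
apply: (@ac_comp _ _ _ F f (fun z => z `^ (1 / 3)) (fun z => (3 * (z `^ (1 / 3)) ^+ 2)^-1)) => //.
- move=> x /F0 Fx.
  have FI : (F x \in `]0, +oo[)%R by rewrite in_itv/= Fx.
  have [r0 _ _ _ E] := powR_thirds Fx.
  apply: DeriveDef; first exact: derivable_powR.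
  rewrite -derive1E powR_derive1// (_ : 1 / 3 - 1 = - (2 / 3)); last by field.
  by rewrite E; field; rewrite gt_eqF.
- move=> x /F0 Fx; have FI : (F x \in `]0, +oo[)%R by rewrite in_itv/= Fx.
  have cp : {for F x, continuous (fun z : R => z `^ (1 / 3))}.
    by apply: derivable_continuous; exact: derivable_powR.
  rewrite (_ : (fun z : R => _) = (fun z => (3 * (z `^ (1 / 3) * z `^ (1 / 3)))^-1)); last first.
    by apply/funext => z; rewrite expr2.
  apply: continuousV.
    by rewrite mulf_neq0// mulf_neq0// gt_eqF// powR_gt0.
  by apply: continuousM; [exact: cst_continuous|exact: continuousM].
- apply: measurable_funM; last by case: acF.
  apply: measurable_funV; apply: measurable_funM => //; apply: measurable_funX.
  exact: measurable_fun_powR.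
Qed.

Lemma in_Lp_Lr (a b r : R) (f g : R -> R) : 0 < r -> in_Lp a b r f ->
  measurable_fun setT g -> ae_on a b (fun x => f x = g x) -> Lr a b r g.
Proof.
move=> r0 /(in_LpP _ _ _ r0).1[k Lk fk] mg fg; apply: Lr_ae_eq Lk mg _.
by apply: aeS2 fk fg => x h1 h2 xab; rewrite -h1// h2.
Qed.

Lemma Lr_in_Lp (a b r : R) (f g : R -> R) : 0 < r -> Lr a b r g ->
  ae_on a b (fun x => f x = g x) -> in_Lp a b r f.
Proof. by move=> r0 Lg fg; apply/in_LpP => //; exists g. Qed.

(** Positivity at every point lets [h], meaningful only on the positive half-line, be evaluated and
    shown measurable without exceptional sets. *)
Lemma positive_version (f : R -> R) (a b : R) : measurable_fun setT f ->
  ae_on a b (fun x => 0 < f x) -> exists f' : R -> R, [/\ measurable_fun setT f',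
    forall x, 0 < f' x & ae_on a b (fun x => f x = f' x)].
Proof.
move=> mf f0; exists (fun x => if 0 < f x then f x else 1); split.
- apply: measurable_fun_ifT => //.
  by apply: measurable_fun_ltr.
- by move=> x; case: ifPn.
- by apply: aeS f0 => x f0 xab; rewrite f0.
Qed.

End integrands.

(** * The Euler-Lagrange equation *)

Section constancy.
Context {R : realType}.
Notation mu := (@lebesgue_measure R).

(** Take for [m] the mean of [W] on [T k], which is at most [k] in absolute value. The integral of
    [(W - m)^2] is that of [W (W - m)] minus [m] times that of [W - m]; both vanish, so [W = m]
    almost everywhere on [T k]. The sets being nested, the constants agree. *)
Lemma ae_const_of_orthogonal (W : R -> R) (T : (set R)^nat) :
  measurable_fun setT W -> (forall k, measurable (T k)) ->
  (forall k, T k `<=` `]0, 1[) -> (forall j k, (j <= k)%N -> T j `<=` T k) ->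
  (forall x, 0 < x < 1 -> exists k, T k x) ->
  (forall k x, T k x -> `|W x| <= k%:R) ->
  (forall k m, `|m| <= k%:R -> \int[mu]_(x in T k) (W x - m) = 0 ->
     \int[mu]_(x in T k) (W x * (W x - m)) = 0) ->
  exists m, ae_on 0 1 (fun x => W x = m).
Proof.
move=> mW mT T01 Tmono Tcov TW orth.
have mT' k : @measurable _ (measurableTypeR R) (T k) by exact: mT.
have Tsub k : T k `<=` `[0, 1].
  by apply: (subset_trans (T01 k)); apply: subset_itv; rewrite bnd_simp.
have bi (f : R -> R) k M : measurable_fun setT f -> (forall x, T k x -> `|f x| <= M) ->
    mu.-integrable (T k) (EFin \o f).
  move=> mf fM; apply: (@integrable_bounded _ 0 1 M) => //; exact: measurable_funTS.
have Tfin k : (mu (T k) < +oo)%E.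
  rewrite (le_lt_trans (le_measure mu _ _ (Tsub k))) ?inE//.
  by rewrite /= lebesgue_measure_itv/= lte_fin ltr01 oppr0 adde0 ltry.
have ci k (c : R) : mu.-integrable (T k) (EFin \o cst c) by apply: (bi _ _ `|c|).
have Wi k : mu.-integrable (T k) (EFin \o W) by apply: (bi W k k%:R) => // x; exact: TW.
have step k : (0 < mu (T k))%E ->
    exists m, {ae mu, forall x, T k x -> W x = m}.
  move=> Tk0; pose V := fine (mu (T k)).
  have V0 : 0 < V by apply: fine_gt0; rewrite Tk0 Tfin.
  pose m := V^-1 * \int[mu]_(x in T k) W x.
  have mk : `|m| <= k%:R.
    rewrite /m normrM gtr0_norm ?invr_gt0// ler_pdivrMl//.
    rewrite (le_trans (le_normr_Rintegral (mT' k) (Wi k)))//.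
    apply: (@le_trans _ _ (\int[mu]_(x in T k) cst k%:R x)).
      by apply: le_Rintegral => //; [exact: integrable_norm|move=> x; exact: TW].
    by rewrite Rintegral_cst// mulrC.
  have I0 : \int[mu]_(x in T k) (W x - m) = 0.
    rewrite RintegralB//; last exact: (ci k m).
    by rewrite (Rintegral_cst mu (mT' k)) -/V /m mulrAC mulVf ?mul1r ?subrr// gt_eqF.
  have mWm : measurable_fun setT (fun x => W x - m) by exact: measurable_funB.
  have Wmi : mu.-integrable (T k) (EFin \o (fun x => W x - m)) by apply: integrable_sub => //; exact: (ci k m).
  have sq0 : \int[mu]_(x in T k) ((W x - m) ^+ 2) = 0.
    have := orth k m mk I0.
    rewrite (_ : \int[mu]_(x in T k) ((W x - m) ^+ 2) =
       \int[mu]_(x in T k) (W x * (W x - m) - m * (W x - m))).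
      rewrite RintegralB//; last exact: integrable_scale.
        by rewrite RintegralZl// I0 mulr0 subr0.
      apply: (bi _ _ (k%:R * (k%:R + k%:R))); first exact: measurable_funM.
      move=> x Tx; rewrite normrM ler_pM//; first exact: TW.
      by rewrite (le_trans (ler_normB _ _))// lerD//; exact: TW.
    by apply: eq_Rintegral => x _; ring.
  exists m.
  have sqi : mu.-integrable (T k) (EFin \o (fun x => (W x - m) ^+ 2)).
    apply: (bi _ _ ((k%:R + k%:R) ^+ 2)); first exact: measurable_funX.
    move=> x Tx; rewrite normrX lerXn2r ?nnegrE ?addr_ge0//.
    by rewrite (le_trans (ler_normB _ _))// lerD//; exact: TW.
  have : (\int[mu]_(x in T k) `|((W x - m) ^+ 2)%:E| = 0)%E.
    transitivity (\int[mu]_(x in T k) ((W x - m) ^+ 2)%:E)%E.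
      by apply: eq_integral => x _ /=; rewrite ger0_norm ?sqr_ge0.
    rewrite -[LHS]fineK; last exact: (integrable_fin_num _ sqi).
    by congr EFin.
  move/ae_eq_integral_abs => H.
  have {H} : ae_eq mu (T k) (EFin \o (fun x => (W x - m) ^+ 2)) (cst 0%E).
    by apply: H => //; case/integrableP: sqi.
  apply: aeS => x H /H [/eqP]; rewrite sqrf_eq0 subr_eq0 => /eqP //.
(* The sets cover []0, 1[], so they cannot all be null. *)
have [k0 Tk0] : exists k0, (0 < mu (T k0))%E.
  apply: contrapT => H.
  have T0 k : mu (T k) = 0.
    by apply/eqP; rewrite -measure_le0 leNgt; apply/negP => Tk; apply: H; exists k.
  have : ae_on 0 1 (fun x : R => False).
    apply: (@negligibleS _ _ _ mu (\bigcup_k T k)).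
      by move=> x /= /not_implyP[/[!inE]/= /[!in_itv]/= x01 _]; have [k Tk] := Tcov x x01; exists k.
    apply: negligible_bigcup => k; exists (T k); split => //; exact: T0.
  by move=> /(ae_on_exists ltr01)[].
have [m Wm] := step k0 Tk0; exists m.
have all k : {ae mu, forall x, T k x -> W x = m}.
  have [kk0|/ltnW k0k] := leqP k k0.
    by apply: aeS Wm => x Wm Tx; apply: Wm; exact: Tmono kk0 _ Tx.
  have Tk : (0 < mu (T k))%E.
    by apply: lt_le_trans Tk0 _; apply: le_measure; rewrite ?inE//; exact: Tmono.
  have [m' Wm'] := step k Tk.
  (* Both constants are almost everywhere the value of [W] on [T k0], which has positive measure. *)
  suff <- : m' = m by [].
  apply: contrapT => mm'.
  have : mu.-negligible (T k0).
    have : {ae mu, forall x, ~ T k0 x}.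
      apply: aeS2 Wm Wm' => x h1 h2 Tx; apply: mm'.
      by rewrite -(h1 Tx) -(h2 (Tmono _ _ k0k _ Tx)).
    by apply: negligibleS => x Tx /= nTx; exact: nTx.
  move=> /negligibleP => /(_ (mT k0)) T0.
  by move: Tk0; rewrite T0 ltxx.
have : {ae mu, forall x, forall k, T k x -> W x = m} by exact/ae_foralln.
apply: aeS => x H; rewrite inE/= in_itv/= => /Tcov[k Tk]; exact: H Tk.
Qed.

End constancy.

Section euler_lagrange.
Context {R : realType}.
Notation mu := (@lebesgue_measure R).
Variables (p q tau : R) (phi P g h : R -> R).
Variables (b a a1 c c1 U a0 a01 : R -> R).
Hypothesis p1 : 1 < p.
Hypothesis q1 : 1 < q.
Hypothesis tau0 : 0 < tau.
Hypothesis Hphi : convex_growth (3 * p) phi.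
Hypothesis HP : convex_growth p P.
Hypothesis Hg : convex_growth q g.
Hypothesis Hh : convex_positive h.
Hypothesis ma0 : measurable_fun setT a0.
Hypothesis aca0 : ac 0 1 a0 a01.
Hypothesis a0_gt0 : forall x : R, 0 < x < 1 -> 0 < a0 x.
Hypothesis a0_mono : forall x y : R, 0 < x -> x <= y -> y < 1 -> a0 x <= a0 y.
Hypothesis La01p : forall d : R, 0 < d < 1 -> Lr d 1 (3 * p) a01.
Hypothesis La01q : forall d : R, 0 < d < 1 -> Lr d 1 q a01.
Hypothesis ma1 : measurable_fun setT a1.
Hypothesis a1_gt0 : forall x, 0 < a1 x.

Let r (x : R) := x `^ (1 / 3).
Let ri (x : R) := (r x)^-1.
Let s (x : R) := a0 x `^ (1 / 3).
Let si (x : R) := (s x)^-1.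
Let X1 (x : R) := b x * r x ^+ 2.
Let X2 (x : R) := a x / x.
Let X3 (x : R) := c x * ri x ^+ 2.
Let X4 (x : R) := 3 / 2 * c1 x * r x.

Hypothesis LX1 : Lr 0 1 (3 * p) X1.
Hypothesis LX2 : Lr 0 1 p X2.
Hypothesis LX3 : Lr 0 1 q X3.
Hypothesis LX4 : Lr 0 1 q X4.
Hypothesis LU : Lr 0 1 2 U.
Hypothesis hi : mu.-integrable `]0, 1[ (EFin \o (fun x => h (a1 x))).

Let p3 : 0 < 3 * p. Proof. by rewrite mulr_gt0// (lt_trans _ p1). Qed.
Let p0 : 0 < p. Proof. by rewrite (lt_trans _ p1). Qed.
Let q0 : 0 < q. Proof. by rewrite (lt_trans _ q1). Qed.

(** The weights degenerate at [0] only. The bound on [[d, 1)] reaches up to [1], because the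
    primitives are integrals over []x, 1[]. *)
Definition locally_bounded_coef (m : R -> R) : Prop := measurable_fun setT m /\
  forall d : R, 0 < d < 1 -> exists M : R, forall x : R, d <= x < 1 -> `|m x| <= M.

Lemma coefM m1 m2 : locally_bounded_coef m1 -> locally_bounded_coef m2 ->
  locally_bounded_coef (fun x => m1 x * m2 x).
Proof.
move=> [mm1 B1] [mm2 B2]; split; first exact: measurable_funM.
move=> d d01; have [M1 H1] := B1 d d01; have [M2 H2] := B2 d d01.
by exists (M1 * M2) => x xd; rewrite normrM ler_pM//; [exact: H1|exact: H2].
Qed.

Lemma coef_cst (k : R) : locally_bounded_coef (cst k).
Proof. by split => // d _; exists `|k|. Qed.

Lemma coefX (m : R -> R) n : locally_bounded_coef m -> locally_bounded_coef (fun x => m x ^+ n).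
Proof.
move=> Hm; elim: n => [|n IH].
  rewrite (_ : (fun x => _) = cst 1); first exact: coef_cst.
  by apply/funext => x; rewrite expr0.
rewrite (_ : (fun x => _) = fun x => m x * m x ^+ n); first exact: coefM.
by apply/funext => x; rewrite exprS.
Qed.

Lemma coef_bounded (m : R -> R) (K : R) : measurable_fun setT m -> (forall x, `|m x| <= K) ->
  locally_bounded_coef m.
Proof. by move=> mm mK; split => // d _; exists K => x _; exact: mK. Qed.

Let r_gt0 (x : R) : 0 < x -> 0 < r x. Proof. exact: powR_gt0. Qed.
Let s_gt0 (x : R) : 0 < x < 1 -> 0 < s x.
Proof. by move=> x01; apply: powR_gt0; exact: a0_gt0. Qed.
Let third0 : 0 <= 1 / 3 :> R. Proof. by rewrite divr_ge0. Qed.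
Let mr : measurable_fun setT r. Proof. exact: measurable_fun_powR. Qed.
Let ms : measurable_fun setT s. Proof. exact: measurable_fun_powR. Qed.

Lemma coef_r : locally_bounded_coef r.
Proof.
split => // d /andP[d0 d1]; exists 1 => x /andP[dx x1].
have x0 := lt_le_trans d0 dx.
have e1 : (1 : R) `^ (1 / 3) = 1 by rewrite powR1.
rewrite gtr0_norm ?r_gt0// /r -[leRHS]e1.
by apply: ge0_ler_powR; rewrite ?nnegrE ?(ltW x0) ?(ltW x1).
Qed.

Lemma coef_ri : locally_bounded_coef ri.
Proof.
split => [|d /andP[d0 d1]]; first exact: measurable_funV.
exists (ri d) => x /andP[dx x1]; have x0 := lt_le_trans d0 dx.
rewrite gtr0_norm ?invr_gt0 ?r_gt0// lef_pV2 ?posrE ?r_gt0//.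
by apply: ge0_ler_powR; rewrite ?nnegrE ?(ltW x0) ?(ltW d0).
Qed.

(** Since [a0] is nondecreasing and positive, [si] is largest at the left end [d]. *)
Lemma coef_si : locally_bounded_coef si.
Proof.
split => [|d /andP[d0 d1]]; first exact: measurable_funV.
exists (si d) => x /andP[dx x1]; have x0 := lt_le_trans d0 dx.
have xI : 0 < x < 1 by rewrite x0.
have dI : 0 < d < 1 by rewrite d0.
rewrite gtr0_norm ?invr_gt0 ?s_gt0// lef_pV2 ?posrE ?s_gt0//.
apply: ge0_ler_powR; rewrite ?nnegrE ?(ltW (a0_gt0 _))//.
exact: a0_mono.
Qed.

Lemma coef_inv : locally_bounded_coef (fun x => x^-1).
Proof.
split => [|d /andP[d0 d1]]; first exact: measurable_inv.
exists d^-1 => x /andP[dx x1]; have x0 := lt_le_trans d0 dx.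
by rewrite gtr0_norm ?invr_gt0// lef_pV2 ?posrE.
Qed.

Lemma Lr_coef (t d : R) f m : 0 < t -> 0 < d < 1 -> Lr d 1 t f -> locally_bounded_coef m ->
  Lr d 1 t (fun x => f x * m x).
Proof.
move=> t0 d01 Lf [mm Hm]; have [M HM] := Hm d d01.
by apply: (Lr_mul t0 Lf mm) => x /andP[/ltW dx x1]; apply: HM; rewrite dx.
Qed.

Lemma coef_Lr (t d : R) m : 0 < t -> 0 < d < 1 -> locally_bounded_coef m -> Lr d 1 t m.
Proof.
move=> t0 d01 [mm Hm]; have [M HM] := Hm d d01.
by apply: (Lr_bounded t0 mm) => x /andP[/ltW dx x1]; apply: HM; rewrite dx.
Qed.

(* The coefficients of theta and eta in the first variation. *)
Definition EL_A (x : R) : R := 3 * tau * phi^`()%classic (X1 x) * r x ^+ 2 * si x ^+ 2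
  + 6 * tau * g^`()%classic (X4 x) * r x * si x + 3 * tau * h^`()%classic (a1 x).

(** The two terms with a minus sign are those containing [a01]: they come from differentiating the
    weights [si ^+ 2] and [si] in the directions of [beta] and of [gamma']. *)
Definition EL_B (x : R) : R :=
  U x * si x ^+ 2
  + (-2 * tau) * (phi^`()%classic (X1 x) * (a01 x * (r x ^+ 2 * si x ^+ 5)))
  + (6 * tau) * (P^`()%classic (X2 x) * x^-1)
  + (2 * tau) * (g^`()%classic (X3 x) * (si x * ri x ^+ 2))
  + (-2 * tau) * (g^`()%classic (X4 x) * (a01 x * (r x * si x ^+ 4))).

Let mphi' := convex_growth_measurable' Hphi.
Let mP' := convex_growth_measurable' HP.
Let mg' := convex_growth_measurable' Hg.
Let ma01 : measurable_fun setT a01. Proof. by case: aca0. Qed.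
Let mX1 : measurable_fun setT X1. Proof. by case: LX1. Qed.
Let mX2 : measurable_fun setT X2. Proof. by case: LX2. Qed.
Let mX3 : measurable_fun setT X3. Proof. by case: LX3. Qed.
Let mX4 : measurable_fun setT X4. Proof. by case: LX4. Qed.
Let mU : measurable_fun setT U. Proof. by case: LU. Qed.
Let msi : measurable_fun setT si. Proof. by case: coef_si. Qed.
Let mri : measurable_fun setT ri. Proof. by case: coef_ri. Qed.

Lemma measurable_EL_A : measurable_fun setT EL_A.
Proof.
apply: measurable_funD; first apply: measurable_funD.
- apply: measurable_funM; last exact: measurable_funX.
  apply: measurable_funM; last exact: measurable_funX.
  by apply: measurable_funM => //; exact: measurableT_comp.
- apply: measurable_funM => //; apply: measurable_funM => //.
  by apply: measurable_funM => //; exact: measurableT_comp.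
- by apply: measurable_funM => //; exact: convex_positive_measurable'.
Qed.

Lemma measurable_EL_B : measurable_fun setT EL_B.
Proof.
rewrite /EL_B; do 4?[apply: measurable_funD]; try apply: measurable_funM => //.
- exact: measurable_funX.
- apply: measurable_funM; first exact: measurableT_comp.
  apply: measurable_funM => //; apply: measurable_funM; exact: measurable_funX.
- apply: measurable_funM; first exact: measurableT_comp.
  exact: measurable_inv.
- apply: measurable_funM; first exact: measurableT_comp.
  apply: measurable_funM => //; exact: measurable_funX.
- apply: measurable_funM; first exact: measurableT_comp.
  apply: measurable_funM => //; apply: measurable_funM => //; exact: measurable_funX.
Qed.

Let sub01 (t d : R) f : 0 < d -> Lr 0 1 t f -> Lr d 1 t f.
Proof. by move=> d0; apply: Lr_sub => //; exact: ltW. Qed.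

(** Here the assumption on [alpha_0'] enters: [a01] is paired with [phi'(X1)] in the exponent [3 p]
    and with [g'(X4)] in the exponent [q], and [convex_growth_integrable'] makes each product
    integrable. *)
Lemma EL_B_integrable (d : R) : 0 < d < 1 -> mu.-integrable `]d, 1[ (EFin \o EL_B).
Proof.
move=> d01; have d0 : 0 < d by case/andP: d01.
have cr := coef_r; have cri := coef_ri; have csi := coef_si.
have m01 : measurable (`]d, 1[%classic : set R) by exact: measurable_itv.
have two1 : 1 <= 2 :> R by rewrite ler1n.
have two0 : 0 < 2 :> R by [].
have i1 : mu.-integrable `]d, 1[ (EFin \o (fun x => U x * si x ^+ 2)).
  exact: (Lr_integrable two1 (Lr_coef two0 d01 (sub01 d0 LU) (coefX 2 csi))).
have i2 := convex_growth_integrable' p3 Hphi (sub01 d0 LX1)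
  (Lr_coef p3 d01 (La01p d01) (coefM (coefX 2 cr) (coefX 5 csi))).
have i3 := convex_growth_integrable' p0 HP (sub01 d0 LX2) (coef_Lr p0 d01 coef_inv).
have i4 := convex_growth_integrable' q0 Hg (sub01 d0 LX3)
  (coef_Lr q0 d01 (coefM csi (coefX 2 cri))).
have i5 := convex_growth_integrable' q0 Hg (sub01 d0 LX4)
  (Lr_coef q0 d01 (La01q d01) (coefM cr (coefX 4 csi))).
apply: (integrable_add m01); last exact: (integrable_scale _ m01 i5).
apply: (integrable_add m01); last exact: (integrable_scale _ m01 i4).
apply: (integrable_add m01); last exact: (integrable_scale _ m01 i3).
by apply: (integrable_add m01); last exact: (integrable_scale _ m01 i2).
Qed.

(* Since theta is the derivative of eta, zeta1 and kappa1 are the derivatives of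
   eta / a0^(2/3) and eta / a0^(1/3). *)
Definition zeta1 (theta eta : R -> R) (x : R) :=
  theta x * si x ^+ 2 + a01 x * (- (2 / 3) * eta x * si x ^+ 5).
Definition kappa1 (theta eta : R -> R) (x : R) :=
  theta x * si x + a01 x * (- (1 / 3) * eta x * si x ^+ 4).
Let Y1 theta eta (x : R) := 3 * tau * zeta1 theta eta x * r x ^+ 2.
Let Y2 (eta : R -> R) (x : R) := 3 * tau * eta x / x.
Let Y3 (eta : R -> R) (x : R) := 2 * tau * eta x * si x * ri x ^+ 2.
Let Y4 theta eta (x : R) := 3 * tau * kappa1 theta eta x * r x.
Let Y5 (theta : R -> R) x := 3 * tau * theta x.
Let Z (eta : R -> R) x := eta x * si x ^+ 2.

(** Each integrand is evaluated along a line, which is why the energy is convex in [t]. The factor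
    [3 tau] in [Y4] is the [3 / 2] of the energy times the [2 tau] of the constraint on [gamma]. *)
Definition perturbed_energy (theta eta : R -> R) (t x : R) : R :=
  1 / 2 * (U x + t * Z eta x) ^+ 2 + phi (X1 x + t * Y1 theta eta x)
  + 2 * P (X2 x + t * Y2 eta x) + g (X3 x + t * Y3 eta x)
  + 2 * g (X4 x + t * Y4 theta eta x) + h (a1 x + t * Y5 theta x).

(* The bound on theta keeps a1 + 3 tau t theta positive when |t| <= 1. *)
Definition test_pair (d K : R) (theta eta : R -> R) : Prop :=
  [/\ 0 < d < 1 / 2, ac 0 1 eta theta, measurable_fun setT eta,
      forall x, `|theta x| <= K /\ `|eta x| <= K &
      forall x, ~~ (d < x < 1 - d) -> theta x = 0 /\ eta x = 0] /\
  (forall x, 3 * tau * `|theta x| <= a1 x / 2) /\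
  (forall x, theta x != 0 -> K^-1 <= a1 x <= K).

Section one_test_pair.
Variables (d K : R) (theta eta : R -> R).
Hypothesis tp : test_pair d K theta eta.

Let d0 : 0 < d. Proof. by case: tp => -[/andP[]]. Qed.
Let d12 : d < 1 / 2. Proof. by case: tp => -[/andP[]]. Qed.
Let d01 : 0 < d < 1. Proof. by rewrite d0; have := d12; lra. Qed.
Let acn : ac 0 1 eta theta. Proof. by case: tp => -[]. Qed.
Let mth : measurable_fun setT theta. Proof. by case: acn. Qed.
Let meta : measurable_fun setT eta. Proof. by case: tp => -[]. Qed.
Let thK x : `|theta x| <= K. Proof. by case: tp => -[_ _ _ /(_ x)[]]. Qed.
Let etaK x : `|eta x| <= K. Proof. by case: tp => -[_ _ _ /(_ x)[]]. Qed.
Let th0 (x : R) : ~~ (d < x < 1 - d) -> theta x = 0.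
Proof. by case: tp => -[_ _ _ _ /(_ x)] H _ /H[]. Qed.
Let eta0 (x : R) : ~~ (d < x < 1 - d) -> eta x = 0.
Proof. by case: tp => -[_ _ _ _ /(_ x)] H _ /H[]. Qed.
Let cth : locally_bounded_coef theta. Proof. exact: coef_bounded mth thK. Qed.
Let ceta : locally_bounded_coef eta. Proof. exact: coef_bounded meta etaK. Qed.

(** As [theta] and [eta] vanish off []d, 1 - d[], local information on [f] gives integrability on
    the whole of []0, 1[]. *)
Lemma Lr_test (t : R) f m1 m2 : 0 < t -> Lr d 1 t f ->
  locally_bounded_coef m1 -> locally_bounded_coef m2 ->
  Lr 0 1 t (fun x => theta x * m1 x + f x * (eta x * m2 x)).
Proof.
move=> t0 Lf c1_ c2_.
have [/ltW d0' dd] : 0 < d /\ 1 - d <= 1 by split => //; have := d0; lra.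
apply: (@Lr_support _ _ _ _ t0 d (1 - d)) => //.
  by move=> x xd; rewrite th0// eta0// !mul0r mulr0 addr0.
apply: (@Lr_sub _ _ _ _ d 1) => //.
apply: Lr_add => //; first by apply: coef_Lr => //; exact: coefM.
by apply: Lr_coef => //; exact: coefM.
Qed.

Let cr := coef_r.
Let cri := coef_ri.
Let csi := coef_si.

Lemma Lr_Y1 : Lr 0 1 (3 * p) (Y1 theta eta).
Proof.
rewrite (_ : Y1 _ _ = fun x => theta x * (cst (3 * tau) x * si x ^+ 2 * r x ^+ 2) +
    a01 x * (eta x * (cst (- 2 * tau) x * si x ^+ 5 * r x ^+ 2))); last first.
  by apply/funext => x; rewrite /Y1 /zeta1 /=; field.
apply: Lr_test => //; first exact: La01p.
  by do 2![apply: coefM; last exact: coefX]; exact: coef_cst.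
by do 2![apply: coefM; last exact: coefX]; exact: coef_cst.
Qed.

Lemma Lr_Y4 : Lr 0 1 q (Y4 theta eta).
Proof.
rewrite (_ : Y4 _ _ = fun x => theta x * (cst (3 * tau) x * si x * r x) +
    a01 x * (eta x * (cst (- tau) x * si x ^+ 4 * r x))); last first.
  by apply/funext => x; rewrite /Y4 /kappa1 /=; field.
apply: Lr_test => //; first exact: La01q.
  by do 2![apply: coefM => //]; exact: coef_cst.
by apply: coefM => //; apply: coefM; [exact: coef_cst|exact: coefX].
Qed.

Lemma Lr_eta (t : R) m : 0 < t -> locally_bounded_coef m -> Lr 0 1 t (fun x => eta x * m x).
Proof.
move=> t0 cm; rewrite (_ : (fun x => _) = fun x => theta x * cst 0 x + cst 1 x * (eta x * m x)).
  by apply: Lr_test => //; [apply: coef_Lr => //; exact: coef_cst|exact: coef_cst].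
by apply/funext => x; rewrite /= mulr0 add0r mul1r.
Qed.

Lemma Lr_Y2 : Lr 0 1 p (Y2 eta).
Proof.
rewrite (_ : Y2 _ = fun x => eta x * (cst (3 * tau) x * x^-1)); last first.
  by apply/funext => x; rewrite /Y2 /=; ring.
by apply: Lr_eta => //; apply: coefM; [exact: coef_cst|exact: coef_inv].
Qed.

Lemma Lr_Y3 : Lr 0 1 q (Y3 eta).
Proof.
rewrite (_ : Y3 _ = fun x => eta x * (cst (2 * tau) x * si x * ri x ^+ 2)); last first.
  by apply/funext => x; rewrite /Y3 /=; ring.
apply: Lr_eta => //; apply: coefM; last exact: coefX.
by apply: coefM => //; exact: coef_cst.
Qed.

Lemma Lr_Z : Lr 0 1 2 (Z eta).
Proof. by apply: Lr_eta => //; exact: coefX. Qed.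

Let Y5_small (x t : R) : -1 <= t <= 1 -> 0 < a1 x + t * Y5 theta x.
Proof.
move=> t1; case: tp => _ [/(_ x) H _].
have : `|t * Y5 theta x| <= a1 x / 2.
  apply: le_trans H; rewrite normrM /Y5 normrM (gtr0_norm (mulr_gt0 _ tau0))//.
  by rewrite ler_piMl ?mulr_ge0 ?(ltW tau0)// ler_norml.
by rewrite ler_norml => /andP[h1 _]; have := a1_gt0 x; lra.
Qed.

Let Y5_lt (x : R) : `|Y5 theta x| < a1 x.
Proof.
case: tp => _ [/(_ x) H _]; rewrite /Y5 normrM (gtr0_norm (mulr_gt0 _ tau0))//.
by apply: le_lt_trans H _; have := a1_gt0 x; lra.
Qed.

Let mY5 : measurable_fun setT (Y5 theta). Proof. exact: measurable_funM. Qed.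

Let sqr_integrable (f : R -> R) : Lr 0 1 2 f ->
  mu.-integrable `]0, 1[ (EFin \o (fun x => f x ^+ 2)).
Proof.
move=> [_]; apply: eq_integrable => // x _ /=.
by rewrite powR_mulrn// -normrX ger0_norm// sqr_ge0.
Qed.

Lemma perturbed_energy_integrable (t : R) : -1 <= t <= 1 ->
  mu.-integrable `]0, 1[ (EFin \o perturbed_energy theta eta t).
Proof.
move=> t1; have lin k X Y : 0 < k -> Lr 0 1 k X -> Lr 0 1 k Y ->
    Lr 0 1 k (fun x => X x + t * Y x).
  by move=> k0 LX LY; apply: Lr_add => //; exact: Lr_scale.
have m01 : measurable (`]0, 1[%classic : set R) by exact: measurable_itv.
have two0 : 0 < 2 :> R by [].
have i1 := integrable_scale (1 / 2) m01 (sqr_integrable (lin _ _ _ two0 LU Lr_Z)).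
have i2 := convex_growth_integrable Hphi (lin _ _ _ p3 LX1 Lr_Y1).
have i3 := integrable_scale 2 m01 (convex_growth_integrable HP (lin _ _ _ p0 LX2 Lr_Y2)).
have i4 := convex_growth_integrable Hg (lin _ _ _ q0 LX3 Lr_Y3).
have i5 := integrable_scale 2 m01 (convex_growth_integrable Hg (lin _ _ _ q0 LX4 Lr_Y4)).
have i6 : mu.-integrable `]0, 1[ (EFin \o (fun x => h (a1 x + t * Y5 theta x))).
(* The constant [K] bounds [|theta|], so it can fail to be positive only when [theta] is zero. *)
- have KK : 0 < K^-1 / 2 \/ forall x, theta x = 0.
    have [K0|K0] := ltP 0 K; first by left; rewrite divr_gt0// invr_gt0.
    by right => x; apply/eqP; rewrite -normr_le0 (le_trans (thK x)).
  have mh' : measurable_fun setT (fun x => h (a1 x + t * Y5 theta x)).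
    apply: convex_positive_measurable => //; last by move=> x; exact: Y5_small.
    by apply: measurable_funD => //; exact: measurable_funM.
  case: KK => [KK|thz]; last first.
    apply: eq_integrable hi => // x _ /=.
    by rewrite /Y5 thz mulr0 mulr0 addr0.
  (* Where [theta] is not zero, [a1] lies in [[K^-1, K]] and moves by at most half of itself, hence
     stays in [[K^-1 / 2, 2 K]], on which [h] is bounded. Elsewhere the term in [h] is unchanged. *)
  have [M M0 HM] := convex_positive_bounded Hh (2 * K) KK.
  apply: (@integrable_le _ _ _ (fun x => h (a1 x) + cst M x)) => //.
  + exact: measurable_funTS.
  + apply: integrable_add => //; apply: (@integrable_bounded _ 0 1 `|M|) => //.
    by apply: subset_itv; rewrite bnd_simp.
  + move=> x _ /=; have [_ _ _ hp] := Hh.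
    rewrite ger0_norm; last by apply: hp; exact: Y5_small.
    have h0 := hp _ (a1_gt0 x).
    have [thx|thx] := eqVneq (theta x) 0.
      by rewrite /Y5 thx mulr0 mulr0 addr0 lerDl.
    rewrite (le_trans (HM _ _)) ?lerDr//.
    case: tp => _ [/(_ x) H /(_ x thx) /andP[h1 h2]].
    have : `|t * Y5 theta x| <= a1 x / 2.
      apply: le_trans H; rewrite normrM /Y5 normrM (gtr0_norm (mulr_gt0 _ tau0))//.
      by rewrite ler_piMl ?mulr_ge0 ?(ltW tau0)// ler_norml.
    by rewrite ler_norml => /andP[h3 h4]; apply/andP; split; lra.
exact: (integrable_add m01 (integrable_add m01 (integrable_add m01
  (integrable_add m01 (integrable_add m01 i1 i2) i3) i4) i5) i6).
Qed.

Let sqr_line (u v : R) : is_derive (0 : R) 1 (fun t => 1 / 2 * (u + t * v) ^+ 2) (u * v).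
Proof.
apply/is_derive1_caratheodory; exists (fun t => u * v + v ^+ 2 / 2 * t); split.
- by move=> t; field.
- by apply: continuousD; [exact: cst_continuous|exact: mulrl_continuous].
- by rewrite mulr0 addr0.
Qed.

Let sqr_centre (u v : R) : centre_convex (fun t => 1 / 2 * (u + t * v) ^+ 2).
Proof.
apply: (@centre_convexZ _ (1 / 2) (fun t => (u + t * v) ^+ 2)); first by rewrite divr_ge0.
move=> t /andP[t0 t1]; have v2 : 0 <= (t * (1 - t)) * v ^+ 2.
  by rewrite mulr_ge0 ?sqr_ge0// mulr_ge0// subr_ge0.
have tv2 : 0 <= 2 * (t * v) ^+ 2 by rewrite mulr_ge0// sqr_ge0.
split; rewrite -subr_ge0.
- by apply: le_trans v2 _; rewrite le_eqVlt; apply/orP; left; apply/eqP; ring.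
- by apply: le_trans v2 _; rewrite le_eqVlt; apply/orP; left; apply/eqP; ring.
- by apply: le_trans tv2 _; rewrite le_eqVlt; apply/orP; left; apply/eqP; ring.
Qed.

Lemma first_variation :
  (forall t : R, -1 <= t <= 1 -> \int[mu]_(x in `]0, 1[) perturbed_energy theta eta 0 x <=
     \int[mu]_(x in `]0, 1[) perturbed_energy theta eta t x) ->
  mu.-integrable `]0, 1[ (EFin \o (fun x => EL_A x * theta x + EL_B x * eta x)) /\
  \int[mu]_(x in `]0, 1[) (EL_A x * theta x + EL_B x * eta x) = 0.
Proof.
move=> emin.
have m01 : measurable (`]0, 1[%classic : set R) by exact: measurable_itv.
have two0 : 0 <= 2 :> R by [].
have ce x : `]0, 1[%classic x -> centre_convex (perturbed_energy theta eta ^~ x).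
  move=> _; exact: (centre_convexD (centre_convexD (centre_convexD (centre_convexD
    (centre_convexD (sqr_centre (U x) (Z eta x))
      (convex_growth_centre Hphi (X1 x) (Y1 theta eta x)))
      (centre_convexZ two0 (convex_growth_centre HP (X2 x) (Y2 eta x))))
      (convex_growth_centre Hg (X3 x) (Y3 eta x)))
      (centre_convexZ two0 (convex_growth_centre Hg (X4 x) (Y4 theta eta x))))
      (convex_positive_centre Hh (Y5_lt x))).
have de x : `]0, 1[%classic x -> is_derive (0 : R) 1 (perturbed_energy theta eta ^~ x)
    (EL_A x * theta x + EL_B x * eta x).
  rewrite /= in_itv/= => xI; have x0 : 0 < x by case/andP: xI.
  have rn : r x != 0 by rewrite gt_eqF// r_gt0.
  have sn : s x != 0 by rewrite gt_eqF// s_gt0.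
  (* Regrouping by integrands: the right side lists the derivatives at [t = 0] of the summands of
     [perturbed_energy], in their order. *)
  have -> : EL_A x * theta x + EL_B x * eta x =
      U x * Z eta x + phi^`()%classic (X1 x) * Y1 theta eta x
      + 2 *: (P^`()%classic (X2 x) * Y2 eta x) + g^`()%classic (X3 x) * Y3 eta x
      + 2 *: (g^`()%classic (X4 x) * Y4 theta eta x) + h^`()%classic (a1 x) * Y5 theta x.
    rewrite /GRing.scale/= /EL_A /EL_B /Z /Y1 /Y2 /Y3 /Y4 /Y5 /zeta1 /kappa1 /si /ri.
    move: (phi^`()%classic _) (P^`()%classic _) (g^`()%classic (X3 x)) (g^`()%classic _)
      (h^`()%classic _) (a01 x) (theta x) (eta x) (U x) => *.
    by field; rewrite rn sn gt_eqF.
  have dh : derivable h (a1 x) 1 by case: Hh => dh _ _ _; exact: dh.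
  exact: (is_deriveD (is_deriveD (is_deriveD (is_deriveD (is_deriveD
    (sqr_line (U x) (Z eta x)) (convex_growth_line Hphi (X1 x) (Y1 theta eta x)))
    (is_deriveZ 2 (convex_growth_line HP (X2 x) (Y2 eta x))))
    (convex_growth_line Hg (X3 x) (Y3 eta x)))
    (is_deriveZ 2 (convex_growth_line Hg (X4 x) (Y4 theta eta x))))
    (is_derive_line (Y5 theta x) dh)).
have mq : measurable_fun (`]0, 1[%classic : set R) (fun x => EL_A x * theta x + EL_B x * eta x).
  apply: measurable_funTS.
  exact: (measurable_funD (measurable_funM measurable_EL_A mth)
    (measurable_funM measurable_EL_B meta)).
exact: (variation_eq0 m01 perturbed_energy_integrable ce de mq emin).
Qed.

End one_test_pair.

Let m01 : measurable (`]0, 1[%classic : set R). Proof. exact: measurable_itv. Qed.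
Let BB (x : R) : R := - \int[mu]_(t in `]x, 1[) EL_B t.
Let acBB : ac 0 1 BB EL_B.
Proof. exact: (ac_tail measurable_EL_B EL_B_integrable). Qed.
(** Cut off because [ac_mul] asks for a function Borel on the whole line, whereas continuity gives
    the measurability of [BB] on []0, 1[]. *)
Let BB0 := BB \_ `]0, 1[.
Let BB0E (x : R) : 0 < x < 1 -> BB0 x = BB x.
Proof. by move=> x01; rewrite /BB0 patchE mem_set//= in_itv. Qed.
Let mBB0 : measurable_fun setT BB0.
Proof. by apply: (measurable_restrictT _ m01).1; exact: (ac_measurable acBB). Qed.
Let acBB0 : ac 0 1 BB0 EL_B.
Proof.
apply: (ac_ext acBB _ measurable_EL_B (aeW _ (fun _ _ => erefl))) => x x01.
by rewrite BB0E.
Qed.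

Lemma by_parts (d K : R) theta eta : test_pair d K theta eta ->
  mu.-integrable `]0, 1[ (EFin \o (fun x => EL_B x * eta x + BB0 x * theta x)) /\
  \int[mu]_(x in `]0, 1[) (EL_B x * eta x + BB0 x * theta x) = 0.
Proof.
move=> [[/andP[d0 d12] acn meta _ out] _].
have d1 : d <= 1 - d by lra.
have d11 : 1 - d < 1 by lra.
have acM := ac_mul acBB0 acn mBB0 meta.
have [Mi ME] := proj2 acM d (1 - d) d0 d1 d11.
have mdd : measurable (`[d, 1 - d]%classic : set R) by exact: measurable_itv.
have sub : `[d, (1 - d)]%classic `<=` `]0, 1[%classic.
  by move=> x /=; rewrite !in_itv/= => /andP[h1 h2]; apply/andP; split; lra.
have zero x : ~ `[d, 1 - d]%classic x -> EL_B x * eta x + BB0 x * theta x = 0.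
  rewrite /= in_itv/= => dx.
  have nd : ~~ (d < x < 1 - d).
    by apply/negP => /andP[h1 h2]; apply: dx; apply/andP; split; lra.
  by have [-> ->] := out x nd; rewrite !mulr0 addr0.
split.
  by apply: (integrable_support m01 mdd sub _ Mi) => x _; exact: zero.
rewrite (Rintegral_support sub); last by move=> x _; exact: zero.
have [_ eta_d] : theta d = 0 /\ eta d = 0 by apply: out; rewrite ltxx.
have [_ eta_d'] : theta (1 - d) = 0 /\ eta (1 - d) = 0 by apply: out; rewrite ltxx andbF.
by rewrite -ME eta_d eta_d' !mulr0 subrr.
Qed.

Hypothesis Hmin : forall (d K : R) theta eta, test_pair d K theta eta ->
  forall t : R, -1 <= t <= 1 -> \int[mu]_(x in `]0, 1[) perturbed_energy theta eta 0 x <=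
     \int[mu]_(x in `]0, 1[) perturbed_energy theta eta t x.

Let W (x : R) : R := EL_A x - BB0 x.
Let mW : measurable_fun setT W.
Proof. by apply: measurable_funB => //; exact: measurable_EL_A. Qed.

(** Two vanishing integrals, the first variation and the integration by parts, are subtracted; the
    terms in [eta] cancel. *)
Lemma test_pair_orthogonal (d K : R) theta eta : test_pair d K theta eta ->
  \int[mu]_(x in `]0, 1[) (W x * theta x) = 0.
Proof.
move=> tp; have [i1 E1] := first_variation tp (Hmin tp); have [i2 E2] := by_parts tp.
rewrite -[RHS](subrr 0) -[X in X - _]E1 -[X in _ - X]E2 -RintegralB//.
by apply: eq_Rintegral => x _; rewrite /W; ring.
Qed.

Lemma EL_equation : exists k, ae_on 0 1 (fun x => EL_A x = BB x + k).
Proof.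
(* The shift by 3 makes the inverse of [kp k] smaller than [1 / 2] already for [k = 0], as a test
   pair with [d] equal to this inverse demands. *)
pose kp (k : nat) : R := k.+3%:R.
have kp0 k : 0 < kp k by rewrite ltr0n.
have kpN k : k%:R <= kp k :> R by rewrite ler_nat !leqW.
pose T (k : nat) : set R := [set x | [/\ (kp k)^-1 < x < 1 - (kp k)^-1,
  (kp k)^-1 <= a1 x <= kp k & `|W x| <= k%:R]].
have kpi_le j k : (j <= k)%N -> (kp k)^-1 <= (kp j)^-1.
  by move=> jk; rewrite lef_pV2 ?posrE// ler_nat.
have mT k : measurable (T k : set R).
    rewrite (_ : T k = `](kp k)^-1, (1 - (kp k)^-1)[%classic `&`
        ((setT `&` a1 @^-1` `[(kp k)^-1, kp k]%classic) `&`
         (setT `&` W @^-1` `[- k%:R, k%:R]%classic))).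
      apply: measurableI; first exact: measurable_itv.
      apply: measurableI; first by apply: ma1 => //; exact: measurable_itv.
      by apply: mW => //; exact: measurable_itv.
    apply/seteqP; split => x; rewrite /T /= !in_itv/= ler_norml.
      by move=> [-> -> ->].
    by move=> [h1 [[_ h2] [_ h3]]].
have [m Wm] : exists m, ae_on 0 1 (fun x => W x = m).
  apply: (@ae_const_of_orthogonal _ W T mW).
  - exact: mT.
  - move=> k x [/andP[h1 h2] _ _]; rewrite /= in_itv/=.
    have : 0 < (kp k)^-1 by rewrite invr_gt0.
    by move: (kp k)^-1 h1 h2 => z h1 h2 z0; apply/andP; split; lra.
  - move=> j k jk x [/andP[h1 h2] /andP[h3 h4] h5]; have hk := kpi_le j k jk.
    have hjk : kp j <= kp k by rewrite ler_nat.
    split; last by rewrite (le_trans h5)// ler_nat.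
      by rewrite (le_lt_trans hk h1)/= (lt_le_trans h2)// lerD2l lerN2.
    by rewrite (le_trans hk h3)/= (le_trans h4 hjk).
  - move=> x /andP[x0 x1].
    have y0 : 0 < 1 - x by rewrite subr_gt0.
    (* A single number above every quantity that membership in [T k] has to control at [x]. *)
    pose M := x^-1 + (1 - x)^-1 + (a1 x)^-1 + a1 x + `|W x|.
    have v1 : 0 < x^-1 by rewrite invr_gt0.
    have v2 : 0 < (1 - x)^-1 by rewrite invr_gt0.
    have v3 : 0 < (a1 x)^-1 by rewrite invr_gt0.
    have v4 := a1_gt0 x; have v5 := normr_ge0 (W x).
    have M0 : 0 <= M by rewrite /M; lra.
    have Mk := archi_boundP M0; exists (Num.bound M).
    have Mk' := lt_le_trans Mk (kpN _).
    have inv_lt (z : R) : 0 < z -> z^-1 <= M -> (kp (Num.bound M))^-1 < z.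
      move=> z0 zM; rewrite -[ltRHS]invrK ltf_pV2 ?posrE ?invr_gt0//.
      exact: le_lt_trans Mk'.
    have w1 := inv_lt _ x0; have w2 := inv_lt _ y0; have w3 := inv_lt _ v4.
    have {}w1 : (kp (Num.bound M))^-1 < x by apply: w1; rewrite /M; lra.
    have {}w2 : (kp (Num.bound M))^-1 < 1 - x by apply: w2; rewrite /M; lra.
    have {}w3 : (kp (Num.bound M))^-1 < a1 x by apply: w3; rewrite /M; lra.
    split.
    + by rewrite w1 ltrBrDl -ltrBrDr w2.
    + by rewrite (ltW w3)/=; apply: ltW; apply: le_lt_trans Mk'; rewrite /M; lra.
    + by apply: ltW; apply: le_lt_trans Mk; rewrite /M; lra.
  - by move=> k x [].
  - move=> k m mk I0.
    have mT' : @measurable _ (measurableTypeR R) (T k) by exact: mT.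
    (* On [T k] one has [|W - m| <= 2 kp k], so this scale gives [3 tau |theta| <= (kp k)^-1 / 2],
       which is at most [a1 / 2] there. *)
    pose t : R := (12 * tau * kp k ^+ 2)^-1.
    have t0 : 0 < t by rewrite invr_gt0 !mulr_gt0 ?exprn_gt0.
    pose theta := (fun x => t * (W x - m)) \_ (T k).
    (* One constant for two purposes: the first summand covers the range of [a1] on [T k], the
       second the size of [theta]. *)
    pose K := kp k + t * (2 * kp k).
    have thE x : T k x -> theta x = t * (W x - m) by move=> Tx; rewrite /theta patchE mem_set.
    have thN x : ~ T k x -> theta x = 0.
      by move=> Tx; rewrite /theta patchE memNset.
    have thb x : `|theta x| <= t * (2 * kp k).
      have [Tx|Tx] := pselect (T k x); last by rewrite thN// normr0 mulr_ge0 ?mulr_ge0 ?ltW.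
      rewrite thE// normrM gtr0_norm// ler_pM2l// (le_trans (ler_normB _ _))//.
      have [_ _ h1] := Tx; have := kpN k; lra.
    have mth : measurable_fun setT theta.
      apply: (measurable_restrictT _ (mT k)).1; apply: measurable_funTS.
      by apply: measurable_funM => //; exact: measurable_funB.
    have T01 : T k `<=` `]0, 1[%classic.
      move=> x [/andP[h1 h2] _ _]; rewrite /= in_itv/=.
      have : 0 < (kp k)^-1 by rewrite invr_gt0.
      by move: (kp k)^-1 h1 h2 => z h1 h2 z0; apply/andP; split; lra.
    have Tint (v : R -> R) : \int[mu]_(x in `]0, 1[) (v x * theta x) =
        \int[mu]_(x in T k) (v x * theta x).
      by apply: Rintegral_support => // x _ Tx; rewrite thN// mulr0.
    have bi (v : R -> R) (M : R) : measurable_fun setT v -> (forall x, T k x -> `|v x| <= M) ->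
        mu.-integrable (T k) (EFin \o v).
      move=> mv vM; apply: (@integrable_bounded _ 0 1 M) => //; last exact: measurable_funTS.
      by apply: (subset_trans T01); apply: subset_itv; rewrite bnd_simp.
    have mWm : measurable_fun setT (fun x => W x - m) by exact: measurable_funB.
    have wm x : T k x -> `|W x - m| <= k%:R + k%:R.
      by move=> [_ _ h1]; rewrite (le_trans (ler_normB _ _))// lerD.
    have mean : \int[mu]_(x in `]0, 1[) theta x = 0.
      have := Tint (cst 1); under eq_Rintegral do rewrite mul1r.
      move=> ->; rewrite (_ : \int[mu]_(x in T k) _ = \int[mu]_(x in T k) (t * (W x - m))).
        by rewrite (RintegralZl t mT' (bi _ _ mWm wm)) I0 mulr0.
      by apply: eq_Rintegral => x /set_mem Tx; rewrite mul1r thE.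
    have dd : 0 < (kp k)^-1 < 1 / 2.
      rewrite invr_gt0 kp0 div1r ltf_pV2 ?posrE//=.
      by rewrite ltr_nat.
    have thK x : `|theta x| <= K by rewrite (le_trans (thb x))// lerDr ltW.
    have th0 x : ~~ ((kp k)^-1 < x < 1 - (kp k)^-1) -> theta x = 0.
      by move=> /negP h1; apply: thN => -[].
    have [eta [acn meta etaK eta0]] := test_primitive mth thK th0 mean.
    have tp : test_pair (kp k)^-1 K theta eta.
      split; first by split => // x h1; split; [exact: th0|exact: eta0].
      split => x.
        have [Tx|Tx] := pselect (T k x); last by rewrite thN// normr0 mulr0 divr_ge0 ?ltW.
        have [_ /andP[h1 _] _] := Tx.
        apply: (@le_trans _ _ ((kp k)^-1 / 2)); last by rewrite ler_pM2r.
        apply: (@le_trans _ _ (3 * tau * (t * (2 * kp k)))).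
          by rewrite ler_pM2l ?mulr_gt0//; exact: thb.
        rewrite le_eqVlt; apply/orP; left; apply/eqP; rewrite /t.
        by field; rewrite gt_eqF// gt_eqF.
      move=> thx; have Tx : T k x by apply: contrapT => /thN h1; rewrite h1 eqxx in thx.
      have [_ /andP[h1 h2] _] := Tx.
      have kK : kp k <= K by rewrite /K lerDl mulr_ge0 ?mulr_ge0 ?ltW.
      have K0 : 0 < K by exact: lt_le_trans kK.
      rewrite (le_trans h2)// andbT (le_trans _ h1)//.
      by rewrite lef_pV2 ?posrE.
    have := test_pair_orthogonal tp; rewrite Tint.
    rewrite (_ : \int[mu]_(x in T k) _ = \int[mu]_(x in T k) (t * (W x * (W x - m)))); last first.
      by apply: eq_Rintegral => x /set_mem Tx; rewrite thE//; ring.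
    have WWi : mu.-integrable (T k) (EFin \o (fun x => W x * (W x - m))).
      apply: (bi _ (k%:R * (k%:R + k%:R))); first exact: measurable_funM.
      by move=> x Tx; rewrite normrM ler_pM//; [case: Tx|exact: wm].
    by rewrite (RintegralZl t mT' WWi) => /eqP; rewrite mulf_eq0 gt_eqF//= => /eqP.
exists m; apply: aeS Wm => x + xab => /(_ xab).
have x01 : 0 < x < 1 by move: xab; rewrite inE/= in_itv.
by rewrite /W BB0E// => /eqP; rewrite subr_eq => /eqP ->; rewrite addrC.
Qed.

End euler_lagrange.

(** * Admissible competitors *)

Section competitor.
Context {R : realType}.
Notation mu := (@lebesgue_measure R).
Variables (p q lam tau : R) (phi g h al0 be0 ga0 v0 al be ga v : R -> R).
Variables (b a a1 c c1 w w1 w0 a0 a01 : R -> R).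
Hypothesis p1 : 1 < p.
Hypothesis q1 : 1 < q.
Hypothesis tau0 : 0 < tau.
Hypothesis Hphi : convex_growth (3 * p) phi.
Hypothesis HP : convex_growth p (psi phi).
Hypothesis Hg : convex_growth q g.
Hypothesis Hh : convex_positive h.
Hypothesis ma0 : measurable_fun setT a0.
Hypothesis aca0 : ac 0 1 a0 a01.
Hypothesis a0_gt0 : forall x : R, 0 < x < 1 -> 0 < a0 x.
Hypothesis a0_mono : forall x y : R, 0 < x -> x <= y -> y < 1 -> a0 x <= a0 y.
Hypothesis La01p : forall d : R, 0 < d < 1 -> Lr d 1 (3 * p) a01.
Hypothesis La01q : forall d : R, 0 < d < 1 -> Lr d 1 q a01.
Hypothesis ma : measurable_fun setT a.
Hypothesis aca : ac 0 1 a a1.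
Hypothesis a1_gt0 : forall x, 0 < a1 x.
Hypothesis La : Lr 0 1 1 a.
Hypothesis La1 : Lr 0 1 1 a1.
Hypothesis mb : measurable_fun setT b.
Hypothesis ib : forall x y, 0 < x -> x <= y -> y < 1 -> mu.-integrable `[x, y] (EFin \o b).
Hypothesis mc : measurable_fun setT c.
Hypothesis acc : ac 0 1 c c1.
Hypothesis mw : measurable_fun setT w.
Hypothesis acw : ac 0 1 w w1.

Let r (x : R) := x `^ (1 / 3).
Let ri (x : R) := (r x)^-1.
Let s (x : R) := a0 x `^ (1 / 3).
Let si (x : R) := (s x)^-1.
Let X1 (x : R) := b x * r x ^+ 2.
Let X2 (x : R) := a x / x.
Let X3 (x : R) := c x * ri x ^+ 2.
Let X4 (x : R) := 3 / 2 * c1 x * r x.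
Let U (x : R) := w x - w0 x.

Hypothesis LX1 : Lr 0 1 (3 * p) X1.
Hypothesis LX2 : Lr 0 1 p X2.
Hypothesis LX3 : Lr 0 1 q X3.
Hypothesis LX4 : Lr 0 1 q X4.
Hypothesis LU : Lr 0 1 2 U.
Hypothesis Lw : Lr 0 1 2 w.
Hypothesis Lw1 : Lr 0 1 (3 * p) (fun x => w1 x * r x ^+ 2).

Hypothesis eal0 : ae_on 0 1 (fun x => al0 x = a0 x).
Hypothesis eal : ae_on 0 1 (fun x => al x = a x).
Hypothesis ebe : ae_on 0 1 (fun x => be x = b x).
Hypothesis ega : ae_on 0 1 (fun x => ga x = c x).
Hypothesis ev : ae_on 0 1 (fun x => v x = w x).
Hypothesis ev' : ae_on 0 1 (fun x => wderiv 0 1 v x = w1 x).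
Hypothesis ev0 : ae_on 0 1 (fun x => v0 x = w0 x).

Hypothesis Cbe : ae_on 0 1 (fun x => (be x - be0 x) / tau = 3 * wderiv 0 1 v x).
Hypothesis Cal : ae_on 0 1 (fun x => (al x - al0 x) / tau = 3 * al0 x `^ (2 / 3) * v x).
Hypothesis Cga : ae_on 0 1 (fun x => (ga x - ga0 x) / tau = 2 * al0 x `^ (1 / 3) * v x).
Hypothesis al_0 : 0 <= crep al 0.
Hypothesis al_1 : crep al 1 = lam.

Let s_gt0 (x : R) : 0 < x < 1 -> 0 < s x.
Proof. by move=> x01; apply: powR_gt0; exact: a0_gt0. Qed.
Let ms : measurable_fun setT s. Proof. exact: measurable_fun_powR. Qed.
Let msi : measurable_fun setT si. Proof. exact: measurable_funV. Qed.
Let mr : measurable_fun setT r. Proof. exact: measurable_fun_powR. Qed.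
Let ma01 : measurable_fun setT a01. Proof. by case: aca0. Qed.
Let p3 : 0 < 3 * p. Proof. by rewrite mulr_gt0// (lt_trans _ p1). Qed.
Let p0 : 0 < p. Proof. by rewrite (lt_trans _ p1). Qed.
Let q0 : 0 < q. Proof. by rewrite (lt_trans _ q1). Qed.

Lemma ac_s_inv : ac 0 1 si (fun x => - (1 / 3) * (a01 x * si x ^+ 4)).
Proof.
have acs := ac_cuberoot aca0 ma0 a0_gt0.
apply: (ac_ext (ac_inv acs ms s_gt0)) => //.
  by apply: measurable_funM => //; apply: measurable_funM => //; exact: measurable_funX.
apply/ae_onP; apply: aeW => x x01; rewrite /si -/(s x).
by have := s_gt0 x01; move: (s x) => z z0; field; rewrite gt_eqF.
Qed.

Section direction.
Variables (d K : R) (theta eta : R -> R).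
Hypothesis tp : test_pair tau a1 d K theta eta.
Let acn : ac 0 1 eta theta. Proof. by case: tp => -[]. Qed.
Let meta : measurable_fun setT eta. Proof. by case: tp => -[]. Qed.
Let mth : measurable_fun setT theta. Proof. by case: acn. Qed.
Let zeta := zeta1 a0 a01 theta eta.
Let kappa := kappa1 a0 a01 theta eta.
Let mzeta : measurable_fun setT zeta.
Proof.
apply: measurable_funD; apply: measurable_funM => //; first exact: measurable_funX.
apply: measurable_funM; [exact: measurable_funM|exact: measurable_funX].
Qed.
Let mkappa : measurable_fun setT kappa.
Proof.
apply: measurable_funD; apply: measurable_funM => //.
apply: measurable_funM; [exact: measurable_funM|exact: measurable_funX].
Qed.

Lemma ac_kappa1 : ac 0 1 (fun x => eta x * si x) (kappa1 a0 a01 theta eta).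
Proof.
apply: (ac_ext (ac_mul acn ac_s_inv meta msi)) => //.
by apply: aeW => x _; rewrite /kappa1 /si /s; ring.
Qed.

Lemma ac_zeta1 : ac 0 1 (fun x => eta x * si x ^+ 2) (zeta1 a0 a01 theta eta).
Proof.
have mes : measurable_fun setT (fun x => eta x * si x) by exact: measurable_funM.
apply: (ac_ext (ac_mul ac_kappa1 ac_s_inv mes msi)) => //.
  by move=> x _; ring.
apply: aeW => x _; rewrite /zeta1 /kappa1 /si /s.
by move: ((a0 x `^ (1 / 3))^-1) => z; field.
Qed.

Variable t : R.
Hypothesis t1 : -1 <= t <= 1.

(** The competitors perturb the given functions rather than their representatives, so that for
    [t = 0] they are literally the minimizer. *)
Definition alt (x : R) := al x + t * (3 * tau) * eta x.
Definition bet (x : R) := be x + t * (3 * tau) * zeta x.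
Definition gat (x : R) := ga x + t * (2 * tau) * (eta x * si x).
Definition vt (x : R) := v x + t * (eta x * si x ^+ 2).

Let perturb (F f f' G g' : R -> R) (k : R) : ac 0 1 F f -> measurable_fun setT F ->
  ac 0 1 G g' -> measurable_fun setT G -> ae_on 0 1 (fun x => f' x = F x) ->
  in_W11loc 0 1 (fun x => f' x + k * G x) /\
  ae_on 0 1 (fun x => wderiv 0 1 (fun x => f' x + k * G x) x = f x + k * g' x).
Proof.
move=> acF mF acG mG e; apply: (ac_wderiv ltr01 (ac_lin k acF acG)).
  by apply: measurable_funD => //; exact: measurable_funM.
by apply: aeS e => x + x01 => /(_ x01) ->.
Qed.

Let mes : measurable_fun setT (fun x => eta x * si x). Proof. exact: measurable_funM. Qed.
Let mess : measurable_fun setT (fun x => eta x * si x ^+ 2).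
Proof. by apply: measurable_funM => //; exact: measurable_funX. Qed.
Let Wal := perturb (t * (3 * tau)) aca ma acn meta eal.
Let Wga := perturb (t * (2 * tau)) acc mc ac_kappa1 mes ega.
Let Wv := perturb t acw mw ac_zeta1 mess ev.

Let pos (x : R) : 0 < a1 x + t * (3 * tau) * theta x.
Proof.
case: tp => _ [/(_ x) H _].
have : `|t * (3 * tau) * theta x| <= a1 x / 2.
  apply: le_trans H; rewrite !normrM -mulrA (gtr0_norm tau0) (@ger0_norm _ 3)//.
  by rewrite ler_piMl ?mulr_ge0 ?(ltW tau0)// ler_norml.
by rewrite ler_norml => /andP[h1 _]; have := a1_gt0 x; lra.
Qed.

Let etaK x : `|eta x| <= K. Proof. by case: tp => -[_ _ _ /(_ x)[]]. Qed.
Let thK x : `|theta x| <= K. Proof. by case: tp => -[_ _ _ /(_ x)[]]. Qed.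

Let thirds (x : R) : x \in `]0, 1[ ->
  [/\ 0 < x < 1, r x != 0, x = r x ^+ 3 & x `^ (2 / 3) = r x ^+ 2].
Proof.
rewrite inE/= in_itv/= => x01; have x0 : 0 < x by case/andP: x01.
by have [h1 h2 h3 _ _] := powR_thirds x0; split => //; rewrite gt_eqF.
Qed.

Lemma alt_X1 : in_X1 p alt.
Proof.
have one0 : 0 < 1 :> R by [].
split; last first.
  apply: (Lr_in_Lp p0 (Lr_add p0 LX2 (Lr_scale p0 t (Lr_Y2 p1 tp)))).
  by apply: aeS eal => x + x01 => /(_ x01) e; rewrite /alt e /X2; ring.
split; first by case: Wal.
- apply: (Lr_in_Lp one0 (Lr_add one0 La (Lr_scale one0 (t * (3 * tau))
    (Lr_bounded one0 meta (fun x _ => etaK x))))).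
  by apply: aeS eal => x + x01 => /(_ x01) e; rewrite /alt e.
- apply: (Lr_in_Lp one0 (Lr_add one0 La1 (Lr_scale one0 (t * (3 * tau))
    (Lr_bounded one0 mth (fun x _ => thK x))))).
  by case: Wal.
Qed.

Lemma bet_X2 : in_X2 p bet.
Proof.
split; last first.
  apply: (Lr_in_Lp p3 (Lr_add p3 LX1 (Lr_scale p3 t
    (Lr_Y1 p1 ma0 a0_gt0 a0_mono La01p tp)))).
  apply: aeS ebe => x + x01 => /(_ x01) e; have [_ _ _ ->] := thirds x01.
  by rewrite /bet e /X1 /zeta /r; ring.
exists (fun x => b x + t * (3 * tau) * zeta x); last first.
  by apply: aeS ebe => x + x01 => /(_ x01) e; rewrite /bet e.
apply/locally_integrable_itvP.
  by apply: measurable_funTS; apply: measurable_funD => //; exact: measurable_funM.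
move=> x y x0 xy y1; apply: integrable_add => //; first exact: ib.
by apply: integrable_scale => //; exact: (ac_integrable ac_zeta1).
Qed.

Lemma gat_X3 : in_X3 q gat.
Proof.
split; first by case: Wga.
- apply: (Lr_in_Lp q0 (Lr_add q0 LX3 (Lr_scale q0 t
    (Lr_Y3 q1 ma0 a0_gt0 a0_mono tp)))).
  apply: aeS ega => x + x01 => /(_ x01) e; have [_ rx _ ->] := thirds x01.
  rewrite /gat e /X3 /ri /si /s /r.
  by move: ((a0 x `^ (1 / 3))^-1) => z; field.
- apply: (Lr_in_Lp q0 (Lr_scale q0 (2 / 3) (Lr_add q0 LX4 (Lr_scale q0 t
    (Lr_Y4 q1 ma0 a0_gt0 a0_mono La01q tp))))).
  case: Wga => _; apply: aeS => x + x01 => /(_ x01) ->.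
  by rewrite /X4 /r; field.
Qed.

Lemma vt_Y : in_Y p vt.
Proof.
have two0 : 0 < 2 :> R by [].
split; first by case: Wv.
- apply: (Lr_in_Lp two0 (Lr_add two0 Lw (Lr_scale two0 t
    (Lr_Z ma0 a0_gt0 a0_mono tp)))).
  by apply: aeS ev => x + x01 => /(_ x01) e; rewrite /vt e.
(* The derivative of [eta / s^2], times [r^2], is the direction already estimated for [beta] divided
   by [3 tau]. *)
- apply: (Lr_in_Lp p3 (Lr_add p3 Lw1 (Lr_scale p3 (t / (3 * tau))
    (Lr_Y1 p1 ma0 a0_gt0 a0_mono La01p tp)))).
  case: Wv => _; apply: aeS => x + x01 => /(_ x01) ->.
  have [_ _ _ ->] := thirds x01.
  by rewrite -/(r x); field; rewrite gt_eqF.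
Qed.

Let pe := perturbed_energy tau phi (psi phi) g h b a a1 c c1 U a0 a01 theta eta t.

Let ae_onI (P Q : R -> Prop) : ae_on 0 1 P -> ae_on 0 1 Q -> ae_on 0 1 (fun x => P x /\ Q x).
Proof. by apply: aeS2 => x HP_ HQ_ x01; split; [exact: HP_|exact: HQ_]. Qed.

Lemma functional_perturbed : functional phi g h v0 alt bet gat vt =
  (\int[mu]_(x in `]0%R, 1%R[) (pe x)%:E)%E.
Proof.
apply: eq_integral_ae.
have [_ Ea] := Wal; have [_ Eg] := Wga.
apply: aeS (ae_onI eal (ae_onI ebe (ae_onI ega (ae_onI Ea (ae_onI Eg (ae_onI ev ev0)))))).
move=> x + x01 => /(_ (mem_set x01)) [e1 [e2 [e3 [e4 [e5 [e6 e7]]]]]].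
have [_ rx _ x23] := thirds (mem_set x01).
congr (_%:E); rewrite /energy /pe /perturbed_energy !addrA.
have -> : vt x - v0 x = U x + t * (eta x * si x ^+ 2) by rewrite /vt e6 e7 /U; ring.
have -> : bet x * x `^ (2 / 3) = X1 x + t * (3 * tau * zeta x * r x ^+ 2).
  by rewrite /bet x23 e2 /X1; ring.
have -> : alt x / x = X2 x + t * (3 * tau * eta x / x) by rewrite /alt e1 /X2; ring.
have -> : gat x / x `^ (2 / 3) = X3 x + t * (2 * tau * eta x * si x * ri x ^+ 2).
  by rewrite /gat x23 e3 /X3 /ri; move: (si x) => z; field.
rewrite [wderiv 0 1 alt x]e4 [wderiv 0 1 gat x]e5.
congr (_ + _ + _ + _ + 2 * g _ + h _); first by rewrite /X4 -/(r x); field.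
by ring.
Qed.

Let d0 : 0 < d. Proof. by case: tp => -[/andP[]]. Qed.
Let d12 : d < 1 / 2. Proof. by case: tp => -[/andP[]]. Qed.
Let eta0 (x : R) : ~~ (d < x < 1 - d) -> eta x = 0.
Proof. by case: tp => -[_ _ _ _ /(_ x)] H _ /H[]. Qed.

(** Absolute continuity on []0, 1[] says nothing at or beyond the ends; there [eta] vanishes on a
    ball of radius [d]. *)
Let eta_continuous : continuous eta.
Proof.
move=> x; have [x0|x0] := ltP 0 x; last first.
  apply/continuous_epsP => e e0; exists d => // y yx.
  rewrite !eta0 ?subrr ?normr0//; apply/negP => /andP[h1 h2]; first by have := d0; lra.
  by move: yx; rewrite ltr_norml => /andP[]; lra.
have [x1|x1] := ltP x 1; first by apply: (ac_continuous acn); rewrite x0.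
apply/continuous_epsP => e e0; exists d => // y yx.
rewrite !eta0 ?subrr ?normr0//; apply/negP => /andP[h1 h2]; first by have := d0; lra.
by move: yx; rewrite ltr_norml => /andP[]; lra.
Qed.

(** The sum of [crep al] and a multiple of [eta] is a continuous representative of [alt], and [eta]
    vanishes at both ends. Continuous representatives agree up to the boundary. *)
Lemma alt_boundary : crep alt 0 = crep al 0 /\ crep alt 1 = crep al 1.
Proof.
have [G [cG GE]] := ac_within01 aca (Lr_integrable (lexx 1) La1).
have [cA eA] : {within `[0, 1], continuous (crep al)} /\ ae_on 0 1 (fun x => al x = crep al x).
  apply: crepP; exists G; split => //; apply: aeS eal => x + x01 => /(_ x01) ->.
  by apply: GE; case: (thirds x01).
pose H := crep al + (fun x => t * (3 * tau) * eta x).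
have cH : {within `[0, 1], continuous H}.
  move=> x; apply: continuousD; first exact: cA.
  apply: continuous_subspaceT => {}x.
  by apply: (@continuousM _ _ (cst (t * (3 * tau))) eta); [exact: cst_continuous|exact: eta_continuous].
have eH : ae_on 0 1 (fun x => alt x = H x).
  by apply: aeS eA => x + x01 => /(_ x01) e; rewrite /alt e.
have [cT eT] : {within `[0, 1], continuous (crep alt)} /\ ae_on 0 1 (fun x => alt x = crep alt x).
  by apply: crepP; exists H.
have [|-> ->] := within01_continuous_ext cT cH.
  by apply: aeS2 eT eH => x e1 e2 x01; rewrite -e1// e2.
have E0 : eta 0 = 0 by apply: eta0; apply/negP => /andP[]; have := d0; lra.
have E1 : eta 1 = 0 by apply: eta0; apply/negP => /andP[]; have := d0; lra.
by rewrite /H !fctE E0 E1 !mulr0 !addr0.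
Qed.

Hypothesis hi : mu.-integrable `]0, 1[ (EFin \o (fun x => h (a1 x))).

Let pe_integrable : mu.-integrable `]0, 1[ (EFin \o pe).
Proof.
exact: (perturbed_energy_integrable p1 q1 tau0 Hphi HP Hg Hh ma0 a0_gt0 a0_mono La01p La01q
  (proj1 La1) a1_gt0 LX1 LX2 LX3 LX4 LU hi tp t1).
Qed.

Lemma admissible_perturbed :
  admissible p q lam tau phi g h al0 be0 ga0 v0 alt bet gat vt.
Proof.
have [_ Ea] := Wal; have [_ Ev] := Wv; have [B0 B1] := alt_boundary.
have tn : tau != 0 by rewrite gt_eqF.
split.
- split; [exact: alt_X1|exact: bet_X2|exact: gat_X3|exact: vt_Y].
- by rewrite B0 B1.
- by apply: aeS Ea => x + x01 => /(_ x01) ->; exact: pos.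
- rewrite functional_perturbed; exact: (integrable_lty _ pe_integrable).
- split.
  + apply: aeS3 Cbe Ev ev' => x + + + x01 => /(_ x01) h1 /(_ x01) h2 /(_ x01) h3.
    rewrite [wderiv 0 1 vt x]h2 -h3 /bet.
    have -> : wderiv 0 1 v x = (be x - be0 x) / tau / 3 by rewrite h1; field.
    by rewrite /zeta; field.
  + apply: aeS2 Cal eal0 => x + + x01 => /(_ x01) h1 /(_ x01) h2.
    have [x01' _ _ _] := thirds x01; have [sx _ s23 _ _] := powR_thirds (a0_gt0 x01').
    move: h1; rewrite !h2 s23 => h1.
    have sn : s x != 0 by rewrite gt_eqF.
    rewrite mulrDr -h1 /alt /si -/(s x); field; rewrite tn sn//.
  + apply: aeS2 Cga eal0 => x + + x01 => /(_ x01) h1 /(_ x01) h2.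
    have [x01' _ _ _] := thirds x01; have [sx _ _ _ _] := powR_thirds (a0_gt0 x01').
    move: h1; rewrite !h2 => h1.
    have sn : s x != 0 by rewrite gt_eqF.
    rewrite mulrDr -h1 /gat /si -/(s x); field; rewrite tn sn//.
Qed.

End direction.
Let alt0 eta : alt eta 0 = al.
Proof. by apply/funext => x; rewrite /alt !mul0r addr0. Qed.
Let bet0 theta eta : bet theta eta 0 = be.
Proof. by apply/funext => x; rewrite /bet !mul0r addr0. Qed.
Let gat0 eta : gat eta 0 = ga.
Proof. by apply/funext => x; rewrite /gat !mul0r addr0. Qed.
Let vt0 eta : vt eta 0 = v.
Proof. by apply/funext => x; rewrite /vt !mul0r addr0. Qed.

Let E := perturbed_energy tau phi (psi phi) g h b a a1 c c1 U a0 a01.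

Let functional0 (d K : R) theta eta : test_pair tau a1 d K theta eta ->
  functional phi g h v0 al be ga v = (\int[mu]_(x in `]0%R, 1%R[) (E theta eta 0 x)%:E)%E.
Proof.
by move=> tp; rewrite -(functional_perturbed tp 0) alt0 bet0 gat0 vt0.
Qed.

Hypothesis functional_fin : (functional phi g h v0 al be ga v < +oo)%E.

Lemma stretch_energy_integrable : mu.-integrable `]0, 1[ (EFin \o (fun x => h (a1 x))).
Proof.
(* The zero direction expresses the functional at the minimizer as an integral of representatives,
   whose integrand dominates [h (a1 x)]. Any [d] in []0, 1 / 2[] would do. *)
have tp : test_pair tau a1 (1 / 4) 0 (cst 0) (cst 0).
  split; first split.
  - by apply/andP; split; lra.
  - exact: ac_cst.
  - exact: measurable_cst.
  - by move=> x; rewrite /= normr0.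
  - by [].
  - split => x; last by rewrite eqxx.
    by rewrite /= normr0 mulr0 divr_ge0// ltW.
have [_ _ _ phi0 _] := Hphi; have [_ _ _ P0 _] := HP; have [_ _ _ g0 _] := Hg.
have [_ _ _ h0] := Hh.
apply/integrableP; split.
  apply/measurable_EFinP; apply: measurable_funTS.
  by apply: convex_positive_measurable => //; exact: (proj1 La1).
apply: le_lt_trans functional_fin; rewrite (functional0 tp).
have hE x : h (a1 x) <= E (cst 0) (cst 0) 0 x.
  rewrite /E /perturbed_energy !mul0r !addr0 lerDr.
  by do !apply: addr_ge0 => //; apply: mulr_ge0 => //; rewrite ?sqr_ge0 ?divr_ge0.
apply: ge0_le_integral_ae => [x _|x _|]; first exact: abse_ge0.
  by rewrite lee_fin; apply: le_trans (hE x); exact: h0.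
by apply: aeW => x _; rewrite /= lee_fin ger0_norm ?h0.
Qed.

Hypothesis minimal : forall al1 be1 ga1 v1,
  admissible p q lam tau phi g h al0 be0 ga0 v0 al1 be1 ga1 v1 ->
  (functional phi g h v0 al be ga v <= functional phi g h v0 al1 be1 ga1 v1)%E.

Lemma energy_minimal (d K : R) theta eta : test_pair tau a1 d K theta eta ->
  forall t : R, -1 <= t <= 1 ->
  \int[mu]_(x in `]0, 1[) E theta eta 0 x <= \int[mu]_(x in `]0, 1[) E theta eta t x.
Proof.
move=> tp t t1; have hi := stretch_energy_integrable.
have Ei u : -1 <= u <= 1 -> mu.-integrable `]0, 1[ (EFin \o E theta eta u).
  exact: (perturbed_energy_integrable p1 q1 tau0 Hphi HP Hg Hh ma0 a0_gt0 a0_mono La01p La01q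
    (proj1 La1) a1_gt0 LX1 LX2 LX3 LX4 LU hi tp).
have m01 : measurable (`]0, 1[%classic : set R) by exact: measurable_itv.
have z1 : -1 <= (0 : R) <= 1 by rewrite oppr_le0 ler01.
have Ef u : -1 <= u <= 1 -> (\int[mu]_(x in `]0%R, 1%R[) (E theta eta u x)%:E)%E \is a fin_num.
  by move=> u1; apply: integrable_fin_num; [exact: m01|exact: Ei].
apply: fine_le; [exact: Ef|exact: Ef|].
rewrite -(functional0 tp) -(functional_perturbed tp t).
by apply: minimal; exact: (admissible_perturbed tp t1 hi).
Qed.

Lemma minimizer_EL_equation : exists k, ae_on 0 1 (fun x =>
  EL_A tau phi g h b a1 c1 a0 x =
  - (\int[mu]_(y in `]x, 1[) EL_B tau phi (psi phi) g b a c c1 U a0 a01 y) + k).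
Proof.
exact: (EL_equation p1 q1 tau0 Hphi HP Hg Hh ma0 aca0 a0_gt0 a0_mono La01p La01q
  (proj1 La1) a1_gt0 LX1 LX2 LX3 LX4 LU stretch_energy_integrable energy_minimal).
Qed.

End competitor.

(** * The equation and the regularity of minimizers *)

Section regularity.
Context {R : realType}.
Notation mu := (@lebesgue_measure R).
Variables (p q tau : R) (a0 a01 : R -> R).
Hypothesis p1 : 1 < p.
Hypothesis q1 : 1 < q.
Hypothesis tau0 : 0 < tau.
Hypothesis ma0 : measurable_fun setT a0.
Hypothesis aca0 : ac 0 1 a0 a01.
Hypothesis a0_gt0 : forall x : R, 0 < x < 1 -> 0 < a0 x.
Hypothesis a0_mono : forall x y : R, 0 < x -> x <= y -> y < 1 -> a0 x <= a0 y.
Hypothesis La01p : forall d : R, 0 < d < 1 -> Lr d 1 (3 * p) a01.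
Hypothesis La01q : forall d : R, 0 < d < 1 -> Lr d 1 q a01.

Let r (x : R) := x `^ (1 / 3).
Let ri (x : R) := (r x)^-1.
Let s (x : R) := a0 x `^ (1 / 3).
Let si (x : R) := (s x)^-1.

Let s_gt0 (x : R) : 0 < x < 1 -> 0 < s x.
Proof. by move=> x01; apply: powR_gt0; exact: a0_gt0. Qed.
Let ms : measurable_fun setT s. Proof. exact: measurable_fun_powR. Qed.
Let msi : measurable_fun setT si. Proof. exact: measurable_funV. Qed.
Let mr : measurable_fun setT r. Proof. exact: measurable_fun_powR. Qed.
Let ma01 : measurable_fun setT a01. Proof. by case: aca0. Qed.
Let p3 : 1 <= 3 * p. Proof. by have := p1; lra. Qed.
Let p30 : 0 < 3 * p. Proof. exact: lt_le_trans p3. Qed.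
Let q0 : 0 < q. Proof. by rewrite (lt_trans _ q1). Qed.
Let csi : locally_bounded_coef si. Proof. exact: coef_si. Qed.

Lemma coef_ac (F f : R -> R) : measurable_fun setT F -> ac 0 1 F f ->
  (forall d : R, 0 < d < 1 -> mu.-integrable `]d, 1[ (EFin \o f)) -> locally_bounded_coef F.
Proof.
move=> mF acF fi; split => // d d01.
by have [M _ HM] := ac_bounded acF d01 (fi _ d01); exists M.
Qed.

(** The derivative of [a0] is integrable up to [1], so [a0] stays bounded there. *)
Lemma coef_s : locally_bounded_coef s.
Proof.
split => // d d01; have d0 : 0 < d by case/andP: d01.
have [_ Ha] : locally_bounded_coef a0.
  by apply: (coef_ac ma0 aca0) => e e01; exact: (Lr_integrable p3 (La01p e01)).
have [M HM] := Ha d d01; exists (M `^ (1 / 3)) => x /andP[dx x1].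
have x01 : 0 < x < 1 by rewrite (lt_le_trans d0 dx).
have ax := a0_gt0 x01.
have aM : a0 x <= M by rewrite -[a0 x]gtr0_norm// HM// dx.
rewrite gtr0_norm ?s_gt0//; apply: ge0_ler_powR => //; rewrite ?divr_ge0//.
- by rewrite nnegrE ltW.
- by rewrite nnegrE (le_trans (ltW ax)).
Qed.

Lemma ac_s : ac 0 1 s (fun x => 1 / 3 * (a01 x * si x ^+ 2)).
Proof.
apply: (ac_ext (ac_cuberoot aca0 ma0 a0_gt0)) => //.
  by apply: measurable_funM => //; apply: measurable_funM => //; exact: measurable_funX.
apply/ae_onP; apply: aeW => x x01; rewrite /si -/(s x).
by have := s_gt0 x01; move: (s x) => z z0; field; rewrite gt_eqF.
Qed.

Lemma ac_s2 : ac 0 1 (fun x => s x ^+ 2) (fun x => 2 / 3 * (a01 x * si x)).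
Proof.
apply: (ac_ext (ac_mul ac_s ac_s ms ms)) => //.
  by do 2?[apply: measurable_funM => //].
apply/ae_onP; apply: aeW => x x01; rewrite /si.
by have := s_gt0 x01; move: (s x) => z z0; field; rewrite gt_eqF.
Qed.

Section conclusions.
Variables (phi g h al0 al be ga v v0 : R -> R).
Variables (b a a1 c c1 U : R -> R) (k : R).
Hypothesis Hphi : convex_growth (3 * p) phi.
Hypothesis HP : convex_growth p (psi phi).
Hypothesis Hg : convex_growth q g.
Hypothesis Hh : convex_positive h.
Hypothesis a1_gt0 : forall x, 0 < a1 x.
Let X1 (x : R) := b x * r x ^+ 2.
Let X2 (x : R) := a x / x.
Let X3 (x : R) := c x * ri x ^+ 2.
Let X4 (x : R) := 3 / 2 * c1 x * r x.
Hypothesis LX1 : Lr 0 1 (3 * p) X1.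
Hypothesis LX2 : Lr 0 1 p X2.
Hypothesis LX3 : Lr 0 1 q X3.
Hypothesis LX4 : Lr 0 1 q X4.
Hypothesis LU : Lr 0 1 2 U.
Hypothesis eal0 : ae_on 0 1 (fun x => al0 x = a0 x).
Hypothesis eal0' : ae_on 0 1 (fun x => wderiv 0 1 al0 x = a01 x).
Hypothesis eal : ae_on 0 1 (fun x => al x = a x).
Hypothesis eal' : ae_on 0 1 (fun x => wderiv 0 1 al x = a1 x).
Hypothesis ebe : ae_on 0 1 (fun x => be x = b x).
Hypothesis ega : ae_on 0 1 (fun x => ga x = c x).
Hypothesis ega' : ae_on 0 1 (fun x => wderiv 0 1 ga x = c1 x).
Hypothesis eU : ae_on 0 1 (fun x => v x - v0 x = U x).

Let A := EL_A tau phi g h b a1 c1 a0.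
Let B := EL_B tau phi (psi phi) g b a c c1 U a0 a01.
Hypothesis EL : ae_on 0 1 (fun x => A x = - (\int[mu]_(y in `]x, 1[) B y) + k).

Let mB : measurable_fun setT B.
Proof. exact: (measurable_EL_B _ Hphi HP Hg ma0 aca0 a0_gt0 a0_mono LX1 LX2 LX3 LX4 LU). Qed.
Let iB (d : R) : 0 < d < 1 -> mu.-integrable `]d, 1[ (EFin \o B).
Proof.
exact: (EL_B_integrable _ p1 q1 Hphi HP Hg ma0 a0_gt0 a0_mono La01p La01q LX1 LX2 LX3 LX4 LU).
Qed.

Let BB (x : R) : R := - \int[mu]_(t in `]x, 1[) B t.
Let acBB : ac 0 1 BB B. Proof. exact: (ac_tail mB iB). Qed.
Let BB0 := BB \_ `]0, 1[.
Let BB0E (x : R) : 0 < x < 1 -> BB0 x = BB x.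
Proof. by move=> x01; rewrite /BB0 patchE mem_set//= in_itv. Qed.
Let mBB0 : measurable_fun setT BB0.
Proof.
have m01 : measurable (`]0, 1[%classic : set R) by exact: measurable_itv.
by apply: (measurable_restrictT _ m01).1; exact: (ac_measurable acBB).
Qed.
Let acBB0 : ac 0 1 BB0 B.
Proof.
apply: (ac_ext acBB _ mB (aeW _ (fun _ _ => erefl))) => x x01.
by rewrite BB0E.
Qed.
Let cBB0 : locally_bounded_coef BB0. Proof. exact: coef_ac mBB0 acBB0 iB. Qed.

(** The Euler-Lagrange equation multiplied by [s^2]: an absolutely continuous representative of
    [3 tau r^2 G1], with derivative [D]. *)
Let Q (x : R) := s x ^+ 2 * (BB0 x + k).
Let D (x : R) := 2 / 3 * (a01 x * (si x * (BB0 x + k))) + B x * s x ^+ 2.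

Let mBk : measurable_fun setT (fun x => BB0 x + k). Proof. exact: measurable_funD. Qed.
Let cBk : locally_bounded_coef (fun x => BB0 x + k).
Proof.
split => // d d01; have [_ /(_ d d01)[M HM]] := cBB0; exists (M + `|k|) => x xd.
by rewrite (le_trans (ler_normD _ _))// lerD2r HM.
Qed.
Let cQ : locally_bounded_coef Q.
Proof. by apply: coefM => //; apply: coefX; exact: coef_s. Qed.
Let ms2 : measurable_fun setT (fun x => s x ^+ 2). Proof. exact: measurable_funX. Qed.
Let mQ : measurable_fun setT Q. Proof. exact: measurable_funM. Qed.
Let mD : measurable_fun setT D.
Proof.
apply: measurable_funD; last exact: measurable_funM.
by do 3?[apply: measurable_funM => //].
Qed.
Let acQ : ac 0 1 Q D.
Proof.
have acBk := ac_lin 1 acBB0 (ac_cst 0 1 k).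
have mBk' : measurable_fun setT (fun x => BB0 x + 1 * cst k x).
  by apply: measurable_funD => //; exact: measurable_funM.
apply: (ac_ext (ac_mul ac_s2 acBk ms2 mBk')) => //.
- by move=> x _; rewrite /Q /= mul1r.
- by apply: aeW => x _; rewrite /D /=; ring.
Qed.

Let one0 : 0 < 1 :> R. Proof. by []. Qed.

Let LD (d : R) : 0 < d < 1 -> Lr d 1 1 D.
Proof.
move=> d01; apply: (Lr_add one0).
  apply: (Lr_scale one0); apply: (Lr_coef one0 d01); last exact: coefM.
  by apply/Lr1P => //; exact: (Lr_integrable p3 (La01p d01)).
apply: (Lr_coef one0 d01); last by apply: coefX; exact: coef_s.
by apply/Lr1P => //; exact: iB.
Qed.

(** In [D] the product rule adds [2 / 3] of [a01 si A] to [B s^2]. The terms with [phi'] and [a01]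
    cancel, so [G2] contains no [phi']; of those with [g'(X4)] and [a01], which come as [4 tau] and
    [-2 tau], the part [2 tau] remains; [h'] enters through the product rule alone. The summand [U]
    is what separates [D] from [tau G2 / r]. *)
Let formulas : ae_on 0 1 (fun x =>
  3 * tau * (x `^ (2 / 3) * G1 phi g h al0 al be ga x) = Q x /\
  tau * (x `^ (- (1 / 3)) * G2 phi g h al0 al be ga x) = D x - U x).
Proof.
have andS (P1 P2 : R -> Prop) : ae_on 0 1 P1 -> ae_on 0 1 P2 -> ae_on 0 1 (fun x => P1 x /\ P2 x).
  by apply: aeS2 => x H1 H2 x01; split; [exact: H1|exact: H2].
apply: aeS (andS _ _ EL (andS _ _ eal0 (andS _ _ eal0' (andS _ _ eal (andS _ _ eal'
  (andS _ _ ebe (andS _ _ ega ega'))))))) => x + xI => /(_ xI).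
move=> [eEL [e1 [e2 [e3 [e4 [e5 [e6 e7]]]]]]].
have x01 : 0 < x < 1 by move: xI; rewrite inE/= in_itv.
have x0 : 0 < x by case/andP: x01.
have [r0 xr x23 xm13 _] := powR_thirds x0.
have y0 : 0 < al0 x by rewrite e1 a0_gt0.
have dg y : derivable g y 1 by case: Hg.
have dh : derivable h (wderiv 0 1 al x) 1 by rewrite e4; case: Hh => H _ _ _; exact: H.
have [-> ->] := @G_formulas _ phi g h al0 al be ga x x0 y0 dg dh.
rewrite x23 xm13 e1 e2 e3 e4 e5 e6 e7 /Q /D BB0E//.
have -> : BB x + k = A x by rewrite eEL.
rewrite /A /B /EL_A /EL_B -/(r x) -/(s x).
have sx := s_gt0 x01.
have X3E : c x / r x ^+ 2 = c x * (r x)^-1 ^+ 2 by rewrite exprVn.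
have xi : x^-1 = (r x ^+ 3)^-1 by rewrite -xr.
rewrite X3E /X1 /X2 /X3 /X4 /ri.
move: (phi^`()%classic _) ((psi phi)^`()%classic _) (g^`()%classic (c x * _))
  (g^`()%classic _) (h^`()%classic _) => phi' psi' g1 g2 h'.
rewrite xi /si; have rx : r x != 0 by rewrite gt_eqF.
have sn : s x != 0 by rewrite gt_eqF.
move: (r x) (s x) (a01 x) (U x) rx sn => r_ s_ a01_ U_ rx sn.
by split; field; rewrite ?rx ?sn.
Qed.

Let tn : tau != 0. Proof. by rewrite gt_eqF. Qed.

Lemma G1_W11 (d : R) : 0 < d < 1 -> in_W11 d 1 (fun x => x `^ (2 / 3) * G1 phi g h al0 al be ga x).
Proof.
move=> d01; have [d0 d1] : 0 < d /\ d < 1 by apply/andP.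
pose F x := cst 0 x + (3 * tau)^-1 * Q x.
have acF : ac d 1 F (fun x => cst 0 x + (3 * tau)^-1 * D x).
  exact: (ac_sub (ltW d0) (lexx 1) (ac_lin _ (ac_cst 0 1 0) acQ)).
have mF : measurable_fun setT F by apply: measurable_funD => //; exact: measurable_funM.
have eF : ae_on d 1 (fun x => x `^ (2 / 3) * G1 phi g h al0 al be ga x = F x).
  apply: (itv_subset_ae (ltW d0) (lexx 1)); apply: aeS formulas => x + x01 => /(_ x01)[H _].
  by rewrite /F -H /=; field.
have [W1 W2] := ac_wderiv d1 acF mF eF.
split => //.
  apply: (Lr_in_Lp one0 _ eF).
  rewrite (_ : F = fun x => (3 * tau)^-1 * Q x); last by apply/funext => x; rewrite /F add0r.
  by apply: (Lr_scale one0); exact: coef_Lr.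
apply: (Lr_in_Lp one0 (Lr_scale one0 (3 * tau)^-1 (LD d01))).
by apply: aeS W2 => x + x01 => /(_ x01) ->; rewrite add0r.
Qed.

Lemma G2_L1 (d : R) : 0 < d < 1 -> in_Lp d 1 1 (fun x => x `^ (- (1 / 3)) * G2 phi g h al0 al be ga x).
Proof.
move=> d01; have d0 : 0 < d by case/andP: d01.
have mU : measurable_fun setT U by case: LU.
have two1 : 1 <= 2 :> R by rewrite ler1n.
have LU1 : Lr d 1 1 U.
  apply/(Lr1P _ _ mU); apply: (Lr_integrable two1).
  exact: (Lr_sub (ltW d0) (lexx 1) LU).
apply: (Lr_in_Lp one0 (Lr_scale one0 tau^-1 (Lr_add one0 (LD d01) (Lr_scale one0 (-1) LU1)))).
apply: (itv_subset_ae (ltW d0) (lexx 1)); apply: aeS formulas => x + x01 => /(_ x01)[_ H].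
by rewrite mulN1r -H; field.
Qed.

Lemma G1_G2_identity : exists c : R, ae_on 0 1 (fun x =>
  3 * x `^ (2 / 3) * G1 phi g h al0 al be ga x =
  (- \int[mu]_(y in `]x, 1[) (y `^ (- (1 / 3)) * G2 phi g h al0 al be ga y
     + (v y - v0 y) / tau)) + c).
Proof.
pose F x := cst 0 x + tau^-1 * Q x; pose f x := cst 0 x + tau^-1 * D x.
have acF : ac 0 1 F f by exact: (ac_lin _ (ac_cst 0 1 0) acQ).
have fi x : 0 < x < 1 -> mu.-integrable `]x, 1[ (EFin \o f).
  move=> x01; rewrite (_ : f = fun y => tau^-1 * D y).
    exact: (Lr_integrable (lexx 1) (Lr_scale one0 _ (LD x01))).
  by apply/funext => y; rewrite /f add0r.
have [c_ Hc] := ac_tail_repr acF fi; exists c_.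
apply: aeS formulas => x + xI => /(_ xI)[H _].
have x01 : 0 < x < 1 by move: xI; rewrite inE/= in_itv.
transitivity (F x); first by rewrite /F add0r -H; field.
rewrite Hc//; congr (- _ + _); apply: eq_Rintegral_ae.
apply: aeS2 formulas eU => y H1 H2; rewrite /= in_itv/= => /andP[xy y1].
have y01 : y \in `]0, 1[ by rewrite inE/= in_itv/= y1 andbT (lt_trans _ xy)//; case/andP: x01.
have [_ H3] := H1 y01; rewrite (H2 y01) /f add0r (_ : D y = (D y - U y) + U y).
  by rewrite -H3; field.
by rewrite subrK.
Qed.

End conclusions.

(** * Integrability of the derivative of [alpha] away from [0] *)

Section stretch.
Variables (a a1 c c1 c0 c01 w w1 : R -> R).
Hypothesis aca : ac 0 1 a a1.
Hypothesis acc : ac 0 1 c c1.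
Hypothesis acc0 : ac 0 1 c0 c01.
Hypothesis mw : measurable_fun setT w.
Hypothesis acw : ac 0 1 w w1.
Hypothesis Lc1 : Lr 0 1 q (fun x => c1 x * r x).
Hypothesis Lc01 : Lr 0 1 q (fun x => c01 x * r x).
Hypothesis Lw1 : Lr 0 1 (3 * p) (fun x => w1 x * r x ^+ 2).
Hypothesis Ca : ae_on 0 1 (fun x => a x = a0 x + 3 * tau * (s x ^+ 2 * w x)).
Hypothesis Cc : ae_on 0 1 (fun x => c x = c0 x + 2 * tau * (s x * w x)).

Let cri := @coef_ri R.
Let mw1 : measurable_fun setT w1. Proof. by case: acw. Qed.

Let unweight (t d : R) (f : R -> R) n : 0 < t -> 0 < d < 1 -> measurable_fun setT f ->
  Lr 0 1 t (fun x => f x * r x ^+ n) -> Lr d 1 t f.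
Proof.
move=> t0 d01 mf Lf; have d0 : 0 < d by case/andP: d01.
have := Lr_coef t0 d01 (Lr_sub (ltW d0) (lexx 1) Lf) (coefX n cri).
move=> H; apply: (Lr_ae_eq H mf); apply/ae_onP; apply: aeW => x /andP[dx _].
have rx : r x != 0 by rewrite gt_eqF// powR_gt0// (lt_trans d0).
by rewrite /ri exprVn mulfK// expf_neq0.
Qed.

Let cw : locally_bounded_coef w.
Proof.
apply: (coef_ac mw acw) => d d01.
exact: (Lr_integrable p3 (unweight p30 d01 mw1 Lw1)).
Qed.

Let a1E : ae_on 0 1 (fun x => a1 x =
  a01 x + 3 * tau * (2 / 3 * (a01 x * (si x * w x)) + w1 x * s x ^+ 2)).
Proof.
have ms2 : measurable_fun setT (fun x => s x ^+ 2) by exact: measurable_funX.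
have := ac_unique_ae aca (ac_lin (3 * tau) aca0 (ac_mul ac_s2 acw ms2 mw)) Ca.
by apply: aeS => x + x01 => /(_ x01) ->; ring.
Qed.

Let c1E : ae_on 0 1 (fun x => c1 x =
  c01 x + 2 * tau * (1 / 3 * (a01 x * (si x ^+ 2 * w x)) + s x * w1 x)).
Proof.
have := ac_unique_ae acc (ac_lin (2 * tau) acc0 (ac_mul ac_s acw ms mw)) Cc.
by apply: aeS => x + x01 => /(_ x01) ->; ring.
Qed.

(** Differentiating the constraint on [alpha] expresses [a1] through [a01] and [s^2 w1]. For the
    exponent [3 p] the integrability of [w1] is part of the space of [v]. For the exponent [q] it is
    not: there [s w1] is recovered from [c1] and [c01] by differentiating the constraint on [gamma],
    and then multiplied by the bounded weight [s]. *)
Lemma stretch_Lr (d : R) : 0 < d < 1 -> Lr d 1 (3 * p) a1 /\ Lr d 1 q a1.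
Proof.
move=> d01; have d0 : 0 < d by case/andP: d01.
have [[ma1 _] [mc1 _] [mc01 _]] := And3 aca acc acc0.
have cs := coef_s.
split.
- have L1 := Lr_scale p30 (2 / 3) (Lr_coef p30 d01 (La01p d01) (coefM csi cw)).
  have L2 := Lr_coef p30 d01 (unweight p30 d01 mw1 Lw1) (coefX 2 cs).
  apply: (Lr_ae_eq (Lr_add p30 (La01p d01) (Lr_scale p30 (3 * tau) (Lr_add p30 L1 L2))) ma1).
  by apply: (itv_subset_ae (ltW d0) (lexx 1)); apply: aeS a1E => x + x01 => /(_ x01) ->.
- have L1 := Lr_scale q0 (2 / 3) (Lr_coef q0 d01 (La01q d01) (coefM csi cw)).
  have L2 := Lr_scale q0 (- (1 / 3)) (Lr_coef q0 d01 (La01q d01) (coefM (coefX 2 csi) cw)).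
  have L3 := Lr_scale q0 (2 * tau)^-1 (unweight (n := 1) q0 d01 mc1 Lc1).
  have L4 := Lr_scale q0 (- (2 * tau)^-1) (unweight (n := 1) q0 d01 mc01 Lc01).
  have L5 := Lr_coef q0 d01 (Lr_add q0 (Lr_add q0 L3 L4) L2) cs.
  apply: (Lr_ae_eq (Lr_add q0 (La01q d01) (Lr_scale q0 (3 * tau) (Lr_add q0 L1 L5))) ma1).
  apply: (itv_subset_ae (ltW d0) (lexx 1)).
  apply: aeS2 a1E c1E => x + + x01 => /(_ x01) -> /(_ x01) ->.
  by field; rewrite gt_eqF.
Qed.

End stretch.
End regularity.

(** * The theorem: choice of representatives and assembly *)

Theorem theorem4 (R : realType) (p q lam tau : R)
    (phi g h al0 be0 ga0 v0 al be ga v : R -> R) :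
  1 < p -> 1 < q -> 0 < lam -> 0 < tau ->
  blowup_growth h -> smooth_convex phi g h ->
  power_growth p q phi g -> derivative_growth p q phi g ->
  admissible_data p q lam phi g h al0 be0 ga0 v0 ->
  (forall d, 0 < d < 1 ->
     in_Lp d 1 (3 * p) (wderiv 0 1 al0) /\ in_Lp d 1 q (wderiv 0 1 al0)) ->
  is_minimizer p q lam tau phi g h al0 be0 ga0 v0 al be ga v ->
  [/\ forall d, 0 < d < 1 ->
        in_W11 d 1 (fun x => x `^ (2 / 3) * G1 phi g h al0 al be ga x) /\
        in_Lp d 1 1 (fun x => x `^ (- (1 / 3)) * G2 phi g h al0 al be ga x),
      exists c : R, ae_on 0 1 (fun x =>
        3 * x `^ (2 / 3) * G1 phi g h al0 al be ga x =
        (- \int[@lebesgue_measure R]_(s in `]x, 1[)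
             (s `^ (- (1 / 3)) * G2 phi g h al0 al be ga s
              + (v s - v0 s) / tau)) + c)
    & forall d, 0 < d < 1 ->
        in_Lp d 1 (3 * p) (wderiv 0 1 al) /\ in_Lp d 1 q (wderiv 0 1 al)].
Proof.
move=> p1 q1 _ tau0 _ [[C2phi C2P C2g C2h] nn cv hcv] [k1 [k2 [_ gphi gP gg]]] _.
move=> [[[[Wal0 _ _] _] _ [Wga0 _ Xga0'] [_ Lv0 _]] _ al0_ge al0'_gt _] Lal0'.
move=> [[[[[Wal Lal Lal'] Xal] [bloc Xbe] [Wga Xga Xga'] [Wv Lv Yv']] [cr0 cr1] al'_gt fin
  [Cbe Cal Cga]] minimal].
have p0 : 0 < p by rewrite (lt_trans _ p1).
have p30 : 0 < 3 * p by rewrite mulr_gt0.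
have q0 : 0 < q by rewrite (lt_trans _ q1).
have one0 : 0 < 1 :> R by [].
have two0 : 0 < 2 :> R by [].
have Hphi : convex_growth (3 * p) phi.
  by apply: C2_convex_growth gphi => // x; [case: (nn x)|case: (cv x)].
have HP : convex_growth p (psi phi).
  by apply: C2_convex_growth gP => // x; [case: (nn x)|case: (cv x)].
have Hg : convex_growth q g.
  by apply: C2_convex_growth gg => // x; [case: (nn x)|case: (cv x)].
have Hh := C2_convex_positive C2h hcv.
have [a0 [a01 [aca0 ma0 eal0 eal0']]] := W11loc_ac ltr01 Wal0.
have a01_gt : ae_on 0 1 (fun x => 0 < a01 x).
  by apply: aeS2 eal0' al0'_gt => x H1 H2 x01; rewrite -H1//; exact: H2.
have a0_ge : ae_on 0 1 (fun x => 0 <= a0 x).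
  by apply: aeS2 eal0 al0_ge => x H1 H2 x01; rewrite -H1//; exact: H2.
(* Nonnegativity becomes strict by comparison with the value at [x / 2], since [a0] is strictly
   increasing. *)
have a0_gt0 (x : R) : 0 < x < 1 -> 0 < a0 x.
  move=> /andP[x0 x1]; have [y0 yx] : 0 < x / 2 /\ x / 2 < x by split; lra.
  apply: le_lt_trans (ac_lt aca0 a01_gt y0 yx x1).
  have y01 : 0 < x / 2 < 1 by rewrite y0 (lt_trans yx).
  exact: (ae_ge0_continuous a0_ge (ac_continuous aca0 y01) y01).
have a0_mono (x y : R) : 0 < x -> x <= y -> y < 1 -> a0 x <= a0 y.
  move=> x0; rewrite le_eqVlt => /orP[/eqP ->//|xy] y1.
  by apply: ltW; exact: (ac_lt aca0 a01_gt).
have ma01 : measurable_fun setT a01 by case: aca0.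
have sub d (P : R -> Prop) : 0 < d < 1 -> ae_on 0 1 P -> ae_on d 1 P.
  by move=> /andP[/ltW d0 _]; exact: itv_subset_ae.
have La01p (d : R) : 0 < d < 1 -> Lr d 1 (3 * p) a01.
  by move=> d01; apply: (in_Lp_Lr p30 (proj1 (Lal0' d d01)) ma01); exact: sub.
have La01q (d : R) : 0 < d < 1 -> Lr d 1 q a01.
  by move=> d01; apply: (in_Lp_Lr q0 (proj2 (Lal0' d d01)) ma01); exact: sub.
have [a [a1' [aca' ma eal eal1]]] := W11loc_ac ltr01 Wal.
have a1'_gt : ae_on 0 1 (fun x => 0 < a1' x).
  by apply: aeS2 eal1 al'_gt => x H1 H2 x01; rewrite -H1//; exact: H2.
have [a1 [ma1 a1_gt0 ea1]] := positive_version (proj1 aca') a1'_gt.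
have aca : ac 0 1 a a1 by exact: (ac_ext aca' (fun _ _ => erefl) ma1 ea1).
have eal' : ae_on 0 1 (fun x => wderiv 0 1 al x = a1 x).
  by apply: aeS2 eal1 ea1 => x H1 H2 x01; rewrite H1// H2.
have La := in_Lp_Lr one0 Lal ma eal.
have La1 := in_Lp_Lr one0 Lal' ma1 eal'.
have [b [mb ebe ib]] := in_L1loc_borel bloc.
have [c [c1 [acc mc ega ega']]] := W11loc_ac ltr01 Wga.
have [c0 [c01 [acc0 mc0 ega0 ega0']]] := W11loc_ac ltr01 Wga0.
have [w [w1 [acw mw ev ev']]] := W11loc_ac ltr01 Wv.
have [w0 Lw0 ev0] := (in_LpP 0 1 v0 two0).1 Lv0.
have Lw := in_Lp_Lr two0 Lv mw ev.
pose r (x : R) : R := x `^ (1 / 3).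
have mr : measurable_fun setT r by exact: measurable_fun_powR.
have x23 (x : R) : x \in `]0, 1[ -> x `^ (2 / 3) = r x ^+ 2.
  rewrite inE/= in_itv/= => /andP[x0 _].
  by have [_ _ ->] := powR_thirds x0.
have weighted (t : R) (f f' m m' : R -> R) : 0 < t -> in_Lp 0 1 t (fun x => f x * m x) ->
    measurable_fun setT f' -> measurable_fun setT m' -> ae_on 0 1 (fun x => f x = f' x) ->
    (forall x, x \in `]0, 1[ -> m x = m' x) -> Lr 0 1 t (fun x => f' x * m' x).
  move=> t0 Lf mf' mm' ef em; apply: (in_Lp_Lr t0 Lf); first exact: measurable_funM.
  by apply: aeS ef => x + x01 => /(_ x01) ->; rewrite em.
have LX1 : Lr 0 1 (3 * p) (fun x => b x * r x ^+ 2).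
  by apply: (weighted _ _ _ _ _ p30 Xbe) => //; exact: measurable_funX.
have LX2 : Lr 0 1 p (fun x => a x / x).
  by apply: (weighted _ _ _ _ _ p0 Xal) => //; exact: measurable_inv.
have LX3 : Lr 0 1 q (fun x => c x * (r x)^-1 ^+ 2).
  apply: (weighted _ _ _ _ _ q0 Xga) => //.
    by apply: measurable_funX; exact: measurable_funV.
  by move=> x x01; rewrite x23// exprVn.
have Lc1 : Lr 0 1 q (fun x => c1 x * r x).
  by apply: (weighted _ _ _ _ _ q0 Xga') => //; case: acc.
have Lc01 : Lr 0 1 q (fun x => c01 x * r x).
  by apply: (weighted _ _ _ _ _ q0 Xga0') => //; case: acc0.
have LX4 : Lr 0 1 q (fun x => 3 / 2 * c1 x * r x).
  have := Lr_scale q0 (3 / 2) Lc1.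
  by congr (Lr 0 1 q _); apply/funext => x; rewrite mulrA.
have Lw1 : Lr 0 1 (3 * p) (fun x => w1 x * r x ^+ 2).
  by apply: (weighted _ _ _ _ _ p30 Yv') => //; [case: acw|exact: measurable_funX].
have LU : Lr 0 1 2 (fun x => w x - w0 x).
  have := Lr_add two0 Lw (Lr_scale two0 (-1) Lw0).
  by congr (Lr 0 1 2 _); apply/funext => x; rewrite mulN1r.
have eU : ae_on 0 1 (fun x => v x - v0 x = w x - w0 x).
  by apply: aeS2 ev ev0 => x H1 H2 x01; rewrite H1// H2.
have [k EL] := minimizer_EL_equation p1 q1 tau0 Hphi HP Hg Hh ma0 aca0
  a0_gt0 a0_mono La01p La01q ma aca a1_gt0 La La1 mb ib mc acc mw acw LX1 LX2 LX3 LX4 LU Lw Lw1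
  eal0 eal ebe ega ev ev' ev0 Cbe Cal Cga cr0 cr1 fin minimal.

(* The constraints solved for the representatives, in the form of products of absolutely continuous
   functions that can be differentiated. *)
have [Ca Cc] : ae_on 0 1 (fun x => a x = a0 x + 3 * tau * ((a0 x `^ (1 / 3)) ^+ 2 * w x)) /\
    ae_on 0 1 (fun x => c x = c0 x + 2 * tau * (a0 x `^ (1 / 3) * w x)).
  have tn : tau != 0 by rewrite gt_eqF.
  split.
    apply: aeS3 (aeS2 (fun x P1 P2 => conj P1 P2) eal eal0) ev Cal => x [+ +] + + x01.
    move=> /(_ x01) e1 /(_ x01) e2 /(_ x01) e3 /(_ x01).
    have x01' : 0 < x < 1 by move: x01; rewrite inE/= in_itv.
    have [_ _ s23 _ _] := powR_thirds (a0_gt0 x x01').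
    rewrite e1 e2 e3 s23 => /(congr1 ( *%R^~ tau)).
    by rewrite mulfVK// => /eqP; rewrite subr_eq => /eqP ->; ring.
  apply: aeS3 (aeS2 (fun x P1 P2 => conj P1 P2) (aeS2 (fun x P1 P2 => conj P1 P2) ega ega0) eal0)
    ev Cga => x [[+ +] +] + + x01.
  move=> /(_ x01) e1 /(_ x01) e2 /(_ x01) e3 /(_ x01) e4 /(_ x01).
  rewrite e1 e2 e3 e4 => /(congr1 ( *%R^~ tau)).
  by rewrite mulfVK// => /eqP; rewrite subr_eq => /eqP ->; ring.
split.
- move=> d d01; split.
    exact: (G1_W11 p1 q1 tau0 ma0 aca0 a0_gt0 a0_mono La01p La01q Hphi HP Hg Hh a1_gt0
      LX1 LX2 LX3 LX4 LU eal0 eal0' eal eal' ebe ega ega' EL d01).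
  exact: (G2_L1 p1 q1 tau0 ma0 aca0 a0_gt0 a0_mono La01p La01q Hphi HP Hg Hh a1_gt0
      LX1 LX2 LX3 LX4 LU eal0 eal0' eal eal' ebe ega ega' EL d01).
- exact: (G1_G2_identity p1 q1 tau0 ma0 aca0 a0_gt0 a0_mono La01p La01q Hphi HP Hg Hh a1_gt0
      LX1 LX2 LX3 LX4 LU eal0 eal0' eal eal' ebe ega ega' eU EL).
- move=> d d01.
  have [Lp_ Lq_] := stretch_Lr p1 q1 tau0 ma0 aca0 a0_gt0 a0_mono La01p La01q aca acc acc0 mw acw
    Lc1 Lc01 Lw1 Ca Cc d01.
  by split; [apply: (Lr_in_Lp p30 Lp_)|apply: (Lr_in_Lp q0 Lq_)]; exact: sub.
Qed.
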